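(* Let $\mathcal X=[a,b]\subset\mathbb R$, $M>0$, $c\in(a,b)$ fixed, and let $\mathcal F$ be one of the following classes: (Monotonicity) $\mathcal F=\{f:0\le f(x)\le M\ \forall x\in\mathcal X,\ f\text{ is non-increasing on }\mathcal X\}$; (Convexity) $\mathcal F=\{f:0\le f(x)\le M\ \forall x\in\mathcal X,\ f\text{ is convex on }\mathcal X\}$; (Unimodality) $\mathcal F=\{f:0\le f(x)\le M\ \forall x\in\mathcal X,\ f\text{ is unimodal about }c\text{ on }\mathcal X\}$. Suppose the sampling density $g$ satisfies $\inf_{x\in\mathcal X}g(x)>0$, that $\int_{\mathcal X}|\phi_j(x)|^{2+\delta}dx<\infty$ for $j=0,\ldots,l$ and some $\delta>0$, and that there exists $L_0\in\mathcal L$ such that $\mathbb E_g[\phi_j(X)L_0(X)]<\mu_j$ for $j=1,\ldots,m$ and $\mathbb E_g[\phi_j(X)L_0(X)]=\mu_j$ for $j=m+1,\ldots,l$, with moreover $(\mu_{m+1},\ldots,\mu_l)$ an interior point of $\{(\mathbb E_g[\phi_{m+1}(X)L(X)],\ldots,\mathbb E_g[\phi_l(X)L(X)]):L\in\mathcal L\}$. Let $X_{(1)}\le\cdots\le X_{(n)}$ be the order statistics of $X_1,\ldots,X_n$, and $X_{(0)}:=a$, $X_{(n+1)}:=b$. Then, almost surely, the problem $(\mathcal P_n)$ is equivalent to the linear program $(\mathcal P_n')$ (i.e. $(\mathcal P_n)$ is finite-dimensionally reducible) with the corresponding discrete shape constraint: (Monotonicity) $L(X_{(i+1)})g(X_{(i+1)})\le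 L(X_{(i)})g(X_{(i)})$ for $i=1,\ldots,n-1$, and $0\le L(X_i)g(X_i)\le M$ for $i=1,\ldots,n$; (Convexity) $$\frac{L(X_{(i+1)})g(X_{(i+1)})-L(X_{(i)})g(X_{(i)})}{X_{(i+1)}-X_{(i)}}\le\frac{L(X_{(i+2)})g(X_{(i+2)})-L(X_{(i+1)})g(X_{(i+1)})}{X_{(i+2)}-X_{(i+1)}},\quad i=0,\ldots,n-1,$$ and $0\le L(X_{(i)})g(X_{(i)})\le M$ for $i=0,1,\ldots,n+1$, where $L(X_{(0)})$ and $L(X_{(n+1)})$ are additional decision variables; (Unimodality) $L(X_{(i-1)})g(X_{(i-1)})\le L(X_{(i)})g(X_{(i)})$ if $X_{(i)}\le c$, $L(X_{(i+1)})g(X_{(i+1)})\le L(X_{(i)})g(X_{(i)})$ if $X_{(i)}\ge c$, for $i=1,\ldots,n$, and $0\le L(X_i)g(X_i)\le M$ for $i=1,\ldots,n$, with the convention $L(X_{(0)})=L(X_{(n+1)})=0$. Additionally, $|val(\mathcal P_n)-val(\mathcal P)|\overset{\text{a.s.*}}{\to}0$ and $\sqrt n\,(val(\mathcal P_n)-val(\mathcal P))=O_{\mathbb P^*}(1)$.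
   Context: Setting. $\phi_0,\ldots,\phi_l:\mathcal X\to\mathbb R$ are known functions, $0\le m\le l$, $\mu_1,\ldots,\mu_l\in\mathbb R$, and one of $\phi_1,\ldots,\phi_l$ is the indicator $I(x\in\mathcal X)$ (total mass constraint). $g$ is a positive probability density on $\mathcal X$ (the sampling distribution), $X,X_1,X_2,\ldots$ are i.i.d. with density $g$, $\mathbb E_g$ is expectation under $g$, and $\mathcal L=\{f/g:f\in\mathcal F\}$. Problem $(\mathcal P)$: $\sup_{L\in\mathcal L}\mathbb E_g[\phi_0(X)L(X)]$ subject to $\mathbb E_g[\phi_j(X)L(X)]\le\mu_j$ for $j=1,\ldots,m$ and $\mathbb E_g[\phi_j(X)L(X)]=\mu_j$ for $j=m+1,\ldots,l$. Problem $(\mathcal P_n)$ (the IW-SAA problem): $\sup_{L\in\mathcal L}\frac1n\sum_{i=1}^n\phi_0(X_i)L(X_i)$ subject to $\frac1n\sum_{i=1}^n\phi_j(X_i)L(X_i)\le\mu_j$ for $j=1,\ldots,m$ and $\frac1n\sum_{i=1}^n\phi_j(X_i)L(X_i)=\mu_j$ for $j=m+1,\ldots,l$. Problem $(\mathcal P_n')$: the same objective and moment constraints as $(\mathcal P_n)$, but with the real numbers $L(X_1),\ldots,L(X_n)$ as decision variables and with $L\in\mathcal L$ replaced by the stated discrete shape constraint. ''Equivalent'' / ''finite-dimensionally reducible'' means: the values at $X_1,\ldots,X_n$ of any $L\in\mathcal L$ satisfy the discrete shape constraint, and conversely any real numbers $L(X_1),\ldots,L(X_n)$ satisfying it are the values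 at $X_1,\ldots,X_n$ of some $L\in\mathcal L$ (in the convexity case: satisfying it for some choice of the endpoint variables); in particular $val(\mathcal P_n)=val(\mathcal P_n')$. $val(\cdot)$ is the optimal value in $[-\infty,\infty]$ ($\sup\emptyset=-\infty$). If $l=m$ the interior point condition is vacuous. A function $f$ is unimodal about $c$ if it is non-decreasing for $x\le c$ and non-increasing for $x\ge c$. Outer convergence. On $(\Omega,\mathcal G,\mathbb P)$, $\mathbb P^*(B)=\inf\{\mathbb P(A):A\supset B,A\in\mathcal G\}$. $T^*$ is the minimal measurable majorant of a map $T:\Omega\to[-\infty,\infty]$ (measurable, $T^*\ge T$, and $T^*\le U$ a.s. for every measurable $U\ge T$ a.s.). $Z_n\overset{\text{a.s.*}}{\to}Z$ means $|Z_n-Z|^*\to0$ a.s. $Z_n=O_{\mathbb P^*}(1)$ means: for every $\varepsilon>0$ there is $K>0$ with $\limsup_n\mathbb P^*(|Z_n|\ge K)\le\varepsilon$. *)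

(* Defs.v *)
From HB Require Import structures.
From mathcomp Require Import all_boot all_order all_algebra.
From mathcomp Require Import finmap.
From mathcomp Require Import all_classical all_reals all_analysis.
From mathcomp Require Import measurable_realfun.

Set Implicit Arguments.
Unset Strict Implicit.
Unset Printing Implicit Defensive.
Import Order.TTheory GRing.Theory Num.Theory.
Import numFieldNormedType.Exports.

Local Open Scope classical_set_scope.
Local Open Scope ring_scope.

(* A function on the domain [a, b] is encoded as a total function R -> R of
   which only the values on [a, b] are constrained. *)

Inductive shape_type := Monotonicity | Convexity | Unimodality.

Definition nonincreasing_on (R : realType) (a b : R) (f : R -> R) :=
  forall x y, a <= x -> x <= y -> y <= b -> f y <= f x.

Definition unimodal_on (R : realType) (a b c : R) (f : R -> R) :=
  (forall x y, a <= x -> x <= y -> y <= b -> y <= c -> f x <= f y) /\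
  (forall x y, a <= x -> x <= y -> y <= b -> c <= x -> f y <= f x).

Definition has_shape (R : realType) (s : shape_type) (a b c : R) (f : R -> R) :=
  match s with
  | Monotonicity => nonincreasing_on a b f
  | Convexity => @convex_function R R^o `[a, b] f
  | Unimodality => unimodal_on a b c f
  end.

Definition shape_class (R : realType) (s : shape_type) (a b c M : R)
    : set (R -> R) :=
  [set f | (forall x, a <= x <= b -> 0 <= f x <= M) /\ has_shape s a b c f].

Definition likelihood_ratios (R : realType) (F : set (R -> R)) (g : R -> R)
    : set (R -> R) :=
  [set L | exists2 f, F f & L = (fun x => f x / g x)].

Definition expect (R : realType) (a b : R) (g h : R -> R) : R :=
  \int[@lebesgue_measure R]_(x in `[a, b]) (h x * g x).

Definition sample_mean (R : realType) (n : nat) (h : 'I_n -> R) : R :=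
  n%:R^-1 * \sum_(i < n) h i.

(* Optimal value of  sup { mom 0 d : d in S }  subject to  mom j d <= mu j for
   1 <= j <= m  and  mom j d = mu j for  m < j <= l; the value mu 0 is unused. *)
Definition optimal_value (R : realType) (D : Type) (S : set D)
    (mom : nat -> D -> R) (mu : nat -> R) (m l : nat) : \bar R :=
  ereal_sup [set (mom 0%N d)%:E | d in
    [set d | [/\ S d,
       forall j, (1 <= j <= m)%N -> mom j d <= mu j
     & forall j, (m < j <= l)%N -> mom j d = mu j]]].

Section Programs.
Context (R : realType) (a b : R) (g : R -> R) (phi : nat -> R -> R).
Context (mu : nat -> R) (m l : nat).

Definition moment (j : nat) (L : R -> R) : R :=
  expect a b g (fun x => phi j x * L x).

Definition val_P (calL : set (R -> R)) : \bar R :=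
  optimal_value calL moment mu m l.

Definition val_Pn (calL : set (R -> R)) (n : nat) (x : 'I_n -> R) : \bar R :=
  optimal_value calL
    (fun j L => sample_mean (fun i => phi j (x i) * L (x i))) mu m l.

(* The decision variables are the n reals y i, standing for L (x i). *)
Definition val_Pn' (n : nat) (x : 'I_n -> R) (C : set ('I_n -> R)) : \bar R :=
  optimal_value C
    (fun j y => sample_mean (fun i => phi j (x i) * y i)) mu m l.

(* The equality-constraint part (E[phi_(m+1) L], ..., E[phi_l L]). *)
Definition eq_moments (L : R -> R) : 'rV[R]_(l - m) :=
  \row_(i < l - m) moment (m + i).+1 L.

End Programs.

Definition order_indices (R : realType) (n : nat) (x : 'I_n -> R) : seq 'I_n :=
  sort (fun i j => x i <= x j) (enum 'I_n).

(* X_(k) for 0 <= k <= n.+1, with X_(0) = a and X_(n+1) = b. *)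
Definition order_stat (R : realType) (a b : R) (n : nat) (x : 'I_n -> R)
    (k : nat) : R :=
  nth 0 (a :: rcons [seq x i | i <- order_indices x] b) k.

(* L(X_(k)) for 0 <= k <= n.+1, where y i stands for L(X_i), and L0 and L1 for
   L(X_(0)) and L(X_(n+1)). *)
Definition ordered_val (R : realType) (L0 L1 : R) (n : nat) (x y : 'I_n -> R)
    (k : nat) : R :=
  nth 0 (L0 :: rcons [seq y i | i <- order_indices x] L1) k.

Section DiscreteShape.
Context (R : realType) (a b c M : R) (g : R -> R) (n : nat) (x : 'I_n -> R).

Let T (k : nat) : R := order_stat a b x k.
Let H (L0 L1 : R) (y : 'I_n -> R) (k : nat) : R :=
  ordered_val L0 L1 x y k * g (T k).
Let in_range (y : 'I_n -> R) := forall i : 'I_n, 0 <= y i * g (x i) <= M.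

(* The endpoint entries of H are not accessed here. *)
Definition discrete_monotone : set ('I_n -> R) :=
  [set y | (forall k, (1 <= k < n)%N -> H 0 0 y k.+1 <= H 0 0 y k) /\
    in_range y].

Definition discrete_convex : set ('I_n -> R) :=
  [set y | exists L0 L1 : R,
    (forall k, (k < n)%N ->
      (H L0 L1 y k.+1 - H L0 L1 y k) / (T k.+1 - T k) <=
      (H L0 L1 y k.+2 - H L0 L1 y k.+1) / (T k.+2 - T k.+1)) /\
    (forall k, (k <= n.+1)%N -> 0 <= H L0 L1 y k <= M)].

Definition discrete_unimodal : set ('I_n -> R) :=
  [set y | (forall k, (1 <= k <= n)%N ->
      (T k <= c -> H 0 0 y k.-1 <= H 0 0 y k) /\
      (c <= T k -> H 0 0 y k.+1 <= H 0 0 y k)) /\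
    in_range y].

Definition discrete_shape (s : shape_type) : set ('I_n -> R) :=
  match s with
  | Monotonicity => discrete_monotone
  | Convexity => discrete_convex
  | Unimodality => discrete_unimodal
  end.

End DiscreteShape.

Definition finitely_reducible (R : realType) (calL : set (R -> R)) (n : nat)
    (x : 'I_n -> R) (C : set ('I_n -> R)) :=
  (forall L, calL L -> C (fun i => L (x i))) /\
  (forall y, C y -> exists2 L, calL L & forall i, L (x i) = y i).

Section OuterConvergence.
Context d (Omega : measurableType d) (R : realType) (P : probability Omega R).
Local Open Scope ereal_scope.

Definition outer_prob (B : set Omega) : \bar R :=
  ereal_inf [set P A | A in [set A | measurable A /\ B `<=` A]].

Definition minimal_majorant (T U : Omega -> \bar R) :=
  [/\ measurable_fun setT U,
      forall w, T w <= U w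
    & forall V : Omega -> \bar R, measurable_fun setT V ->
        (\forall w \ae P, T w <= V w) -> \forall w \ae P, U w <= V w].

Definition outer_as_cvg (Z : nat -> Omega -> \bar R) (Zlim : Omega -> \bar R) :=
  exists U : nat -> Omega -> \bar R,
    (forall n, minimal_majorant (fun w => `|Z n w - Zlim w|) (U n)) /\
    \forall w \ae P, U ^~ w @ \oo --> 0.

Definition outer_bounded_in_prob (Z : nat -> Omega -> \bar R) :=
  forall eps : R, (0 < eps)%R -> exists2 K : R, (0 < K)%R &
    limn_esup (fun n => outer_prob [set w | K%:E <= `|Z n w|]) <= eps%:E.

End OuterConvergence.

Section Sampling.
Context d (Omega : measurableType d) (R : realType) (P : probability Omega R).

Definition prob_density (a b : R) (g : R -> R) :=
  [/\ measurable_fun `[a, b] g,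
      forall x, a <= x <= b -> 0 < g x
    & (\int[@lebesgue_measure R]_(x in `[a, b]) (g x)%:E = 1)%E].

Definition has_density (a b : R) (g : R -> R) (X : {RV P >-> R}) :=
  forall A : set R, measurable A ->
    distribution P X A =
      (\int[@lebesgue_measure R]_(x in A `&` `[a, b]) (g x)%:E)%E.

Definition mutually_independent (X : nat -> {RV P >-> R}) :=
  forall (J : {fset nat}) (A : nat -> set R),
    (forall i, measurable (A i)) ->
    P (\bigcap_(i in [set` J]) (X i @^-1` A i)) =
      (\prod_(i <- J) P (X i @^-1` A i))%E.

Definition iid_with_density (a b : R) (g : R -> R) (X : nat -> {RV P >-> R}) :=
  mutually_independent X /\ (forall i, has_density a b g (X i)).

End Sampling.

(* Main.v *)
(* Write f = g L on [a, b], 0 outside, and psi_j = phi_j / g, so that the moment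
   of L is E[psi_j(X) f(X)] and its sample version is the empirical mean of
   psi_j f.  Every f of the class is, up to an affine change, quasiconcave with
   values in [0, M], hence M times an average of indicators of intervals (its
   superlevel sets), and everything reduces to the empirical process of
   psi_j 1_{x <= t}, uniformly in t. Along a finite increasing chain of
   thresholds its squared increments over disjoint blocks are nearly
   uncorrelated, so a chaining maximal inequality applies after truncating
   psi_j; it bounds the probability that some deviation exceeds n t by K /
   (n t^2), with psi_j merely square integrable. Together with Borel--Cantelli
   along n = k^2 and a Cauchy-Schwarz bound between consecutive
   squares this gives the uniform law of large numbers, and the uniform rate
   n^(-1/2) in probability.
   The Slater point and the interior point condition make the optimal value
   Lipschitz in the moments, uniformly over small perturbations, so both
   conclusions transfer to the values.  Almost surely the X_i are distinct and
   lie in ]a, b[; then the discrete constraints are exactly the traces of the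
   shape constraints, an extension being a step function in the monotone and
   unimodal cases and the maximum of the chords in the convex case. *)

(* For centred sums [S_u], [S_v] of two functions with disjoint supports, however, E[S_u^2 S_v^2] is
   at most 3 n^2 times the product of the two second moments. This controls the smaller of two
   adjacent increments, whose fourth power is at most the product of their squares. Billingsley's
   bisection argument turns it into a bound on the maximum with a constant independent of the number
   of thresholds, so finite chains pass to all rational thresholds, and then pathwise to all real
   ones. Random suprema over the class are never formed. Everything goes through the measurable
   events [bad n t], defined with rational thresholds; off such an event the moment error is bounded
   for all members of the class at once, and outer probabilities and minimal majorants are compared
   with measurable functions built from these events. The bound K / (n t^2) is not summable in n,
   which is why the almost sure statement has to pass through the squares. *)
Require Import Defs.
From HB Require Import structures.
From mathcomp Require Import all_boot all_order all_algebra.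
From mathcomp Require Import finmap.
From mathcomp Require Import all_classical all_reals all_analysis.
From mathcomp Require Import measurable_realfun.
From mathcomp Require Import zify ring lra.

Set Implicit Arguments.
Unset Strict Implicit.
Unset Printing Implicit Defensive.
Import Order.TTheory GRing.Theory Num.Theory.
Import numFieldNormedType.Exports.

Local Open Scope classical_set_scope.
Local Open Scope ring_scope.

(** * Stability of optimal values under perturbation of the moments *)

Section PerturbedPrograms.
Context (R : realType) (T : Type).
Implicit Types (S : set (T -> R)) (f : (T -> R) -> R).

(** Mixtures of any finite length, because the robust Slater point is built from [1 + 2 * (l - m)]
    members at once. *)
Definition closed_under_mixtures S :=
  forall (I : finType) (w : I -> R) (L : I -> T -> R),
    (forall i, S (L i)) -> (forall i, 0 <= w i) -> \sum_i w i = 1 ->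
    S (fun x => \sum_i w i * L i x).

(** Asked on members of [S] only: the moments are integrals, additive only where the integrands are
    integrable. *)
Definition affine_on S f :=
  forall (I : finType) (w : I -> R) (L : I -> T -> R),
    (forall i, S (L i)) -> (forall i, 0 <= w i) -> \sum_i w i = 1 ->
    f (fun x => \sum_i w i * L i x) = \sum_i w i * f (L i).

Lemma affine_on2 S f (t : R) L K : affine_on S f -> S L -> S K ->
  0 <= t <= 1 ->
  f (fun x => (1 - t) * L x + t * K x) = (1 - t) * f L + t * f K.
Proof.
move=> Sf SL SK /andP[t0 t1].
have := Sf bool (fun b => if b then 1 - t else t) (fun b => if b then L else K).
rewrite !big_bool /= => <- //; first 1 last.
- by case.
- by case=> //; rewrite subr_ge0.
- by rewrite subrK.
by congr f; apply/funext => x; rewrite big_bool.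
Qed.

Lemma closed_under_mixtures2 S (t : R) L K : closed_under_mixtures S ->
  S L -> S K -> 0 <= t <= 1 -> S (fun x => (1 - t) * L x + t * K x).
Proof.
move=> Sc SL SK /andP[t0 t1].
have := Sc bool (fun b => if b then 1 - t else t) (fun b => if b then L else K).
move=> /(_ _ _ _)/=.
rewrite (_ : (fun x => _) = (fun x => (1 - t) * L x + t * K x)); last first.
  by apply/funext => x; rewrite big_bool.
apply.
- by case.
- by case=> //; rewrite subr_ge0.
- by rewrite big_bool /= subrK.
Qed.

(** Diagonal dominance: at the coordinate where [|x|] is largest the perturbation costs at most
    [p * e <= r / 2] times that maximum, so [x *m A] keeps at least half of [r * |x|] there. With
    zero right-hand side the same estimate kills the kernel, whence invertibility. *)
Lemma perturbed_scalar_mx_solve p (r e k : R) (A : 'M[R]_p) (y : 'rV[R]_p) :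
  0 < r -> 0 <= k -> (forall i j, `|A i j - (i == j)%:R * r| <= e) ->
  p%:R * e <= r / 2 -> (forall i, `|y ord0 i| <= k) ->
  exists2 x : 'rV[R]_p, x *m A = y & forall i, `|x ord0 i| <= 2 * k / r.
Proof.
move=> r0 k0 Ae pe yk.
have key (x : 'rV[R]_p) (c : R) : 0 <= c ->
    (forall i, `|(x *m A) ord0 i| <= c) -> forall i, `|x ord0 i| <= 2 * c / r.
  move=> c0 xA i0.
  case: (@arg_maxP _ _ _ i0 xpredT (fun i => `|x ord0 i|) isT) => i _ imax.
  apply: (le_trans (imax i0 isT)).
  have := xA i; rewrite mxE.
  have -> : \sum_j x ord0 j * A j i =
      r * x ord0 i + \sum_j x ord0 j * (A j i - (j == i)%:R * r).
    under [in RHS]eq_bigr do rewrite mulrBr.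
    rewrite sumrB [X in _ + (_ - X)](bigD1 i)//= eqxx mul1r.
    rewrite [X in _ + (_ - (_ + X))]big1; last first.
      by move=> j /negbTE ->; rewrite mul0r mulr0.
    by rewrite addr0 mulrC; ring.
  have sm : `|\sum_j x ord0 j * (A j i - (j == i)%:R * r)|
      <= r / 2 * `|x ord0 i|.
    apply: (le_trans (ler_norm_sum _ _ _)).
    apply: (@le_trans _ _ (\sum_(j < p) `|x ord0 i| * e)).
      apply: ler_sum => j _; rewrite normrM ler_pM//.
      exact: imax.
    rewrite sumr_const card_ord -[X in X <= _]mulr_natr -mulrA [X in _ <= X]mulrC [e * _]mulrC.
    by rewrite ler_wpM2l.
  move=> h; have {}h : r * `|x ord0 i| - r / 2 * `|x ord0 i| <= c.
    apply: le_trans h; apply: (@le_trans _ _ (`|r * x ord0 i| -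
       `|\sum_j x ord0 j * (A j i - (j == i)%:R * r)|)).
      by rewrite normrM (gtr0_norm r0) lerD2l lerN2.
    exact: lerB_normD.
  by rewrite ler_pdivlMr//; lra.
have uA : A \in unitmx.
  rewrite -row_free_unit -kermx_eq0; apply/eqP/row_matrixP => i.
  rewrite row0; apply/rowP => j; rewrite [RHS]mxE.
  have := key (row i (kermx A)) 0 (lexx _).
  rewrite -row_mul mulmx_ker row0 => /(_ _ j).
  rewrite mulr0 mul0r normr_le0 => /(_ _)/eqP; apply.
  by move=> ?; rewrite mxE normr0.
exists (y *m invmx A); first by rewrite mulmxKV.
by move=> i; apply: key => // j; rewrite mulmxKV.
Qed.

Section Stability.
Variables (S : set (T -> R)) (N : nat -> (T -> R) -> R) (mu : nat -> R).
Variables (m l : nat).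
Hypothesis ml : (m <= l)%N.
Hypothesis Scvx : closed_under_mixtures S.
Hypothesis Naff : forall j, (j <= l)%N -> affine_on S (N j).
Variable B : R.
Hypothesis NB : forall j L, (j <= l)%N -> S L -> `|N j L| <= B.
Variables (L0 : T -> R).
Hypothesis SL0 : S L0.
Hypothesis L0lt : forall j, (1 <= j <= m)%N -> N j L0 < mu j.
Hypothesis L0eq : forall j, (m < j <= l)%N -> N j L0 = mu j.
Variables (r : R) (V : 'I_(l - m) -> bool -> T -> R).
Hypothesis r0 : 0 < r.
Hypothesis SV : forall k b, S (V k b).
Hypothesis NV : forall (i k : 'I_(l - m)) b,
  N (m + i).+1 (V k b) = mu (m + i).+1 + (-1) ^+ b * (i == k)%:R * r.

(* The equality targets are met by moving along the segments joining the
   antipodal vertices V k false, V k true; the equality moments of the latter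
   are almost a multiple of the canonical basis. *)
Lemma robust_slater : exists2 e : R, 0 < e &
  forall N' : nat -> (T -> R) -> R,
  (forall j, (j <= l)%N -> affine_on S (N' j)) ->
  (forall j L, (j <= l)%N -> S L -> `|N' j L - N j L| <= e) ->
  forall v : nat -> R, (forall j, (m < j <= l)%N -> `|v j| <= e) ->
  exists K, [/\ S K, forall j, (1 <= j <= m)%N -> N' j K <= mu j - e
    & forall j, (m < j <= l)%N -> N' j K = mu j + v j].
Proof.
have [s s0 Ls] : exists2 s : R, 0 < s &
    forall j, (1 <= j <= m)%N -> N j L0 <= mu j - s.
  exists (\big[Order.min/1]_(j < m) (mu j.+1 - N j.+1 L0)).
    by apply: lt_bigmin => // i _; rewrite subr_gt0 L0lt//=.
  move=> [//|j] /= jm; rewrite lerBrDr -lerBrDl.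
  exact: (@bigmin_le_cond _ _ _ _ (Ordinal jm)).
have B0 : 0 <= B by apply: le_trans (NB (leq0n l) SL0).
have [B1 B10 B1j] : exists2 B1 : R, 0 < B1 &
    forall j, (1 <= j <= m)%N -> B - mu j + s <= B1.
  exists (1 + B + s + \sum_(j < m) `|mu j.+1|).
    by apply: ltr_wpDr; [exact: sumr_ge0|lra].
  move=> [//|j] /= jm; rewrite (bigD1 (Ordinal jm))//=.
  set z := \sum_(_ < _ | _) _.
  have z0 : 0 <= z by apply: sumr_ge0.
  have := ler_norm (- mu j.+1); rewrite normrN; lra.
pose p := (l - m)%N.
(* Total weight allowed to leave [L0]: moving it costs at most [tau * B1 <= s / 4] of the slack [s]
   in the inequalities. *)
pose tau := Order.min (1 / 2) (s / (4 * B1)).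
have tau0 : 0 < tau by rewrite /tau lt_min !divr_gt0 ?mulr_gt0.
have tau1 : tau <= 1 / 2 by rewrite ge_min lexx.
have tauB : tau * B1 <= s / 4.
  rewrite -ler_pdivlMr// (_ : s / 4 / B1 = s / (4 * B1)) ?ge_min ?lexx ?orbT//.
  by field; rewrite gt_eqF.
(* Base weight of each of the [2 * p] vertices; [p.+1] instead of [p] keeps it positive when there
   is no equality constraint. *)
pose th := tau / (2 * p.+1%:R).
have p10 : 0 < p.+1%:R :> R by [].
have pp1 : p%:R <= p.+1%:R :> R by rewrite ler_nat.
have pR0 : 0 <= p%:R :> R by [].
have th0 : 0 < th by rewrite divr_gt0// mulr_gt0.
have pth : p%:R * (2 * th) <= tau.
  rewrite (_ : _ * _ = p%:R / p.+1%:R * tau).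
    apply: ler_piMl; first exact: ltW.
    by rewrite ler_pdivrMr// mul1r.
  by rewrite /th; field; rewrite gt_eqF.
(* Three demands: [s / 4] leaves slack in the inequalities, [r * th / 2] keeps the corrections [x]
   below [2 * th] so that all weights stay nonnegative, and the last bound makes [A] diagonally
   dominant. *)
pose e := Order.min (s / 4) (Order.min (r * th / 2) (r / (2 * p.+1%:R))).
have e0 : 0 < e by rewrite /e !lt_min !divr_gt0 ?mulr_gt0.
have es : e <= s / 4 by rewrite ge_min lexx.
have er : e <= r * th / 2 by rewrite !ge_min lexx !orbT.
have pe : p%:R * e <= r / 2.
  apply: (@le_trans _ _ (p%:R * (r / (2 * p.+1%:R)))).
    by rewrite ler_wpM2l// !ge_min lexx !orbT.
  rewrite (_ : p%:R * (r / (2 * p.+1%:R)) = p%:R / p.+1%:R * (r / 2)).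
    apply: ler_piMl; first by rewrite divr_ge0 ?ltW.
    by rewrite ler_pdivrMr// mul1r.
  by field; rewrite gt_eqF.
exists e => // N' N'aff N'N v ve.
pose D j L := N' j L - N j L.
have De j L : (j <= l)%N -> S L -> `|D j L| <= e by exact: N'N.
have ltml (i : 'I_p) : (m < (m + i).+1 <= l)%N.
  by rewrite ltnS leq_addr/= -ltn_subRL.
have lel (i : 'I_p) : ((m + i).+1 <= l)%N by have /andP[] := ltml i.
(* Row [k] is the effect on the perturbed equality moments of the direction
   [(V k false - V k true) / 2]; [y] below is the target [v] minus the error already produced by the
   base weights. *)
pose A : 'M[R]_p := \matrix_(k, i) ((k == i)%:R * r +
  (D (m + i).+1 (V k false) - D (m + i).+1 (V k true)) / 2).
pose w0 := 1 - p%:R * (2 * th).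
pose y : 'rV[R]_p := \row_i (v (m + i).+1 - (w0 * D (m + i).+1 L0 +
  \sum_(k < p) th * (D (m + i).+1 (V k false) + D (m + i).+1 (V k true)))).
have w00 : 0 <= w0 by rewrite /w0; lra.
have [x xA xth] : exists2 x : 'rV[R]_p, x *m A = y &
    forall i, `|x ord0 i| <= 2 * (2 * e) / r.
  apply: (@perturbed_scalar_mx_solve _ _ e) => //.
  - by rewrite mulr_ge0// ltW.
  - move=> k i; rewrite mxE addrAC subrr add0r.
    rewrite normrM (@ger0_norm _ 2^-1)// ler_pdivrMr//.
    rewrite (le_trans (ler_normB _ _))// mulr2n mulrDr !mulr1.
    by rewrite lerD ?De.
  - move=> i; rewrite mxE (le_trans (ler_normB _ _))// (_ : 2 * e = e + e); last by ring.
    rewrite lerD ?ve//; apply: (le_trans (ler_normD _ _)).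
    apply: (@le_trans _ _ (w0 * e + \sum_(k < p) (2 * th) * e)); last first.
      rewrite sumr_const card_ord -[X in _ + X]mulr_natl mulrA -mulrDl /w0.
      by rewrite subrK mul1r.
    rewrite lerD//; first by rewrite normrM ger0_norm// ler_wpM2l// De.
    rewrite (le_trans (ler_norm_sum _ _ _))// ler_sum// => k _.
    rewrite normrM gtr0_norm// (_ : 2 * th * e = th * (e + e)); last by ring.
    rewrite ler_wpM2l ?(ltW th0)//.
    rewrite (le_trans (ler_normD _ _))//.
    by rewrite lerD ?De.
have {}xth k : `|x ord0 k| <= 2 * th.
  apply: (le_trans (xth k)); rewrite ler_pdivrMr//; lra.
pose w (i : (unit + 'I_p * bool)%type) :=
  if i is inr (k, b) then th + (-1) ^+ b * (x ord0 k / 2) else w0.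
pose LL (i : (unit + 'I_p * bool)%type) :=
  if i is inr (k, b) then V k b else L0.
have sumE (F : (unit + 'I_p * bool)%type -> R) :
    \sum_i F i = F (inl tt) + \sum_(k < p) (F (inr (k, false)) + F (inr (k, true))).
  rewrite big_sumType/= (big_pred1 tt); last by case.
  congr (_ + _); rewrite (eq_bigr (fun q => F (inr (q.1, q.2)))); last by case.
  rewrite -(pair_bigA _ (fun k b => F (inr (k, b))))/=.
  by apply: eq_bigr => k _; rewrite big_bool addrC.
have SLL i : S (LL i) by case: i => [[]|[k b]]//=.
have w_ge0 i : 0 <= w i.
  case: i => [[]|[k b]]//=; have := xth k; rewrite ler_norml.
  by case: b; rewrite ?expr1 ?expr0; lra.
have w1 : \sum_i w i = 1.
  rewrite sumE /= (eq_bigr (fun=> 2 * th)); last by move=> k _; ring.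
  by rewrite sumr_const card_ord -[X in _ + X]mulr_natl /w0 subrK.
have N'K j : (j <= l)%N -> N' j (fun z => \sum_i w i * LL i z) =
    \sum_i w i * N' j (LL i).
  by move=> jl; apply: N'aff.
exists (fun z => \sum_i w i * LL i z); split.
- exact: Scvx.
- move=> j jm; have jl : (j <= l)%N by case/andP: jm => _ /leq_trans; exact.
  rewrite N'K// sumE/=.
  have ub L : S L -> N' j L <= B + e.
    move=> SL; have := De j L jl SL; have := NB jl SL.
    by rewrite !ler_norml /D; lra.
  have h0 : w0 * N' j L0 <= w0 * (mu j - s + e).
    rewrite ler_wpM2l//; have := De j L0 jl SL0; have := Ls j jm.
    by rewrite !ler_norml /D; lra.
  have h1 : \sum_(k < p) (w (inr (k, false)) * N' j (V k false) +
      w (inr (k, true)) * N' j (V k true)) <= p%:R * (2 * th) * (B + e).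
    rewrite -mulrA mulr_natl -[X in _ *+ X]card_ord -sumr_const ler_sum// => k _.
    apply: (@le_trans _ _ (w (inr (k, false)) * (B + e) +
                           w (inr (k, true)) * (B + e))).
      by rewrite lerD// ler_wpM2l// ub.
    by rewrite -mulrDl/= le_eqVlt; apply/orP; left; apply/eqP; ring.
  apply: (le_trans (lerD h0 h1)).
  set q := p%:R * (2 * th) in pth *.
  have q0 : 0 <= q by rewrite mulr_ge0// mulr_ge0// ltW.
  have qB : q * (B - mu j + s) <= q * B1 by rewrite ler_wpM2l// B1j.
  have qB' : q * B1 <= tau * B1 by rewrite ler_wpM2r// ltW.
  rewrite /w0 -/q; lra.
- move=> j jml; have [i ->] : exists i : 'I_p, j = (m + i).+1.
    case/andP: jml => mj jl.
    have ji : (j - m.+1 < p)%N by rewrite subnS prednK ?subn_gt0// leq_sub2r.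
    by exists (Ordinal ji); rewrite /= -addSn subnKC.
  rewrite N'K// sumE/=.
  have -> : N' (m + i).+1 L0 = mu (m + i).+1 + D (m + i).+1 L0.
    by rewrite /D L0eq//; ring.
  have N'V k b : N' (m + i).+1 (V k b) = mu (m + i).+1 +
      ((-1) ^+ b * (i == k)%:R * r + D (m + i).+1 (V k b)).
    by rewrite /D NV; ring.
  under eq_bigr do rewrite !N'V.
  have := congr1 (fun u : 'rV[R]_p => u ord0 i) xA.
  rewrite !mxE => xAi.
  rewrite -[in RHS](subrK (w0 * D (m + i).+1 L0 +
    \sum_(k < p) th * (D (m + i).+1 (V k false) + D (m + i).+1 (V k true))) (v _)).
  rewrite -xAi.
  rewrite (eq_bigr (fun k => 2 * th * mu (m + i).+1 + (x ord0 k * A k i +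
    th * (D (m + i).+1 (V k false) + D (m + i).+1 (V k true))))); last first.
    by move=> k _; rewrite mxE [i == k]eq_sym expr1 expr0; field.
  rewrite !big_split/= sumr_const card_ord -mulr_natl /w0.
  by rewrite -/p; ring.
Qed.

(** A point feasible for [N1] misses the [N2] constraints by at most [D]. Mixing in a weight [D / e]
    of a robust Slater point repairs it: the slack [e] pays for the inequalities and the free offset
    [v] cancels the equality errors. The objective loses [D] from the change of moments and
    [2 * (B + e) * D / e] from the mixing. *)
Lemma optimal_value_le (N1 N2 : nat -> (T -> R) -> R) (e D : R) :
  0 < D <= e ->
  affine_on S (N2 0) -> (forall j, (1 <= j <= l)%N -> affine_on S (N2 j)) ->
  (forall j L, (j <= l)%N -> S L -> `|N1 j L - N2 j L| <= D) ->
  (forall L, S L -> `|N2 0 L| <= B + e) ->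
  (forall v : nat -> R, (forall j, (m < j <= l)%N -> `|v j| <= e) ->
    exists K, [/\ S K, forall j, (1 <= j <= m)%N -> N2 j K <= mu j - e
      & forall j, (m < j <= l)%N -> N2 j K = mu j + v j]) ->
  (optimal_value S N1 mu m l <=
   optimal_value S N2 mu m l + ((1 + 2 * (B + e) / e) * D)%:E)%E.
Proof.
move=> /andP[D0 De] aff0 aff12 N12 N2B N2K.
have e0 : 0 < e by exact: lt_le_trans De.
apply: ge_ereal_sup => _ [L [SL Lle Leq] <-].
pose t := D / e.
have t01 : 0 <= t <= 1.
  by rewrite divr_ge0 ?(ltW D0) ?(ltW e0)//= ler_pdivrMr// mul1r.
have /andP[t0 t1] := t01.
have tpos : 0 < t by rewrite divr_gt0.
have te : t * e = D by rewrite /t divfK// gt_eqF.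
(* Solves [(1 - t) * (N2 j L - mu j) + t * v j = 0]; its size is at most [(1 - t) * e], within the
   range allowed for offsets. *)
pose v j := - ((1 - t) / t * (N2 j L - mu j)).
have [|K [SK Kle Keq]] := N2K v.
  move=> j /[dup] jml /andP[_ jl]; rewrite normrN normrM.
  have h : `|N2 j L - mu j| <= D by rewrite -(Leq _ jml) distrC N12.
  rewrite ger0_norm; last by rewrite divr_ge0// subr_ge0.
  rewrite mulrAC ler_pdivrMr// [e * t]mulrC te.
  apply: le_trans h; apply: ler_piMl => //; lra.
have N0 : N2 0%N (fun x => (1 - t) * L x + t * K x) >=
    N1 0%N L - (1 + 2 * (B + e) / e) * D.
  rewrite (affine_on2 aff0 SL SK)//.
  have := N12 0 L isT SL; rewrite ler_norml => /andP[_ hN].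
  have := N2B L SL; rewrite ler_norml => /andP[_ hL].
  have := N2B K SK; rewrite ler_norml => /andP[hK _].
  have -> : (1 + 2 * (B + e) / e) * D = D + 2 * (B + e) * t.
    by rewrite /t; field; rewrite gt_eqF.
  have h1 : t * N2 0%N L <= t * (B + e) by rewrite ler_wpM2l.
  have h2 : t * - (B + e) <= t * N2 0%N K by rewrite ler_wpM2l.
  lra.
rewrite -leeBlDr// -EFinB.
apply: (le_trans _ (ereal_sup_ubound _)); last first.
  exists (fun x => (1 - t) * L x + t * K x); last by [].
  split; first exact: closed_under_mixtures2.
  - move=> j /[dup] jm /andP[j1 jm']; have jl := leq_trans jm' ml.
    rewrite (affine_on2 (aff12 _ _) SL SK)// ?j1//.
    have := N12 j L jl SL; rewrite ler_norml => /andP[hN _].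
    have h1 : (1 - t) * N2 j L <= (1 - t) * (mu j + D).
      by rewrite ler_wpM2l ?subr_ge0//; have := Lle j jm; lra.
    have h2 : t * N2 j K <= t * (mu j - e) by rewrite ler_wpM2l// Kle.
    apply: (le_trans (lerD h1 h2)).
    rewrite -subr_ge0 (_ : _ - _ = t * D + (t * e - D)); last by ring.
    by rewrite te subrr addr0 mulr_ge0// ltW.
  - move=> j /[dup] jml /andP[mj jl]; have j1 : (1 <= j)%N by case: j mj {jl jml}.
    rewrite (affine_on2 (aff12 _ _) SL SK) ?j1//.
    by rewrite Keq// /v; field; rewrite gt_eqF.
by rewrite lee_fin.
Qed.

(** The one-sided estimate is used in both directions: [robust_slater] applies to [N'] and, with
    zero perturbation, to [N] itself. The value for [N] is shown finite, so that the difference of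
    extended reals is meaningful. *)
Lemma optimal_value_stable : exists C e : R, [/\ 0 < C, 0 < e &
  forall (N' : nat -> (T -> R) -> R) (D : R),
  (forall j, (j <= l)%N -> affine_on S (N' j)) ->
  0 < D <= e ->
  (forall j L, (j <= l)%N -> S L -> `|N' j L - N j L| <= D) ->
  (`|optimal_value S N' mu m l - optimal_value S N mu m l| <= (C * D)%:E)%E].
Proof.
have B0 : 0 <= B by apply: le_trans (NB (leq0n l) SL0).
have [e e0 H] := robust_slater.
exists (1 + 2 * (B + e) / e), e; split => //.
  by rewrite addr_gt0// divr_gt0// mulr_gt0// ltr_wpDl.
move=> N' D N'aff /[dup] De /andP[D0 De'] N'N.
have N'e j L : (j <= l)%N -> S L -> `|N' j L - N j L| <= e.
  by move=> jl SL; apply: le_trans De'; exact: N'N.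
have NB0 L : S L -> `|N 0%N L| <= B + e.
  by move=> SL; rewrite (le_trans (NB _ SL))// lerDl ltW.
have N'B0 L : S L -> `|N' 0%N L| <= B + e.
  move=> SL; have := N'e 0%N L isT SL; have := NB (leq0n l) SL.
  by rewrite !ler_norml; lra.
have a : forall N'', (forall j, (j <= l)%N -> affine_on S (N'' j)) ->
    forall j, (1 <= j <= l)%N -> affine_on S (N'' j).
  by move=> N'' h j /andP[_]; exact: h.
have le1 : (optimal_value S N' mu m l <= optimal_value S N mu m l +
    ((1 + 2 * (B + e) / e) * D)%:E)%E.
  apply: optimal_value_le => //; [exact: Naff|exact: a|].
  move=> v ve; apply: H => // j L jl SL.
  by rewrite subrr normr0 ltW.
have le2 : (optimal_value S N mu m l <= optimal_value S N' mu m l +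
    ((1 + 2 * (B + e) / e) * D)%:E)%E.
  apply: optimal_value_le => //; [exact: N'aff|exact: a| |].
    by move=> j L jl SL; rewrite distrC N'N.
  by move=> v ve; apply: H.
have vB : (optimal_value S N mu m l <= (B + e)%:E)%E.
  apply: ge_ereal_sup => _ [L [SL _ _] <-]; rewrite lee_fin.
  exact: (le_trans (ler_norm _)) (NB0 _ SL).
have vL0 : ((N 0%N L0)%:E <= optimal_value S N mu m l)%E.
  apply: ereal_sup_ubound; exists L0 => //; split=> // j jm.
  exact/ltW/L0lt.
have : optimal_value S N mu m l \is a fin_num.
  rewrite fin_numE; apply/andP; split.
    by apply: contraTneq vL0 => ->; rewrite leeNy_eq.
  by apply: contraTneq vB => ->; rewrite leye_eq.
case: (optimal_value S N mu m l) le1 le2 => [x| |]// le1 le2 _.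
case: (optimal_value S N' mu m l) le1 le2 => [y| |]//.
rewrite -!EFinD !lee_fin => le1 le2.
by rewrite ler_norml; apply/andP; split; lra.
Qed.

End Stability.
End PerturbedPrograms.

(** * Finite-dimensional reduction of the shape constraints *)

Section ShapeReduction.
Variable R : realType.

Lemma size_order_indices n (x : 'I_n -> R) : size (order_indices x) = n.
Proof. by rewrite /order_indices size_sort size_enum_ord. Qed.

Lemma order_indices_sorted n (x : 'I_n -> R) :
  sorted (fun i j => x i <= x j) (order_indices x).
Proof. by apply: sort_sorted => i j; exact: le_total. Qed.

Lemma mem_order_indices n (x : 'I_n -> R) i : i \in order_indices x.
Proof. by rewrite mem_sort mem_enum. Qed.

Lemma uniq_order_indices n (x : 'I_n -> R) : uniq (order_indices x).
Proof. by rewrite sort_uniq enum_uniq. Qed.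

(* The sample index of the k-th order statistic, for 1 <= k <= n. *)
Definition order_index n (x : 'I_n.+1 -> R) (k : nat) : 'I_n.+1 :=
  nth ord0 (order_indices x) k.-1.

Section Fixed.
Variables (n : nat) (x : 'I_n.+1 -> R) (a b : R).
Hypothesis xinj : injective x.
Hypothesis xab : forall i, a < x i < b.

Local Notation T := (order_stat a b x).
Local Notation idx := (order_index x).

Lemma order_statE k : (1 <= k <= n.+1)%N -> T k = x (idx k).
Proof.
case: k => [//|k] /= kn; rewrite /order_stat /= nth_rcons size_map size_order_indices kn.
by rewrite (nth_map ord0)// size_order_indices.
Qed.

Lemma ordered_valE (L0 L1 : R) y k : (1 <= k <= n.+1)%N ->
  ordered_val L0 L1 x y k = y (idx k).
Proof.
case: k => [//|k] /= kn; rewrite /ordered_val /= nth_rcons size_map size_order_indices kn.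
by rewrite (nth_map ord0)// size_order_indices.
Qed.

Lemma order_stat0 : T 0 = a. Proof. by []. Qed.

Lemma order_stat_last : T n.+2 = b.
Proof.
by rewrite /order_stat /= nth_rcons size_map size_order_indices ltnn eqxx.
Qed.

Lemma ordered_val0 (L0 L1 : R) y : ordered_val L0 L1 x y 0 = L0.
Proof. by []. Qed.

Lemma ordered_val_last (L0 L1 : R) y : ordered_val L0 L1 x y n.+2 = L1.
Proof.
by rewrite /ordered_val /= nth_rcons size_map size_order_indices ltnn eqxx.
Qed.

Lemma order_indexK i : exists2 k, (1 <= k <= n.+1)%N & idx k = i.
Proof.
exists (index i (order_indices x)).+1.
  by rewrite /= -[X in (_ < X)%N](size_order_indices x) index_mem mem_order_indices.
by rewrite /order_index /= nth_index// mem_order_indices.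
Qed.

(** Distinct samples inside the open interval make the augmented grid strictly increasing, endpoints
    included; all divided differences are then genuine. *)
Lemma order_stat_lt k k' : (k < k')%N -> (k' <= n.+2)%N -> T k < T k'.
Proof.
suff step j : (j <= n.+1)%N -> T j < T j.+1.
  elim: k' => // k' ih; rewrite ltnS leq_eqVlt => /predU1P[->|kk'] k'n.
    exact: step.
  by apply: lt_trans (ih kk' (ltnW k'n)) _; exact: step.
move=> jn; have [j0|j0] := posnP j.
  by rewrite j0 order_stat0 order_statE//; have /andP[] := xab (idx 1).
have [jn'|nj] := ltnP j n.+1; last first.
  have -> : j = n.+1 by apply/eqP; rewrite eqn_leq jn.
  by rewrite order_stat_last order_statE ?leqnn//; have /andP[] := xab (idx n.+1).
rewrite !order_statE ?j0 ?jn'//= lt_neqAle; apply/andP; split.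
  apply/eqP => /xinj; rewrite /order_index => /eqP.
  rewrite nth_uniq ?size_order_indices ?uniq_order_indices//; last by rewrite prednK.
  by rewrite -{2}[j]prednK//= ltn_eqF// prednK.
rewrite /order_index /=.
have := order_indices_sorted x; move/(sortedP ord0) => /(_ j.-1).
rewrite size_order_indices prednK//.
exact.
Qed.

Lemma order_stat_le k k' : (k <= k')%N -> (k' <= n.+2)%N -> T k <= T k'.
Proof.
rewrite leq_eqVlt => /predU1P[-> //|kk' k'n]; exact/ltW/order_stat_lt.
Qed.

Lemma order_stat_leE k k' : (k <= n.+2)%N -> (k' <= n.+2)%N ->
  (T k <= T k') = (k <= k')%N.
Proof.
move=> kn k'n; apply/idP/idP => [|kk']; last exact: order_stat_le.
by apply: contraTT; rewrite -ltnNge -ltNge => h; exact: order_stat_lt.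
Qed.

(** The index [n.+2] is left out, so [b] belongs to the last cell; the empty maximum yields 0 to the
    left of [a]. *)
Definition floor_index (z : R) : nat := \max_(k < n.+2 | T k <= z) k.

Lemma floor_index_le z : (floor_index z <= n.+1)%N.
Proof. by apply/bigmax_leqP => k _; rewrite -ltnS. Qed.

Lemma floor_index_mono z z' : z <= z' -> (floor_index z <= floor_index z')%N.
Proof.
move=> zz'; apply/bigmax_leqP => k kz.
by apply: (@leq_bigmax_cond _ _ (fun k : 'I_n.+2 => k : nat) k); exact: le_trans zz'.
Qed.

Lemma floor_indexK k : (k <= n.+1)%N -> floor_index (T k) = k.
Proof.
move=> kn; apply/eqP; rewrite eqn_leq; apply/andP; split.
  by apply/bigmax_leqP => j; rewrite order_stat_leE// ltnW// ltnW.
have kn' : (k < n.+2)%N by [].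
by apply: (@leq_bigmax_cond _ _ (fun k : 'I_n.+2 => k : nat) (Ordinal kn')) => /=.
Qed.

Lemma floor_indexP z : a <= z -> T (floor_index z) <= z.
Proof.
move=> az; rewrite /floor_index; elim/big_ind : _ => //= i j Ti Tj.
by rewrite /maxn; case: ifP.
Qed.

Lemma lt_ceil_order_stat z : z < b -> z < T (floor_index z).+1.
Proof.
move=> zb; rewrite ltNge; apply/negP => h.
have [kn|nk] := ltnP (floor_index z) n.+1.
  have kn' : ((floor_index z).+1 < n.+2)%N by [].
  have := @leq_bigmax_cond _ (fun k : 'I_n.+2 => T k <= z)
    (fun k : 'I_n.+2 => k : nat) (Ordinal kn') h.
  by rewrite /= ltnn.
have e : floor_index z = n.+1 by apply/eqP; rewrite eqn_leq floor_index_le.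
by move: h; rewrite e order_stat_last leNgt zb.
Qed.

(** One past the last node strictly below [z], rather than the floor plus one, so that an interior
    node is its own ceiling. *)
Definition ceil_index (z : R) : nat := (\max_(k < n.+2 | T k < z) k).+1.

Lemma ceil_index_le z : (1 <= ceil_index z <= n.+2)%N.
Proof. by rewrite /= ltnS; apply/bigmax_leqP => k _; rewrite -ltnS. Qed.

Lemma ceil_index_mono z z' : z <= z' -> (ceil_index z <= ceil_index z')%N.
Proof.
move=> zz'; rewrite ltnS; apply/bigmax_leqP => k kz.
by apply: (@leq_bigmax_cond _ _ (fun k : 'I_n.+2 => k : nat) k); exact: lt_le_trans zz'.
Qed.

Lemma ceil_indexK k : (1 <= k <= n.+1)%N -> ceil_index (T k) = k.
Proof.
case: k => // k /= kn; apply/eqP; rewrite eqSS eqn_leq; apply/andP; split.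
  apply/bigmax_leqP => j; rewrite ltNge order_stat_leE; first last.
  - exact/ltnW/ltn_ord.
  - exact: leqW.
  by rewrite -ltnNge ltnS.
have kn' : (k < n.+2)%N by rewrite ltnW.
apply: (@leq_bigmax_cond _ _ (fun k : 'I_n.+2 => k : nat) (Ordinal kn')) => /=.
by apply: order_stat_lt => //; rewrite ltnW.
Qed.

Lemma ceil_indexP z : a < z -> z <= b -> z <= T (ceil_index z).
Proof.
move=> az zb; rewrite leNgt; apply/negP => h.
have [kn|nk] := ltnP (ceil_index z) n.+2.
  have := @leq_bigmax_cond _ (fun k : 'I_n.+2 => T k < z)
    (fun k : 'I_n.+2 => k : nat) (Ordinal kn) h.
  by rewrite /= ltnn.
have e : ceil_index z = n.+2.
  by apply/eqP; rewrite eqn_leq nk andbT; have /andP[] := ceil_index_le z.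
by move: h; rewrite e order_stat_last ltNge zb.
Qed.

End Fixed.
End ShapeReduction.

Section ConvexReal.
Variable R : realType.

Lemma convex_functionP (a b : R) (f : R -> R) :
  @convex_function R R^o `[a, b] f <->
  forall x y t : R, a <= x <= b -> a <= y <= b -> 0 <= t <= 1 ->
    f (t * x + (1 - t) * y) <= t * f x + (1 - t) * f y.
Proof.
split=> [cf x y t xab yab t01|cf t x y].
  have [t' tt'] : exists t' : {i01 R}, t'%:num = t.
    have /andP[t0 t1] := t01.
    by exists (Itv01 t0 t1).
  have := cf t' x y; rewrite !inE /= !in_itv/= => /(_ xab yab).
  by rewrite -tt'.
rewrite !inE /= !in_itv/= => xab yab.
have := cf x y t%:num xab yab; rewrite ge0 le1 => /(_ isT).
by [].
Qed.

Lemma convex_slope (a b : R) (f : R -> R) x y z :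
  @convex_function R R^o `[a, b] f -> a <= x -> x < y -> y < z -> z <= b ->
  (f y - f x) / (y - x) <= (f z - f y) / (z - y).
Proof.
move=> /convex_functionP cf ax xy yz zb.
have xz : 0 < z - x by rewrite subr_gt0 (lt_trans xy).
have yx0 : 0 < y - x by rewrite subr_gt0.
have zy0 : 0 < z - y by rewrite subr_gt0.
have := cf x z ((z - y) / (z - x)).
have -> : (z - y) / (z - x) * x + (1 - (z - y) / (z - x)) * z = y.
  by field; rewrite gt_eqF.
move=> /(_ _ _ _) h.
have {}h : f y <= (z - y) / (z - x) * f x + (1 - (z - y) / (z - x)) * f z.
  apply: h.
  - by rewrite ax (le_trans (ltW xy))// (le_trans (ltW yz)).
  - by rewrite zb (le_trans ax)// (le_trans (ltW xy))// ltW.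
  - rewrite divr_ge0 ?(ltW zy0) ?(ltW xz)//= ler_pdivrMr// mul1r.
    by rewrite lerD2l lerN2 ltW.
have {}h : (z - x) * f y <= (z - y) * f x + (y - x) * f z.
  have := ler_wpM2l (ltW xz) h.
  rewrite (_ : (z - x) * (_ * f x + _ * f z) = (z - y) * f x + (y - x) * f z)//.
  by field; rewrite gt_eqF.
rewrite ler_pdivrMr// mulrAC ler_pdivlMr//.
nra.
Qed.

(** Sublevel sets of a convex function are intervals. This serves twice: to bound a convex extension
    by its end values, and to see that [M - f] has intervals as superlevel sets. *)
Lemma convex_superlevel (a b : R) (f : R -> R) u x y z :
  @convex_function R R^o `[a, b] f -> a <= x -> x <= y -> y <= z -> z <= b ->
  f x <= u -> f z <= u -> f y <= u.
Proof.
move=> /convex_functionP cf ax xy yz zb fx fz.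
have [xz|zx] := ltP x z; last first.
  have -> // : y = x by apply/eqP; rewrite eq_le xy (le_trans yz).
have xz0 : 0 < z - x by rewrite subr_gt0.
have := cf x z ((z - y) / (z - x)).
have -> : (z - y) / (z - x) * x + (1 - (z - y) / (z - x)) * z = y.
  by field; rewrite gt_eqF.
set t := (z - y) / (z - x).
have t01 : 0 <= t <= 1.
  rewrite divr_ge0 ?subr_ge0 ?(ltW xz)//= ler_pdivrMr// mul1r.
  by rewrite lerD2l lerN2.
have /andP[t0 t1] := t01.
move=> /(_ _ _ t01) h; apply: (le_trans (h _ _)).
- by rewrite ax (le_trans xy)// (le_trans yz).
- by rewrite zb (le_trans ax)// (le_trans xy).
have h1 : t * f x <= t * u by rewrite ler_wpM2l.
have h2 : (1 - t) * f z <= (1 - t) * u by rewrite ler_wpM2l// subr_ge0.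
lra.
Qed.

End ConvexReal.

(** * Discrete constraints as traces of the three shape classes *)

Section FinitelyReducible.
Variables (R : realType) (a b c M : R) (g : R -> R).
Hypothesis acb : a < c < b.
Hypothesis M0 : 0 < M.
Hypothesis g0 : forall x, a <= x <= b -> 0 < g x.
Variables (n : nat) (x : 'I_n.+1 -> R).
Hypothesis xinj : injective x.
Hypothesis xab : forall i, a < x i < b.

Local Notation T := (order_stat a b x).
Local Notation idx := (order_index x).
Local Notation calL s := (likelihood_ratios (shape_class s a b c M) g).

Let xab' i : a <= x i <= b.
Proof. by have /andP[/ltW -> /ltW ->] := xab i. Qed.

Let gx i : g (x i) != 0.
Proof. by rewrite gt_eqF// g0. Qed.

Let Tab k : (k <= n.+2)%N -> a <= T k <= b.
Proof.
move=> kn; apply/andP; split.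
  by have := @order_stat_le _ _ x a b xinj xab 0 k isT kn.
by have := order_stat_le xinj xab kn (leqnn _); rewrite order_stat_last.
Qed.

Let HE (L0 L1 : R) y k : (1 <= k <= n.+1)%N ->
  ordered_val L0 L1 x y k * g (T k) = y (idx k) * g (x (idx k)).
Proof. by move=> kn; rewrite ordered_valE// order_statE. Qed.

Let HEf (L0 L1 : R) f k : (1 <= k <= n.+1)%N ->
  ordered_val L0 L1 x (fun i => f (x i) / g (x i)) k * g (T k) = f (T k).
Proof. by move=> kn; rewrite HE// order_statE// divfK. Qed.

Lemma monotone_reducible :
  finitely_reducible (calL Monotonicity) x (discrete_monotone a b M g x).
Proof.
split=> [_ [f [fM fmono] ->]|y [ymono yM]].
  split=> [k /andP[k1 kn]|i]; last by rewrite divfK// fM.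
  have kn' : (k <= n.+1)%N by exact: ltnW.
  rewrite !HEf ?k1 ?kn'//; apply: fmono.
  - by have /andP[] := Tab (leqW kn').
  - by apply: order_stat_le => //; rewrite ltnW.
  - by have /andP[] := Tab (leqW kn).
pose h k := y (idx k) * g (x (idx k)).
have hmono i j : (1 <= i)%N -> (i <= j)%N -> (j <= n.+1)%N -> h j <= h i.
  move=> i1; elim: j => [|j ih]; first by case: i i1.
  rewrite leq_eqVlt => /predU1P[-> //|ij jn].
  apply: le_trans (ih ij (ltnW jn)); have j1 : (1 <= j)%N by apply: leq_trans i1 _.
  have := ymono j; rewrite j1 jn => /(_ isT).
  by rewrite !HE// j1 ltnW.
(* Left of the first sample the value at the first sample is reused, since index 0 carries no
   decision variable in the monotone case. *)
pose f z := h (maxn 1 (floor_index x a b z)).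
have fx i : f (x i) = y i * g (x i).
  have [k /andP[k1 kn] ki] := order_indexK x i.
  rewrite /f -ki -(order_statE x a b) ?k1// floor_indexK//.
  by rewrite (maxn_idPr k1) /h order_statE ?k1.
exists (fun z => f z / g z); last by move=> i; rewrite fx mulfK.
exists f => //; split => [z _|u v au uv vb].
  exact: yM.
apply: hmono; first by rewrite leq_max.
  by rewrite geq_max !leq_max leqnn/= floor_index_mono ?orbT.
by rewrite geq_max floor_index_le.
Qed.

Lemma unimodal_reducible :
  finitely_reducible (calL Unimodality) x (discrete_unimodal a b c M g x).
Proof.
split=> [_ [f [fM [fl fr]] ->]|y [ymode yM]].
  split=> [k /andP[k1 kn]|i]; last by rewrite divfK// fM.
  have /andP[aT Tb] := Tab (leqW kn).
  have fT0 : 0 <= f (T k) by have /andP[] := fM (T k) (Tab (leqW kn)).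
  split=> [Tc|cT].
    rewrite [leRHS]HEf ?k1//; case: k k1 kn aT Tb fT0 Tc => // k _ kn aT Tb fT0 Tc.
    rewrite /=; have [k0|k0] := posnP k.
      by rewrite [X in ordered_val _ _ _ _ X]k0 ordered_val0 mul0r.
    have kn' : (k <= n.+1)%N by exact: ltnW.
    rewrite HEf ?k0//; apply: fl => //.
    - by have /andP[] := Tab (leqW kn').
    - by apply: order_stat_le => //; rewrite ltnW.
  rewrite [leRHS]HEf ?k1//.
  have [kn'|nk] := ltnP k n.+1; last first.
    have -> : k = n.+1 by apply/eqP; rewrite eqn_leq kn.
    rewrite ordered_val_last mul0r; apply: (le_trans fT0).
    by have -> : k = n.+1 by apply/eqP; rewrite eqn_leq kn.
  rewrite HEf//; apply: fr => //; first by apply: order_stat_le => //; rewrite ltnW.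
  by have /andP[] := Tab (leqW kn').
pose h k := ordered_val 0 0 x y k * g (T k).
have h0 : h 0%N = 0 by rewrite /h ordered_val0 mul0r.
have hn : h n.+2 = 0 by rewrite /h ordered_val_last mul0r.
have hM k : (k <= n.+2)%N -> 0 <= h k <= M.
  case: k => [_|k]; first by rewrite h0 lexx ltW.
  rewrite leq_eqVlt => /predU1P[[->]|kn]; first by rewrite hn lexx ltW.
  by rewrite /h HE//; exact: yM.
have hup i j : (i <= j)%N -> (j <= n.+1)%N -> T j <= c -> h i <= h j.
  elim: j => [|j ih]; first by rewrite leqn0 => /eqP ->.
  rewrite leq_eqVlt => /predU1P[-> //|ij jn Tc].
  apply: le_trans (ih ij (ltnW jn) _) _.
    by apply: le_trans Tc; apply: order_stat_le => //; exact: leqW.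
  by have [+ _] := ymode j.+1 jn; exact.
have hdown i j : (i <= j)%N -> (1 <= i)%N -> (j <= n.+2)%N -> c <= T i -> h j <= h i.
  move=> + i1 + cT; elim: j => [|j ih]; first by rewrite leqn0 => /eqP ->.
  rewrite leq_eqVlt => /predU1P[-> //|ij jn].
  apply: le_trans _ (ih ij (ltnW jn)).
  have j1 : (1 <= j <= n.+1)%N by rewrite (leq_trans i1 ij).
  have [_] := ymode j j1; apply; apply: le_trans cT _.
  by apply: order_stat_le => //; exact: ltnW.
pose K := floor_index x a b; pose K' := ceil_index x a b.
have Kn z : (K z <= n.+1)%N by exact: floor_index_le.
have K'n z : (1 <= K' z <= n.+2)%N by exact: ceil_index_le.
have /andP[ac cb] := acb.
have TKc : T (K c) <= c by apply: floor_indexP; exact: ltW.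
have TK'c : c <= T (K' c) by apply: ceil_indexP => //; exact: ltW.
(* Left of [c] a point takes the value of the last node before it, right of [c] that of the next
   node; beyond the extreme nodes this gives the conventional value 0. At [c] the larger of the two
   dominates both sides, and they agree when [c] is a sample. *)
pose f z := if z < c then h (K z) else if c < z then h (K' z)
            else Order.max (h (K c)) (h (K' c)).
have fl z : z < c -> f z = h (K z) by rewrite /f => ->.
have fr z : c < z -> f z = h (K' z) by rewrite /f => cz; rewrite ltNge ltW//= cz.
have fc : f c = Order.max (h (K c)) (h (K' c)) by rewrite /f ltxx.
have Kmono u v : u <= v -> (K u <= K v)%N by exact: floor_index_mono.
have K'mono u v : u <= v -> (K' u <= K' v)%N by exact: ceil_index_mono.
have fM z : 0 <= f z <= M.
  have hK u : 0 <= h (K u) <= M by apply: hM; rewrite leqW.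
  have hK' u : 0 <= h (K' u) <= M by apply: hM; have /andP[] := K'n u.
  rewrite /f; case: ifP => // _; case: ifP => // _.
  by rewrite /Order.max; case: ifP.
have fT k : (1 <= k <= n.+1)%N -> f (T k) = h k.
  move=> /[dup] k1n /andP[k1 kn].
  have KT : K (T k) = k by exact: floor_indexK.
  have KT' : K' (T k) = k by exact: ceil_indexK.
  have [Tc|cT|Tc] := ltgtP (T k) c.
  - by rewrite fl// KT.
  - by rewrite fr// KT'.
  - by rewrite Tc fc -Tc KT KT' maxxx.
exists (fun z => f z / g z); last first.
  move=> i; have [k k1n ki] := order_indexK x i.
  by rewrite -ki -(order_statE x a b)// fT// /h HE// order_statE// mulfK.
exists f => //; split => //; split => u v au uv vb => [vc|cu].
- have [uc|cu] := ltP u c; last first.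
    have -> : u = c by apply/eqP; rewrite eq_le cu (le_trans uv).
    by have -> : v = c by apply/eqP; rewrite eq_le vc (le_trans cu).
  rewrite fl//; have [vc'|cv] := ltP v c.
    rewrite fl//; apply: hup; [exact: Kmono|exact: Kn|].
    apply: le_trans vc; apply: floor_indexP; exact: le_trans uv.
  have -> : v = c by apply/eqP; rewrite eq_le vc.
  by rewrite fc le_max; apply/orP; left; apply: hup => //; apply: Kmono; exact: ltW.
- have [cv|vc] := ltP c v; last first.
    have -> : v = c by apply/eqP; rewrite eq_le vc (le_trans cu).
    by have -> : u = c by apply/eqP; rewrite eq_le cu (le_trans uv).
  have K'v2 : (K' v <= n.+2)%N by have /andP[] := K'n v.
  rewrite (fr v)//; have [cu'|uc] := ltP c u.
    rewrite fr//; apply: hdown => //; first exact: K'mono.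
    apply: le_trans cu _; apply: ceil_indexP; first exact: lt_trans cu'.
    exact: le_trans vb.
  have -> : u = c by apply/eqP; rewrite eq_le uc cu.
  rewrite fc le_max; apply/orP; right; apply: hdown => //.
  by apply: K'mono; exact: ltW.
Qed.

Lemma convex_reducible :
  finitely_reducible (calL Convexity) x (discrete_convex a b M g x).
Proof.
have ga : 0 < g a by apply: g0; have /andP[ac cb] := acb; rewrite lexx ltW// (lt_trans ac).
have gb : 0 < g b by apply: g0; have /andP[ac cb] := acb; rewrite lexx andbT ltW// (lt_trans ac).
have ab : a <= b by have /andP[ac cb] := acb; rewrite ltW// (lt_trans ac).
split=> [_ [f [fM fcvx] ->]|y [L0 [L1 [yslope yM]]]].
  exists (f a / g a), (f b / g b).
  have H k : (k <= n.+2)%N -> ordered_val (f a / g a) (f b / g b) x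
      (fun i => f (x i) / g (x i)) k * g (T k) = f (T k).
    case: k => [_|k]; first by rewrite ordered_val0 order_stat0 divfK// gt_eqF.
    rewrite leq_eqVlt => /predU1P[[->]|kn]; last exact: HEf.
    by rewrite ordered_val_last order_stat_last divfK// gt_eqF.
  split=> [k kn|k kn]; last by rewrite H// fM// Tab.
  have kn1 : (k.+1 <= n.+2)%N by exact: leqW.
  have kn2 : (k <= n.+2)%N by exact: ltnW.
  rewrite !H//; apply: (convex_slope fcvx).
  - by have /andP[] := Tab kn2.
  - exact: order_stat_lt.
  - exact: order_stat_lt.
  - by have /andP[] := Tab (kn : (k.+2 <= n.+2)%N).
pose h k := ordered_val L0 L1 x y k * g (T k).
pose s k := (h k.+1 - h k) / (T k.+1 - T k).
have Tlt k : (k <= n.+1)%N -> T k < T k.+1 by move=> kn; exact: order_stat_lt.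
have smono i j : (i <= j)%N -> (j <= n.+1)%N -> s i <= s j.
  elim: j => [|j ih]; first by rewrite leqn0 => /eqP ->.
  rewrite leq_eqVlt => /predU1P[-> //|ij jn].
  by apply: le_trans (ih ij (ltnW jn)) _; exact: yslope.
have hS k : (k <= n.+1)%N -> h k.+1 = h k + s k * (T k.+1 - T k).
  move=> kn; rewrite /s divfK; first by rewrite addrC subrK.
  by rewrite gt_eqF// subr_gt0 Tlt.
pose line k z := h k + s k * (z - T k).
(* Slopes are nondecreasing, so the prolonged chord [k] rises too slowly to its right and descends
   too fast to its left; one induction away from [k] in each direction. *)
have line_le k j : (k <= n.+1)%N -> (j <= n.+2)%N -> line k (T j) <= h j.
  move=> kn; have [kj|jk] := leqP k j.
    elim: j kj => [|j ih]; first by rewrite leqn0 => /eqP <- _; rewrite /line subrr mulr0 addr0.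
    rewrite leq_eqVlt => /predU1P[<- _|kj jn]; first by rewrite /line subrr mulr0 addr0.
    have {}ih := ih kj (ltnW jn); rewrite hS//.
    have sk : s k * (T j.+1 - T j) <= s j * (T j.+1 - T j).
      by rewrite ler_wpM2r ?subr_ge0 ?(ltW (Tlt _ _))// smono.
    by move: ih sk; rewrite /line; nra.
  have [e kE] : exists e, k = (j + e)%N by exists (k - j)%N; rewrite subnKC// ltnW.
  move=> _; elim: e j {jk} kE => [|e ih] j kE.
    by rewrite kE addn0 /line subrr mulr0 addr0.
  have jk : (j < k)%N by rewrite kE addnS ltnS leq_addr.
  have {}ih := ih j.+1; rewrite addSn -addnS in ih; have {}ih := ih kE.
  have jn : (j <= n.+1)%N by rewrite (leq_trans _ kn)// ltnW.
  move: ih; rewrite hS//.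
  have sk : s j * (T j.+1 - T j) <= s k * (T j.+1 - T j).
    by rewrite ler_wpM2r ?subr_ge0 ?(ltW (Tlt _ _))// smono// ltnW.
  by move: sk; rewrite /line; nra.
pose f z := \big[Order.max/line 0%N z]_(k < n.+2) line k z.
have f_ge (k : 'I_n.+2) z : line k z <= f z by exact: (le_bigmax _ (fun k : 'I_n.+2 => line k z) k).
have f_le z u : (forall k : 'I_n.+2, line k z <= u) -> f z <= u.
  by move=> h1; apply: bigmax_le => [|k _]; [exact: (h1 ord0)|exact: h1].
have fT k : (k <= n.+2)%N -> f (T k) = h k.
  move=> kn; apply/eqP; rewrite eq_le; apply/andP; split.
    by apply: f_le => i; apply: line_le => //; rewrite -ltnS.
  (* No chord starts at the node [n.+2]; its value is attained at the right end of the chord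
     [n.+1]. *)
  move: kn; rewrite leq_eqVlt => /predU1P[->|kn].
    apply: le_trans (f_ge ord_max _); rewrite /line /= hS//.
  apply: le_trans (f_ge (Ordinal kn) _).
  by rewrite /line /= subrr mulr0 addr0.
have fcvx : @convex_function R R^o `[a, b] f.
  apply/convex_functionP => u v t _ _ /andP[t0 t1]; apply: f_le => k.
  have -> : line k (t * u + (1 - t) * v) = t * line k u + (1 - t) * line k v.
    by rewrite /line; ring.
  by rewrite lerD// ler_wpM2l ?subr_ge0.
have hM k : (k <= n.+2)%N -> 0 <= h k <= M.
  by move=> kn; exact: yM.
have fM z : a <= z <= b -> 0 <= f z <= M.
  move=> /andP[az zb]; apply/andP; split; last first.
    (* The bound [M] comes from the two endpoint variables: a convex function lies below the larger
       of its end values. *)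
    apply: (convex_superlevel fcvx (lexx a) az zb (lexx b)).
      by rewrite -[X in f X](order_stat0 x a b) fT//; have /andP[] := hM 0%N isT.
    by rewrite -[X in f X](order_stat_last x a b) fT//; have /andP[] := hM n.+2 (leqnn _).
  move: zb; rewrite le_eqVlt => /predU1P[->|zb].
    by rewrite -[X in f X](order_stat_last x a b) fT//; have /andP[] := hM n.+2 (leqnn _).
  pose k := floor_index x a b z.
  have kn : (k < n.+2)%N by rewrite ltnS floor_index_le.
  (* For nonnegativity the chord over the cell of [z] suffices: there it is a convex combination of
     two nonnegative node values. *)
  apply: le_trans (f_ge (Ordinal kn) z); rewrite /line /=.
  have Tz : T k <= z by exact: floor_indexP.
  have zT : z < T k.+1 by exact: lt_ceil_order_stat.
  have /andP[hk0 _] := hM k (ltnW kn); have /andP[hk1 _] := hM k.+1 kn.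
  have TT : 0 < T k.+1 - T k by rewrite subr_gt0 Tlt.
  have -> : h k + s k * (z - T k) =
      (h k * (T k.+1 - z) + h k.+1 * (z - T k)) / (T k.+1 - T k).
    by rewrite /s; field; rewrite gt_eqF.
  apply: divr_ge0; last exact: ltW.
  by apply: addr_ge0; apply: mulr_ge0 => //; rewrite subr_ge0// ltW.
exists (fun z => f z / g z).
  by exists f.
move=> i; have [k /[dup] k1n /andP[k1 kn] ki] := order_indexK x i.
rewrite -ki -(order_statE x a b)//.
rewrite fT; last exact: leqW.
by rewrite /h HE// order_statE// mulfK.
Qed.

Lemma shape_reducible s :
  finitely_reducible (calL s) x (discrete_shape a b c M g x s).
Proof.
case: s => /=; [exact: monotone_reducible|exact: convex_reducible|
  exact: unimodal_reducible].
Qed.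

End FinitelyReducible.

Lemma val_Pn_reduction (R : realType) (phi : nat -> R -> R) (mu : nat -> R)
    (m l n : nat) (x : 'I_n -> R) (calL : set (R -> R)) (C : set ('I_n -> R)) :
  finitely_reducible calL x C -> val_Pn phi mu m l calL x = val_Pn' phi mu m l x C.
Proof.
move=> [LC CL]; congr ereal_sup; apply/seteqP; split.
  move=> _ [L [/LC CLx Lle Leq] <-].
  by exists (fun i => L (x i)).
move=> _ [y [/CL[L SL Ly] yle yeq] <-].
have e j : sample_mean (fun i => phi j (x i) * L (x i)) =
    sample_mean (fun i => phi j (x i) * y i).
  by congr sample_mean; apply/funext => i; rewrite Ly.
exists L; last by rewrite e.
by split => // j hj; rewrite e; [exact: yle|exact: yeq].
Qed.

(** * Bounded functions of independent variables *)

(** The subtracted term is [t] rounded down to a multiple of [e]. If the top level is reached all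
    lower ones are; otherwise it contributes nothing and [N] drops by one. *)
Lemma staircase_sum (R : realType) (e t : R) (N : nat) : 0 < e -> 0 <= t < N.+1%:R * e ->
  0 <= t - e * \sum_(i < N) (i.+1%:R * e <= t)%R%:R <= e.
Proof.
move=> e0; elim: N => [|N ih] /andP[t0 tN].
  by rewrite big_ord0 mulr0 subr0 t0/= ltW// -[X in _ < X]mul1r.
rewrite big_ord_recr/=; case: (lerP (N.+1%:R * e) t) => [Nt|tNe].
  rewrite (eq_bigr (fun=> 1)); last first.
    move=> i _; rewrite (le_trans _ Nt)// ler_pM2r// ler_nat.
    by rewrite ltnW// ltnS.
  rewrite sumr_const card_ord -[1 *+ N]/(N%:R) -[true%:R]/(1 : R).
  have -> : N%:R + 1 = N.+1%:R :> R by rewrite natr1.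
  have N2 : N.+2%:R = N.+1%:R + 1 :> R by rewrite natr1.
  by rewrite N2 in tN; apply/andP; split; lra.
by rewrite addr0; apply: ih; rewrite t0.
Qed.

(** A discretised layer-cake formula. Levels start at 1 and not at 0, hence are strictly positive,
    where superlevel sets will be known to be intervals. *)
Lemma staircase (R : realType) (C t : R) (N : nat) : (0 < N)%N -> 0 < C -> 0 <= t <= C ->
  0 <= t - C / N%:R * \sum_(i < N) (i.+1%:R * (C / N%:R) <= t)%R%:R <= C / N%:R.
Proof.
move=> N0 C0 /andP[t0 tC]; apply: staircase_sum.
  by rewrite divr_gt0// ltr0n.
rewrite t0/=; apply: le_lt_trans tC _.
rewrite mulrCA ltr_pMr// ltr_pdivlMr ?ltr0n// mul1r ltr_nat//.
Qed.

Section BoundedExpectation.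
Context d (T : measurableType d) (R : realType) (P : probability T R).
Implicit Types (f g : T -> R).

Definition bounded_measurable d' (T' : measurableType d') (f : T' -> R) :=
  measurable_fun setT f /\ exists C : R, forall x, `|f x| <= C.

Local Notation bdd := bounded_measurable.
Local Notation Ex := (Rintegral P setT).

Lemma bdd_cst c : bdd (fun _ : T => c).
Proof. by split; [exact: measurable_cst|exists `|c|]. Qed.

Lemma bddD f g : bdd f -> bdd g -> bdd (fun x => f x + g x).
Proof.
move=> [mf [C fC]] [mg [D gD]]; split; first exact: measurable_funD.
by exists (C + D) => x; rewrite (le_trans (ler_normD _ _))// lerD.
Qed.

Lemma bddM f g : bdd f -> bdd g -> bdd (fun x => f x * g x).
Proof.
move=> [mf [C fC]] [mg [D gD]]; split; first exact: measurable_funM.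
by exists (C * D) => x; rewrite normrM ler_pM.
Qed.

Lemma bddZ c f : bdd f -> bdd (fun x => c * f x).
Proof. exact: bddM (bdd_cst c). Qed.

Lemma bddN f : bdd f -> bdd (fun x => - f x).
Proof.
move=> bf; rewrite (_ : (fun x => - f x) = (fun x => -1 * f x)).
  exact: bddZ.
by apply/funext => x; rewrite mulN1r.
Qed.

Lemma bddB f g : bdd f -> bdd g -> bdd (fun x => f x - g x).
Proof. by move=> bf bg; apply: bddD bf (bddN bg). Qed.

Lemma bddX n f : bdd f -> bdd (fun x => f x ^+ n).
Proof.
move=> bf; elim: n => [|n ih]; first exact: bdd_cst.
by under eq_fun do rewrite exprS; exact: bddM.
Qed.

Lemma bdd_sum I (s : seq I) (Q : pred I) (f : I -> T -> R) :
  (forall i, bdd (f i)) -> bdd (fun x => \sum_(i <- s | Q i) f i x).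
Proof.
move=> bf; elim: s => [|i s ih].
  by under eq_fun do rewrite big_nil; exact: bdd_cst.
under eq_fun do rewrite big_cons; case: (Q i) => //; exact: bddD.
Qed.

Lemma bdd_prod I (s : seq I) (Q : pred I) (f : I -> T -> R) :
  (forall i, bdd (f i)) -> bdd (fun x => \prod_(i <- s | Q i) f i x).
Proof.
move=> bf; elim: s => [|i s ih].
  by under eq_fun do rewrite big_nil; exact: bdd_cst.
under eq_fun do rewrite big_cons; case: (Q i) => //; exact: bddM.
Qed.

Lemma bdd_indic (A : set T) : measurable A -> bdd (\1_A : T -> R).
Proof.
move=> mA; split; first exact: measurable_indic.
by exists 1 => x; rewrite indicE; case: (_ \in _); rewrite ?normr1 ?normr0.
Qed.

Lemma bdd_integrable f : bdd f -> P.-integrable setT (EFin \o f).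
Proof.
move=> [mf [C fC]]; apply: measurable_bounded_integrable => //.
- by rewrite /= probability_setT ltry.
- exists C; split; first exact: num_real.
  by move=> x Cx y _ /=; rewrite (le_trans (fC y))// ltW.
Qed.

Lemma expD f g : bdd f -> bdd g -> Ex (fun x => f x + g x) = Ex f + Ex g.
Proof. by move=> bf bg; rewrite RintegralD//; exact: bdd_integrable. Qed.

Lemma expB f g : bdd f -> bdd g -> Ex (fun x => f x - g x) = Ex f - Ex g.
Proof. by move=> bf bg; rewrite RintegralB//; exact: bdd_integrable. Qed.

Lemma expZ c f : bdd f -> Ex (fun x => c * f x) = c * Ex f.
Proof. by move=> bf; rewrite RintegralZl//; exact: bdd_integrable. Qed.

Lemma exp_cst c : Ex (fun _ => c) = c.
Proof. by rewrite Rintegral_cst//= probability_setT mulr1. Qed.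

Lemma exp_sum I (s : seq I) (Q : pred I) (f : I -> T -> R) :
  (forall i, bdd (f i)) ->
  Ex (fun x => \sum_(i <- s | Q i) f i x) = \sum_(i <- s | Q i) Ex (f i).
Proof.
move=> bf; elim: s => [|i s ih].
  by under eq_Rintegral do rewrite big_nil; rewrite big_nil exp_cst.
under eq_Rintegral do rewrite big_cons; rewrite big_cons; case: (Q i) => //.
by rewrite expD// ?ih//; exact: bdd_sum.
Qed.

Lemma exp_le f g : bdd f -> bdd g -> (forall x, f x <= g x) -> Ex f <= Ex g.
Proof. by move=> bf bg fg; apply: le_Rintegral => //; exact: bdd_integrable. Qed.

Lemma exp_ge0 f : (forall x, 0 <= f x) -> 0 <= Ex f.
Proof. by move=> f0; exact: Rintegral_ge0. Qed.

Lemma exp_indic (A : set T) : measurable A -> Ex (\1_A) = fine (P A).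
Proof. by move=> mA; rewrite /Rintegral integral_indic// setIT. Qed.

Lemma bdd_markov f c : bdd f -> (forall x, 0 <= f x) -> 0 < c ->
  (P [set x | (c <= f x)%R] <= (Ex f / c)%:E)%E.
Proof.
move=> bf f0 c0; have mA : measurable [set x | c <= f x].
  rewrite -[X in measurable X]setTI; apply: measurable_fun_le => //.
  by case: bf.
rewrite -(fineK (fin_num_measure P _ mA)) lee_fin ler_pdivlMr// mulrC.
rewrite -exp_indic// -expZ; last exact: bdd_indic.
apply: exp_le => //; first by apply: bddZ; exact: bdd_indic.
move=> x; rewrite indicE; case: (boolP (x \in _)); rewrite ?mulr1 ?mulr0//.
by rewrite inE.
Qed.

End BoundedExpectation.

#[global] Hint Extern 0 (bounded_measurable _) =>
  solve [assumption | exact: bdd_cst] : core.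

Ltac bdd := repeat first [assumption | exact: bdd_cst | apply: bddD
  | apply: bddM | apply: bddN | apply: bddX | apply: bdd_sum => ?
  | apply: bdd_prod => ?].

(** * Product formulas and moments of sums of independent variables *)

Section Independence.
Context d (T : measurableType d) (R : realType) (P : probability T R).
Local Notation bdd := (bounded_measurable (R := R)).
Local Notation Ex := (Rintegral P setT).

Lemma bdd_comp (Y : {RV P >-> R}) (k : R -> R) :
  bdd k -> bdd (fun w => k (Y w)).
Proof.
move=> [mk [C kC]]; split; last by exists C => x.
exact: measurableT_comp.
Qed.

(* Staircase approximation of k by indicators of its superlevel sets. *)
Lemma exp_mul_of_indic (G : T -> R) (Y : {RV P >-> R}) (c : R) : bdd G ->
  (forall A, measurable A ->
    Ex (fun w => G w * \1_A (Y w)) = c * Ex (fun w => \1_A (Y w))) ->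
  forall k, bdd k -> Ex (fun w => G w * k (Y w)) = c * Ex (fun w => k (Y w)).
Proof.
move=> bG GA; pose I A (w : T) : R := \1_A (Y w).
have bI A : measurable A -> bdd (I A).
  by move=> mA; apply: bdd_comp; exact: bdd_indic.
have bounds : exists2 B : R, 0 < B & forall w, `|G w| <= B.
  have [_ [B GB]] := bG; exists (`|B| + 1); first by rewrite ltr_wpDl.
  by move=> w; rewrite (le_trans (GB w))// (le_trans (ler_norm _))// lerDl.
have [B B0 GB] := bounds.
have pos k (C : R) : bdd k -> 0 < C -> (forall x, 0 <= k x <= C) ->
    Ex (fun w => G w * k (Y w)) = c * Ex (fun w => k (Y w)).
  move=> bk C0 kC.
  pose kN N (x : R) : R :=
    C / N.+1%:R * \sum_(i < N.+1) \1_[set y | i.+1%:R * (C / N.+1%:R) <= k y] x.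
  have mA N i : measurable [set y | i.+1%:R * (C / N.+1%:R) <= k y].
    rewrite -[X in measurable X]setTI; apply: measurable_fun_le => //.
    by case: bk.
  have bkN N : bdd (kN N).
    by apply: bddZ; apply: bdd_sum => i; exact: bdd_indic.
  have kkN N x : 0 <= k x - kN N x <= C / N.+1%:R.
    rewrite (_ : kN N x = C / N.+1%:R *
        \sum_(i < N.+1) (i.+1%:R * (C / N.+1%:R) <= k x)%R%:R).
      exact: staircase.
    congr (_ * _); apply: eq_bigr => i _.
    rewrite indicE; case: (boolP (_ <= k x)) => h; first by rewrite mem_set.
    by rewrite memNset//; exact/negP.
  have eqN N : Ex (fun w => G w * kN N (Y w)) = c * Ex (fun w => kN N (Y w)).
    have bsum : bdd (fun w => \sum_(i < N.+1)
        I [set y | i.+1%:R * (C / N.+1%:R) <= k y] w).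
      by apply: bdd_sum => i; exact: bI.
    rewrite [in RHS]expZ//.
    rewrite (_ : (fun w => _) = (fun w => C / N.+1%:R * \sum_(i < N.+1)
        (G w * I [set y | i.+1%:R * (C / N.+1%:R) <= k y] w))); last first.
      by apply/funext => w; rewrite /kN mulrCA mulr_sumr.
    rewrite expZ; last by apply: bdd_sum => i; apply: bddM => //; exact: bI.
    rewrite !exp_sum; [|by move=> i; exact: bI|
      by move=> i; apply: bddM => //; exact: bI].
    rewrite mulrCA; congr (_ * _); rewrite mulr_sumr.
    by apply: eq_bigr => i _; rewrite GA.
  have bkY := bdd_comp Y bk; have bkNY N := bdd_comp Y (bkN N).
  apply/eqP; rewrite -subr_eq0 -normr_le0; apply/ler_addgt0Pl => e e0.
  rewrite addr0.
  have [N hN] : exists N, (B + `|c|) * (C / N.+1%:R) <= e.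
    have K0 : 0 < (B + `|c|) * C by rewrite mulr_gt0// ltr_wpDr.
    exists (Num.truncn ((B + `|c|) * C / e)).
    rewrite mulrA ler_pdivrMr// -ler_pdivrMl// mulrC.
    exact/ltW/truncnS_gt.
  apply: le_trans hN; rewrite mulrDl.
  rewrite (_ : Ex _ - _ = Ex (fun w => G w * (k (Y w) - kN N (Y w))) -
      c * Ex (fun w => k (Y w) - kN N (Y w))); last first.
    rewrite [in RHS]expB// mulrBr.
    rewrite (_ : (fun w => G w * (k (Y w) - kN N (Y w))) =
        (fun w => G w * k (Y w) - G w * kN N (Y w))); last first.
      by apply/funext => w; rewrite mulrBr.
    rewrite [X in _ = X - _]expB ?eqN; [|exact: bddM|exact: bddM].
    by rewrite -/(kN N); lra.
  have bD : bdd (fun w => k (Y w) - kN N (Y w)) by exact: bddB.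
  have absE f (D : R) : bdd f -> (forall w, `|f w| <= D) -> `|Ex f| <= D.
    move=> bf fD; rewrite -[D](exp_cst P) ler_norml.
    rewrite -mulN1r -expZ//; apply/andP; split; apply: exp_le => //.
    - by move=> w; have := fD w; rewrite ler_norml mulN1r => /andP[].
    - by move=> w; rewrite (le_trans (ler_norm _))// fD.
  rewrite (le_trans (ler_normB _ _))// lerD//.
    apply: absE; first exact: bddM.
    move=> w; rewrite normrM ler_pM//.
    by have /andP[h0 h1] := kkN N (Y w); rewrite ger0_norm.
  rewrite normrM ler_wpM2l//; apply: absE => // w.
  by have /andP[h0 h1] := kkN N (Y w); rewrite ger0_norm.
move=> k bk; have [mk [C kC]] := bk.
have bkY := bdd_comp Y bk.
have [D D0 range] : exists2 D : R, 0 < D & forall x, 0 <= k x + D <= 2 * D.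
  exists (`|C| + 1) => [|x]; first by rewrite ltr_wpDl.
  have := kC x; have := ler_norm C.
  by rewrite !ler_norml => h1 /andP[h2 h3]; apply/andP; split; lra.
have D20 : 0 < 2 * D by rewrite mulr_gt0.
have bk' : bdd (fun x => k x + D) by apply: bddD.
have := pos _ _ bk' D20 range.
have -> : (fun w => G w * (k (Y w) + D)) =
    (fun w => G w * k (Y w) + D * G w).
  by apply/funext => w; ring.
have GE : Ex G = c.
  have := GA setT measurableT.
  have -> : (fun w => G w * \1_setT (Y w)) = G.
    by apply/funext => w; rewrite indicT mulr1.
  have -> : (fun w => \1_setT (Y w)) = (fun=> 1 : R).
    by apply/funext => w; rewrite indicT.
  by rewrite exp_cst mulr1.
rewrite !expD//; [|exact: bddM|exact: bddZ].
rewrite expZ// exp_cst GE => h; apply: (addIr (D * c)).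
by rewrite h; ring.
Qed.

Variable X : nat -> {RV P >-> R}.
Hypothesis indepX : mutually_independent X.

Lemma exp_prod_indic n (A : nat -> set R) : (forall i, measurable (A i)) ->
  Ex (fun w => \prod_(i < n) \1_(A i) (X i w)) =
  \prod_(i < n) Ex (fun w => \1_(A i) (X i w)).
Proof.
move=> mA.
have EI i : Ex (fun w => \1_(A i) (X i w)) = fine (P (X i @^-1` A i)).
  rewrite -exp_indic; last by rewrite -[X in measurable X]setTI; exact: measurable_funP.
  by [].
under [RHS]eq_bigr do rewrite EI.
pose J : {fset nat} := [fset i in iota 0 n]%fset.
have memJ i : (i \in J) = (i < n)%N by rewrite !inE/= mem_iota.
have prodJ (F : nat -> R) : \prod_(i < n) F i = \prod_(i <- J) F i.
  rewrite -(big_mkord xpredT F) /index_iota subn0.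
  apply: perm_big; apply: uniq_perm; [exact: iota_uniq|exact: fset_uniq|].
  by move=> i; rewrite mem_iota add0n -memJ.
rewrite (prodJ (fun i => fine (P (X i @^-1` A i)))).
have mX i : measurable (X i @^-1` A i).
  by rewrite -[X in measurable X]setTI; exact: measurable_funP.
have <- : fine (P (\bigcap_(i in [set` J]) (X i @^-1` A i))) =
    \prod_(i <- J) fine (P (X i @^-1` A i)).
  rewrite indepX//; elim: (enum_fset J) => [|i s ih]; first by rewrite !big_nil.
  rewrite !big_cons fineM ?ih//; first exact: fin_num_measure.
  by apply: prode_fin_num => j _; exact: fin_num_measure.
rewrite -exp_indic; last by apply: fin_bigcap_measurable.
congr (Rintegral _ _ _); apply/funext => w.
rewrite (prodJ (fun i => \1_(A i) (X i w))) indicE.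
case: (pselect ((\bigcap_(i in [set` J]) X i @^-1` A i) w)) => wJ.
  rewrite (mem_set wJ) big_seq big1// => i iJ.
  by rewrite indicE mem_set//; apply: wJ.
have [i iJ wi] : exists2 i, i \in J & ~ A i (X i w).
  by apply: contrapT => h; apply: wJ => i iJ; apply: contrapT => k; apply: h; exists i.
by rewrite (memNset wJ) (big_rem i)//= indicE memNset// mul0r.
Qed.

(** Independence is given for sets only. Induction on a rank [r] from which all factors are
    indicators: [exp_mul_of_indic] reduces a general factor at coordinate [r] to an indicator, the
    other factors being frozen in [G]. *)
Lemma exp_prod n (k : nat -> R -> R) : (forall i, bdd (k i)) ->
  Ex (fun w => \prod_(i < n) k i (X i w)) =
  \prod_(i < n) Ex (fun w => k i (X i w)).
Proof.
pose Q (k : nat -> R -> R) := Ex (fun w => \prod_(i < n) k i (X i w)) =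
  \prod_(i < n) Ex (fun w => k i (X i w)).
have congQ k1 k2 : (forall i, (i < n)%N -> k1 i = k2 i) -> Q k1 -> Q k2.
  move=> e12; rewrite /Q.
  have -> : (fun w => \prod_(i < n) k1 i (X i w)) =
      (fun w => \prod_(i < n) k2 i (X i w)).
    by apply/funext => w; apply: eq_bigr => i _; rewrite e12.
  by move=> ->; apply: eq_bigr => i _; rewrite e12.
(* Coordinates from [n] on do not enter the product; making them indicators of the full line lets
   the induction be used at [r = n]. *)
pose trunc (k : nat -> R -> R) i := if (i < n)%N then k i else \1_setT.
have truncQ k1 : Q (trunc k1) -> Q k1.
  by apply: congQ => i ni; rewrite /trunc ni.
have btrunc k1 : (forall i, bdd (k1 i)) -> forall i, bdd (trunc k1 i).
  by move=> b1 i; rewrite /trunc; case: ifP => // _; exact: bdd_indic.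
have tail k1 i : (n <= i)%N -> exists2 A, measurable A & trunc k1 i = \1_A.
  by move=> ni; exists setT => //; rewrite /trunc ltnNge ni.
suff main : forall r (k : nat -> R -> R), (forall i, bdd (k i)) ->
    (forall i, (r <= i)%N -> exists2 A, measurable A & k i = \1_A) -> Q k.
  by move=> bk; apply: truncQ; apply: (main n); [exact: btrunc|exact: tail].
elim => [|r ih] {}k bk kA.
  have /choice[A hA] : forall i, exists A, measurable A /\ k i = \1_A.
    by move=> i; have [A mA ->] := kA i isT; exists A.
  have -> : k = fun i => \1_(A i) by apply/funext => i; have [_ ->] := hA i.
  by apply: exp_prod_indic => i; have [] := hA i.
have [rn|nr] := ltnP r n; last first.
  apply: truncQ; apply: ih; first exact: btrunc.
  by move=> i ri; apply: tail; exact: leq_trans ri.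
pose r' := Ordinal rn; rewrite /Q.
under eq_Rintegral do rewrite (bigD1 r')//= mulrC.
rewrite (bigD1 r')//= mulrC.
apply: exp_mul_of_indic => //.
  by apply: bdd_prod => i; exact: bdd_comp.
move=> A mA; pose k' i := if i == r then \1_A else k i.
have -> : (fun w => \prod_(i < n | i != r') k i (X i w) * \1_A (X r w)) =
    (fun w => \prod_(i < n) k' i (X i w)).
  apply/funext => w; rewrite [RHS](bigD1 r')//= [RHS]mulrC.
  congr (_ * _); last by rewrite /k' eqxx.
  by apply: eq_bigr => i ir; rewrite /k' (negbTE (ir : i != r :> nat)).
have -> : \prod_(i < n | i != r') Ex (fun w => k i (X i w)) *
    Ex (fun w => \1_A (X r w)) = \prod_(i < n) Ex (fun w => k' i (X i w)).
  rewrite [RHS](bigD1 r')//= [RHS]mulrC.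
  congr (_ * _); last by rewrite /k' eqxx.
  by apply: eq_bigr => i ir; rewrite /k' (negbTE (ir : i != r :> nat)).
apply: ih.
  by move=> i; rewrite /k'; case: ifPn => // _; exact: bdd_indic.
move=> i ri; rewrite /k'; case: eqVneq => [_|ir]; first by exists A.
by apply: kA; rewrite ltn_neqAle eq_sym ir.
Qed.

(* Polynomials in bounded functions of X 0, ..., X n.-1. *)
Definition past n (F : T -> R) := exists (I : finType) (k : I -> nat -> R -> R),
  (forall q i, bdd (k q i)) /\
  forall w, F w = \sum_q \prod_(i < n) k q i (X i w).

Lemma past_bdd n F : past n F -> bdd F.
Proof.
move=> [I [k [bk Fk]]]; rewrite (_ : F = fun w => \sum_q \prod_(i < n) k q i (X i w)).
  by apply: bdd_sum => q; apply: bdd_prod => i; exact: bdd_comp.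
exact/funext.
Qed.

Lemma pastD n F G : past n F -> past n G -> past n (fun w => F w + G w).
Proof.
move=> [I [k [bk Fk]]] [J [h [bh Gh]]].
exists (I + J)%type, (fun q => match q with inl q => k q | inr q => h q end).
split; first by case.
by move=> w; rewrite big_sumType/= Fk Gh.
Qed.

Lemma pastM n F G : past n F -> past n G -> past n (fun w => F w * G w).
Proof.
move=> [I [k [bk Fk]]] [J [h [bh Gh]]].
exists (I * J)%type, (fun q i x => k q.1 i x * h q.2 i x).
split; first by move=> q i; apply: bddM.
move=> w; rewrite -(pair_bigA _ (fun q r => \prod_(i < n) (k q i (X i w) * h r i (X i w))))/=.
rewrite Fk Gh big_distrlr/=; apply: eq_bigr => q _; apply: eq_bigr => r _.
by rewrite big_split.
Qed.

Lemma past_exp_mul n F k : past n F -> bdd k ->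
  Ex (fun w => F w * k (X n w)) = Ex F * Ex (fun w => k (X n w)).
Proof.
move=> [I [h [bh Fh]]] bk.
have -> : F = fun w => \sum_q \prod_(i < n) h q i (X i w) by exact/funext.
pose h' q i := if i == n then k else h q i.
have bh' q i : bdd (h' q i) by rewrite /h'; case: ifP.
have h'E q w : \prod_(i < n) h q i (X i w) * k (X n w) =
    \prod_(i < n.+1) h' q i (X i w).
  rewrite big_ord_recr/= /h' eqxx; congr (_ * _).
  by apply: eq_bigr => i _; rewrite ltn_eqF.
under eq_Rintegral do (rewrite mulr_suml; under eq_bigr do rewrite h'E).
rewrite !exp_sum; first last.
- by move=> q; apply: bdd_prod => i; exact: bdd_comp.
- by move=> q; apply: bdd_prod => i; exact: bdd_comp.
rewrite mulr_suml; apply: eq_bigr => q _.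
rewrite !exp_prod// big_ord_recr/= /h' eqxx; congr (_ * _).
by apply: eq_bigr => i _; rewrite ltn_eqF.
Qed.

Lemma past_next n k : bdd k -> past n.+1 (fun w => k (X n w)).
Proof.
move=> bk; exists unit, (fun _ i => if i == n then k else fun=> 1); split.
  by move=> _ i; case: ifP.
move=> w; rewrite (big_pred1 tt); last by case.
rewrite big_ord_recr/= eqxx big1 ?mul1r// => i _.
by rewrite ltn_eqF.
Qed.

Lemma pastS n F : past n F -> past n.+1 F.
Proof.
move=> [I [k [bk Fk]]].
exists I, (fun q i => if i == n then fun=> 1 else k q i); split.
  by move=> q i; case: ifP.
move=> w; rewrite Fk; apply: eq_bigr => q _.
rewrite big_ord_recr/= eqxx mulr1; apply: eq_bigr => i _.
by rewrite ltn_eqF.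
Qed.

Lemma past_sum n k : bdd k -> past n (fun w => \sum_(i < n) k (X i w)).
Proof.
move=> bk; elim: n => [|n ih].
  exists void, (fun _ _ _ => 0); split=> // w.
  by rewrite [LHS]big_ord0 [RHS]big1// => q; case: q.
under eq_fun do rewrite big_ord_recr.
by apply: pastD; [exact: pastS|exact: past_next].
Qed.

Hypothesis identX : forall i k, bdd k ->
  Ex (fun w => k (X i w)) = Ex (fun w => k (X 0%N w)).
Notation mean k := (Ex (fun w => k (X 0%N w))).

Lemma exp_sum_sqr n u : bdd u -> mean u = 0 ->
  Ex (fun w => (\sum_(i < n) u (X i w)) ^+ 2) =
  n%:R * mean (fun x => u x ^+ 2).
Proof.
move=> bu u0; elim: n => [|n ih].
  by under eq_Rintegral do rewrite big_ord0 expr0n; rewrite exp_cst mul0r.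
have pA := past_sum n bu; set A := (fun w => _) in pA.
have bA := past_bdd pA.
have bX k : bdd k -> bdd (fun w => k (X n w)) by exact: bdd_comp.
rewrite (_ : (fun w => _) = fun w => A w ^+ 2 + (2 * (A w * u (X n w)) +
   (fun x => u x ^+ 2) (X n w))); last first.
  by apply/funext => w; rewrite big_ord_recr/= -/(A w); ring.
have bu2 := bX _ (bddX 2 bu); have bun := bX _ bu.
rewrite !expD ?expZ; [|bdd..].
rewrite ih (past_exp_mul pA bu) (identX n bu) u0 (identX n (bddX 2 bu)).
by rewrite -natr1; ring.
Qed.

Lemma exp_sum_mul n u v : bdd u -> bdd v -> mean u = 0 -> mean v = 0 ->
  Ex (fun w => (\sum_(i < n) u (X i w)) * (\sum_(i < n) v (X i w))) =
  n%:R * mean (fun x => u x * v x).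
Proof.
move=> bu bv u0 v0; elim: n => [|n ih].
  by under eq_Rintegral do rewrite big_ord0 mul0r; rewrite exp_cst mul0r.
have pA := past_sum n bu; set A := (fun w => _) in pA.
have pB := past_sum n bv; set B := (fun w => _) in pB.
have bA := past_bdd pA; have bB := past_bdd pB.
have bX k : bdd k -> bdd (fun w => k (X n w)) by exact: bdd_comp.
have buv : bdd (fun x => u x * v x) by bdd.
rewrite (_ : (fun w => _) = fun w => A w * B w + (A w * v (X n w) +
   (B w * u (X n w) + (fun x => u x * v x) (X n w)))); last first.
  by apply/funext => w; rewrite !big_ord_recr/= -/(A w) -/(B w); ring.
have bun := bX _ bu; have bvn := bX _ bv; have buvn := bX _ buv.
rewrite !expD; [|bdd..].
rewrite ih (past_exp_mul pA bv) (past_exp_mul pB bu) (identX n bu) (identX n bv) (identX n buv) u0 v0.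
by rewrite -natr1; ring.
Qed.

(** Expanding [(A + u)^2 (B + v)^2] with a fresh sample, every term containing a centred factor to
    the first power and independent of the rest vanishes. What is added is at most [n + n + 4 n + 3]
    times [a * b], that is [3 ((n + 1)^2 - n^2) a b], which explains the constant 3. *)
Lemma exp_sum_sqr_mul n u v (a b : R) : bdd u -> bdd v ->
  mean u = 0 -> mean v = 0 ->
  mean (fun x => u x ^+ 2) <= a -> mean (fun x => v x ^+ 2) <= b ->
  mean (fun x => u x * v x) ^+ 2 <= a * b ->
  mean (fun x => u x ^+ 2 * v x ^+ 2) <= 3 * (a * b) ->
  Ex (fun w => (\sum_(i < n) u (X i w)) ^+ 2 * (\sum_(i < n) v (X i w)) ^+ 2)
    <= 3 * n%:R ^+ 2 * (a * b).
Proof.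
move=> bu bv u0 v0 ua vb uvab u2v2; elim: n => [|n ih].
  under eq_Rintegral do rewrite big_ord0 expr0n mul0r.
  by rewrite exp_cst expr0n mulr0 mul0r.
have EA2 := exp_sum_sqr n bu u0; have EB2 := exp_sum_sqr n bv v0.
have EAB := exp_sum_mul n bu bv u0 v0.
have pA := past_sum n bu; set A := (fun w => _) in pA.
have pB := past_sum n bv; set B := (fun w => _) in pB.
rewrite -/(A _) in EA2; rewrite -/(B _) in EB2; rewrite -/A -/B in EAB.
have bA := past_bdd pA; have bB := past_bdd pB.
pose u2 x := u x ^+ 2; pose v2 x := v x ^+ 2; pose uv x := u x * v x.
pose uv2 x := u x * v x ^+ 2; pose u2v x := u x ^+ 2 * v x.
pose u2v2' x := u x ^+ 2 * v x ^+ 2.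
have bu2 : bdd u2 by rewrite /u2; bdd.
have bv2 : bdd v2 by rewrite /v2; bdd.
have buv : bdd uv by rewrite /uv; bdd.
have buv2 : bdd uv2 by rewrite /uv2; bdd.
have bu2v : bdd u2v by rewrite /u2v; bdd.
have bu2v2 : bdd u2v2' by rewrite /u2v2'; bdd.
have bX k : bdd k -> bdd (fun w => k (X n w)) by exact: bdd_comp.
have pAA := pastM pA pA; have pBB := pastM pB pB; have pAB := pastM pA pB.
have pAAB := pastM pAA pB; have pABB := pastM pAB pB.
have [[[[b1 b2] b3] b4] b5] := (past_bdd pAA, past_bdd pBB, past_bdd pAB, past_bdd pAAB, past_bdd pABB).
have [[[[c1 c2] c3] c4] c5] := (bX _ bu2, bX _ bv2, bX _ buv, bX _ buv2, bX _ bu2v).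
have c6 := bX _ bu2v2; have c7 := bX _ bu; have c8 := bX _ bv.
rewrite (_ : (fun w => _) = fun w => A w ^+ 2 * B w ^+ 2 +
   (2 * ((A w * A w * B w) * v (X n w)) + ((A w * A w) * v2 (X n w) +
   (2 * ((A w * B w * B w) * u (X n w)) + (4 * ((A w * B w) * uv (X n w)) +
   (2 * (A w * uv2 (X n w)) + ((B w * B w) * u2 (X n w) +
   (2 * (B w * u2v (X n w)) + u2v2' (X n w))))))))); last first.
  apply/funext => w; rewrite !big_ord_recr/= -/(A w) -/(B w).
  by rewrite /u2v2' /u2v /u2 /v2 /uv2 /uv; ring.
rewrite !expD ?expZ; [|bdd..].
rewrite (past_exp_mul pAAB bv) (past_exp_mul pAA bv2) (past_exp_mul pABB bu).
rewrite (past_exp_mul pAB buv) (past_exp_mul pA buv2) (past_exp_mul pBB bu2).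
rewrite (past_exp_mul pB bu2v) !(identX n)// u0 v0.
have EA : Ex A = 0.
  rewrite exp_sum; last by move=> i; exact: bdd_comp.
  by rewrite big1// => i _; rewrite identX.
have EB : Ex B = 0.
  rewrite exp_sum; last by move=> i; exact: bdd_comp.
  by rewrite big1// => i _; rewrite identX.
rewrite EA EB EAB.
have -> : Ex (fun w => A w * A w) = n%:R * mean u2.
  by rewrite -EA2; congr (Ex _); apply/funext => w; rewrite expr2.
have -> : Ex (fun w => B w * B w) = n%:R * mean v2.
  by rewrite -EB2; congr (Ex _); apply/funext => w; rewrite expr2.
have n0 : 0 <= n%:R :> R by [].
have mu0 : 0 <= mean u2 by apply: exp_ge0 => w; exact: sqr_ge0.
have mv0 : 0 <= mean v2 by apply: exp_ge0 => w; exact: sqr_ge0.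
have mm : mean u2 * mean v2 <= a * b by exact: ler_pM.
rewrite -natr1 -/uv in uvab *.
have h1 : n%:R * (mean u2 * mean v2) <= n%:R * (a * b) by rewrite ler_wpM2l.
have h2 : n%:R * (mean uv ^+ 2) <= n%:R * (a * b) by rewrite ler_wpM2l.
rewrite -/u2v2' in u2v2; rewrite -/(A _) -/(B _) in ih.
move: h1 h2 ih u2v2.
set z1 := mean u2; set z2 := mean v2; set z3 := mean uv; set z4 := mean u2v2'.
set ab := a * b; set z5 := Ex _ => h1 h2 ih u2v2.
nra.
Qed.

End Independence.

(** * A chaining maximal inequality *)

(** Either [10 y <= x], and [(11/10)^4 < 3/2], or [x + y <= 11 y]. The factor of [x ^+ 4] must stay
    below 2 for the bisection to contract: two halves, each with a quarter of the squared mass. *)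
Lemma quartic_split (R : realFieldType) (x y : R) : 0 <= x -> 0 <= y ->
  (x + y) ^+ 4 <= 3 / 2 * x ^+ 4 + 11 ^+ 4 * y ^+ 4.
Proof.
move=> x0 y0; have [yx|xy] := lerP (10 * y) x.
  apply: (@le_trans _ _ ((11 / 10 * x) ^+ 4)).
    by rewrite lerXn2r// ?nnegrE; lra.
  rewrite exprMn; apply: ler_wpDr; first by rewrite mulr_ge0 ?exprn_ge0.
  by rewrite ler_wpM2r ?exprn_ge0//; lra.
apply: (@le_trans _ _ ((11 * y) ^+ 4)).
  by rewrite lerXn2r// ?nnegrE; lra.
by rewrite exprMn lerDr mulr_ge0 ?exprn_ge0//; lra.
Qed.

(** Here [a], [b] are the increments on both sides of a point [j], [x] is the increment between [j]
    and a splitting point [h], and [z], [e] are those on both sides of [h]. The second minimum does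
    not involve [j], so it is a single random variable and not a maximum. *)
Lemma min_le_split_l (R : realFieldType) (a b z e x : R) : 0 <= x -> 0 <= z -> 0 <= e ->
  a <= x + z -> b <= e + x ->
  Order.min a b <= Order.min a x + Order.min z e.
Proof.
rewrite !minEle => x0 z0 e0.
by case: (lerP a b); case: (lerP a x); case: (lerP z e); lra.
Qed.

Lemma min_le_split_r (R : realFieldType) (a b z e x : R) : 0 <= x -> 0 <= z -> 0 <= e ->
  a <= x + z -> b <= e + x ->
  Order.min a b <= Order.min x b + Order.min z e.
Proof.
rewrite !minEle => x0 z0 e0.
by case: (lerP a b); case: (lerP x b); case: (lerP z e); lra.
Qed.

Section Maximal.
Context d (T : measurableType d) (R : realType) (P : probability T R).
Local Notation bdd := (bounded_measurable (R := R)).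
Local Notation Ex := (Rintegral P setT).

(** The mass at [h] itself goes to neither side, since it may exceed half of the total; the jump
    across it is handled by using both [h] and [h.+1] as splitting points. *)
Lemma half_mass_index (u : nat -> R) i k : (i < k)%N -> (forall j, 0 <= u j) ->
  exists2 h, (i <= h < k)%N &
    \sum_(i <= j < h) u j <= (\sum_(i <= j < k) u j) / 2 /\
    \sum_(h.+1 <= j < k) u j <= (\sum_(i <= j < k) u j) / 2.
Proof.
move=> ik u0; set U := \sum_(i <= j < k) u j.
have U0 : 0 <= U by apply: sumr_ge0.
pose Q h := (i <= h < k)%N && (\sum_(i <= j < h) u j <= U / 2).
have Qi : exists h, Q h by exists i; rewrite /Q leqnn ik big_geq// divr_ge0.
have Qb h : Q h -> (h <= k)%N by move=> /andP[/andP[_ /ltnW]].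
case: (ex_maxnP Qi Qb) => h /andP[/andP[ih hk] hU] hmax.
exists h; first by rewrite ih hk.
split => //; have [hk'|kh] := ltnP h.+1 k; last by rewrite big_geq// divr_ge0.
have : ~~ Q h.+1 by apply/negP => /hmax; rewrite ltnn.
rewrite /Q hk' (leqW ih)/= -ltNge => lt.
have : U = \sum_(i <= j < h.+1) u j + \sum_(h.+1 <= j < k) u j.
  by rewrite /U (@big_cat_nat _ _ _ h.+1)// ltnW// ltnW.
lra.
Qed.

Variables (S : nat -> T -> R) (u : nat -> R) (c : R).
Hypothesis bS : forall j, bdd (S j).
Hypothesis u0 : forall j, 0 <= u j.
Hypothesis c0 : 0 <= c.
Hypothesis mom : forall i j k, (i <= j <= k)%N ->
  Ex (fun w => (S j w - S i w) ^+ 2 * (S k w - S j w) ^+ 2) <=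
  c * (\sum_(i <= q < k) u q) ^+ 2.

Let beta : R := 11 ^+ 4.
Let beta0 : 0 <= beta. Proof. exact: exprn_ge0. Qed.

Lemma le_min_quartic (x y : R) :
  Order.min `|x| `|y| ^+ 4 <= x ^+ 2 * y ^+ 2.
Proof.
rewrite -[x ^+ 2]real_normK ?num_real// -[y ^+ 2]real_normK ?num_real//.
rewrite (_ : _ ^+ 4 = Order.min `|x| `|y| ^+ 2 * Order.min `|x| `|y| ^+ 2).
  by rewrite ler_pM ?sqr_ge0// lerXn2r ?nnegrE ?ge_min ?lexx ?orbT// le_min !normr_ge0.
by rewrite -exprD.
Qed.

(* The chaining majorant: splitting at the index of half mass loses a factor
   3/2 per half while the squared mass is divided by 4. *)
Lemma maximal_majorant i k : (i <= k)%N -> exists W : T -> R,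
  [/\ bdd W, forall w, 0 <= W w,
    forall w j, (i <= j <= k)%N ->
      Order.min `|S j w - S i w| `|S k w - S j w| ^+ 4 <= W w
  & Ex W <= 8 * beta * (c * (\sum_(i <= q < k) u q) ^+ 2)].
Proof.
have [n] := ubnP (k - i); elim: n i k => // n ih i k kin ik.
have [ki|{}ik] := leqP k i.
  exists (fun=> 0); split => //.
  - move=> w j /andP[ij jk]; have -> : j = i.
      by apply/eqP; rewrite eqn_leq ij (leq_trans jk ki).
    by rewrite subrr normr0 min_l// expr0n.
  - by rewrite exp_cst mulr_ge0// mulr_ge0// sqr_ge0.
have [h /andP[ih' hk] [U1 U2]] := half_mass_index ik u0.
set U := \sum_(i <= q < k) u q in U1 U2 *.
have ki0 : (k - i <= n)%N by [].
have [|W1 [bW1 W10 W1le EW1]] := ih i h _ ih'.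
  by apply: leq_trans ki0; rewrite ltn_sub2r.
have [||W2 [bW2 W20 W2le EW2]] := ih h.+1 k.
- by apply: leq_trans ki0; rewrite ltn_sub2l.
- by [].
pose D j w := (S j w - S i w) ^+ 2 * (S k w - S j w) ^+ 2.
have D0 j w : 0 <= D j w by rewrite mulr_ge0 ?sqr_ge0.
have bD j : bdd (D j) by apply: bddM; apply: bddX; apply: bddB.
(* The constant [8 * beta] is the fixed point of this recursion: the two halves give
   [2 * (3 / 2) * (8 * beta) / 4 = 6 * beta], the two splitting terms [2 * beta]. *)
exists (fun w => (3 / 2 * W1 w + beta * D h w) +
                 (3 / 2 * W2 w + beta * D h.+1 w)).
have bZ f a : bdd f -> bdd (fun w : T => a * f w) by move=> bf; exact: bddZ.
split.
- by apply: bddD; apply: bddD; apply: bZ.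
- by move=> w; rewrite !addr_ge0// mulr_ge0// divr_ge0.
- move=> w j /andP[ij jk].
  have quart (a b x : R) : 0 <= a -> 0 <= b -> 0 <= x -> x <= a + b ->
      x ^+ 4 <= 3 / 2 * a ^+ 4 + beta * b ^+ 4.
    move=> a0 b0 x0 xab; apply: le_trans (quartic_split a0 b0).
    by rewrite lerXn2r// nnegrE// addr_ge0.
  have min0 (x y : R) : 0 <= Order.min `|x| `|y| by rewrite le_min !normr_ge0.
  have [jh|hj] := leqP j h.
  + apply: (@le_trans _ _ (3 / 2 * W1 w + beta * D h w)); last first.
      by rewrite lerDl addr_ge0// mulr_ge0// divr_ge0.
    have l1 := W1le w j; rewrite ij jh in l1; have {}l1 := l1 isT.
    have l2 := le_min_quartic (S h w - S i w) (S k w - S h w).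
    apply: le_trans (lerD (ler_wpM2l _ l1) (ler_wpM2l _ l2)) => //.
    apply: quart => //.
    have t1 := ler_distD (S h w) (S j w) (S i w).
    have t2 := ler_distD (S h w) (S k w) (S j w).
    rewrite (distrC (S h w) (S j w)) in t2 *.
    exact: min_le_split_l.
  + apply: (@le_trans _ _ (3 / 2 * W2 w + beta * D h.+1 w)); last first.
      by rewrite lerDr addr_ge0// mulr_ge0// divr_ge0.
    have l1 := W2le w j; rewrite hj jk in l1; have {}l1 := l1 isT.
    have l2 := le_min_quartic (S h.+1 w - S i w) (S k w - S h.+1 w).
    apply: le_trans (lerD (ler_wpM2l _ l1) (ler_wpM2l _ l2)) => //.
    apply: quart => //.
    have t1 := ler_distD (S h.+1 w) (S j w) (S i w).
    have t2 := ler_distD (S h.+1 w) (S k w) (S j w).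
    rewrite (distrC (S h.+1 w) (S j w)) in t2 *.
    exact: min_le_split_r.
- have [bD1 bD2] := (bD h, bD h.+1).
  rewrite !expD ?expZ; [|bdd..].
  have m1 : Ex (D h) <= c * U ^+ 2 by apply: mom; rewrite ih' ltnW.
  have m2 : Ex (D h.+1) <= c * U ^+ 2 by apply: mom; rewrite hk (leqW ih').
  have half (V : R) : 0 <= V -> V <= U / 2 -> c * V ^+ 2 <= c * U ^+ 2 / 4.
    move=> V0 VU; rewrite -mulrA ler_wpM2l//.
    apply: (@le_trans _ _ ((U / 2) ^+ 2)).
      by rewrite lerXn2r// nnegrE// (le_trans V0).
    by rewrite exprMn; lra.
  have s1 := half _ (sumr_ge0 _ (fun q _ => u0 q)) U1.
  have s2 := half _ (sumr_ge0 _ (fun q _ => u0 q)) U2.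
  have s3 : beta * Ex (D h) <= beta * (c * U ^+ 2) by rewrite ler_wpM2l.
  have s4 : beta * Ex (D h.+1) <= beta * (c * U ^+ 2) by rewrite ler_wpM2l.
  set V1 := \sum_(i <= q < h) u q in s1 EW1.
  set V2 := \sum_(h.+1 <= q < k) u q in s2 EW2.
  have s5 : 8 * beta * (c * V1 ^+ 2) <= 8 * beta * (c * U ^+ 2 / 4).
    by rewrite ler_wpM2l// mulr_ge0.
  have s6 : 8 * beta * (c * V2 ^+ 2) <= 8 * beta * (c * U ^+ 2 / 4).
    by rewrite ler_wpM2l// mulr_ge0.
  by move: EW1 EW2 s3 s4 s5 s6; set Z := c * U ^+ 2; lra.
Qed.

(** If [|S j| > 2 l] while [|S N| < l], the increments from 0 to [j] and from [j] to [N] both exceed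
    [l], so the majorant of the fourth powers is at least [l ^+ 4]. Markov's inequality treats this
    event and the event [|S N| >= l]. *)
Lemma maximal_inequality N (l : R) : 0 < l -> (forall w, S 0 w = 0) ->
  (P [set w | exists2 j, (j <= N)%N & (2 * l < `|S j w|)%R] <=
   (8 * 11 ^+ 4 * (c * (\sum_(0 <= q < N) u q) ^+ 2) / l ^+ 4 +
    Ex (fun w => (S N w ^+ 2)%R) / l ^+ 2)%:E)%E.
Proof.
move=> l0 S00; have [W [bW W0 Wle EW]] := maximal_majorant (leq0n N).
have mS j : measurable_fun setT (S j) by case: (bS j).
have mset (f : T -> R) a : measurable_fun setT f -> measurable [set w | a <= f w].
  by move=> mf; rewrite -[X in measurable X]setTI; apply: measurable_fun_le.
have mset' (f : T -> R) a : measurable_fun setT f -> measurable [set w | a < f w].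
  move=> mf; rewrite (_ : [set w | _] = setT `&` f @^-1` [set` `]a, +oo[]).
    exact: mf.
  by apply/seteqP; split => w /=; rewrite in_itv/= andbT => // -[].
have bS2 : bdd (fun w => S N w ^+ 2) by apply: bddX.
have sub : [set w | exists2 j, (j <= N)%N & 2 * l < `|S j w|] `<=`
    [set w | l ^+ 4 <= W w] `|` [set w | l ^+ 2 <= S N w ^+ 2].
  move=> w [j jN Sj].
  have [Sl|lS] := lerP l `|S N w|.
    by right => /=; rewrite -[X in _ <= X]real_normK ?num_real// lerXn2r ?nnegrE// ltW.
  left => /=; apply: le_trans (Wle w j _); last by rewrite jN.
  rewrite S00 subr0 lerXn2r ?nnegrE ?(ltW l0)// ?le_min ?normr_ge0//.
  apply/andP; split; first lra.
  have := lerB_dist (S j w) (S N w); rewrite [X in _ <= X]distrC; lra.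
have mB : measurable [set w | exists2 j, (j <= N)%N & 2 * l < `|S j w|].
  rewrite (_ : [set w | _] = \bigcup_(j in [set j | (j <= N)%N])
    [set w | 2 * l < `|S j w|]); last first.
    by apply/seteqP; split => [w [j jN h]|w [j jN h]]; exists j.
  apply: bigcup_measurable => j _; apply: mset'.
  exact: measurableT_comp.
have mW : measurable_fun setT W by case: bW.
have mS2 : measurable_fun setT (fun w => S N w ^+ 2) by case: bS2.
apply: (le_trans (le_measure _ _ _ sub)); rewrite ?inE//.
  by apply: measurableU; apply: mset.
apply: le_trans; first by apply: measureU2; exact: mset.
rewrite EFinD leeD//.
  apply: (le_trans (bdd_markov P bW W0 (exprn_gt0 4 l0))).
  by rewrite lee_fin ler_wpM2r// invr_ge0 exprn_ge0// ltW.
apply: (le_trans (bdd_markov P bS2 _ (exprn_gt0 2 l0))); first by move=> w; exact: sqr_ge0.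
by [].
Qed.

End Maximal.

(** * Deviations along a nested family of sets *)

Section RealIntegrable.
Context d (T : measurableType d) (R : realType) (mu : {measure set T -> \bar R}).

Lemma integrable_EFinD (D : set T) (f g : T -> R) : measurable D ->
  mu.-integrable D (EFin \o f) -> mu.-integrable D (EFin \o g) ->
  mu.-integrable D (EFin \o (fun x => f x + g x)).
Proof. by move=> mD fi gi; exact: (integrableD mD fi gi). Qed.

Lemma integrable_EFinZ (D : set T) (f : T -> R) (c : R) : measurable D ->
  mu.-integrable D (EFin \o f) ->
  mu.-integrable D (EFin \o (fun x => c * f x)).
Proof. by move=> mD fi; exact: (integrableZl mD c fi). Qed.

Lemma Rintegral_sum (I : finType) (F : I -> T -> R) :
  (forall i, mu.-integrable setT (EFin \o F i)) ->
  Rintegral mu setT (fun x => \sum_i F i x) = \sum_i Rintegral mu setT (F i).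
Proof.
move=> iF; rewrite /Rintegral; under eq_integral do rewrite -sumEFin.
rewrite integral_sum//.
by rewrite sum_fine// => i _; apply: integrable_fin_num => //; exact: iF.
Qed.

End RealIntegrable.

Section Deviation.
Context d (T : measurableType d) (R : realType) (P : probability T R).
Variable X : nat -> {RV P >-> R}.
Local Notation bdd := (bounded_measurable (R := R)).
Local Notation Ex := (Rintegral P setT).
Local Notation mean k := (Ex (fun w => k (X 0%N w))).

Definition deviation n (k : R -> R) (w : T) : R :=
  \sum_(i < n) k (X i w) - n%:R * mean k.

Lemma measurable_deviation n k : measurable_fun setT k ->
  measurable_fun setT (deviation n k).
Proof.
move=> mk; apply: measurable_funB => //.
by apply: measurable_sum => i; exact: measurableT_comp.
Qed.

Lemma bdd_deviation n k : bdd k -> bdd (deviation n k).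
Proof.
by move=> bk; apply: bddB => //; apply: bdd_sum => i; exact: bdd_comp.
Qed.

Lemma deviation_centered n k w :
  deviation n k w = \sum_(i < n) (k (X i w) - mean k).
Proof. by rewrite /deviation sumrB sumr_const card_ord mulr_natl. Qed.

Hypothesis indepX : mutually_independent X.
Hypothesis identX : forall i k, bdd k ->
  Ex (fun w => k (X i w)) = Ex (fun w => k (X 0%N w)).

Lemma deviationB n k1 k2 w : bdd k1 -> bdd k2 ->
  deviation n k1 w - deviation n k2 w = deviation n (fun x => k1 x - k2 x) w.
Proof.
move=> b1 b2; rewrite /deviation expB; [|exact: bdd_comp..].
by rewrite sumrB; ring.
Qed.

Lemma mean_centered k : bdd k -> mean (fun x => k x - mean k) = 0.
Proof.
by move=> bk; rewrite expB ?exp_cst ?subrr//; exact: bdd_comp.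
Qed.

Lemma mean_centered_sqr k : bdd k ->
  mean (fun x => (k x - mean k) ^+ 2) = mean (fun x => k x ^+ 2) - mean k ^+ 2.
Proof.
move=> bk; have bk0 := bdd_comp (X 0%N) bk.
have bk2 : bdd (fun w => k (X 0%N w) ^+ 2) by exact: bddX.
set p := mean k.
rewrite (_ : (fun w => (k (X 0%N w) - p) ^+ 2) = (fun w =>
   k (X 0%N w) ^+ 2 + ((- (2 * p)) * k (X 0%N w) + p ^+ 2))); last first.
  by apply/funext => w; ring.
by rewrite !expD ?expZ ?exp_cst -/p; [ring|bdd..].
Qed.

Lemma sqr_mean_le k : bdd k -> mean k ^+ 2 <= mean (fun x => k x ^+ 2).
Proof.
move=> bk; rewrite -subr_ge0 -mean_centered_sqr//.
by apply: exp_ge0 => w; exact: sqr_ge0.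
Qed.

Lemma exp_deviation_sqr n k : bdd k ->
  Ex (fun w => deviation n k w ^+ 2) <= n%:R * mean (fun x => k x ^+ 2).
Proof.
move=> bk; under eq_Rintegral do rewrite deviation_centered.
have bu : bdd (fun x => k x - mean k) by bdd.
rewrite (exp_sum_sqr indepX identX n bu (mean_centered bk)).
rewrite ler_wpM2l// mean_centered_sqr// gerDl oppr_le0; exact: sqr_ge0.
Qed.

(** Let p, q be the means of [f], [g]. Since [f g = 0], the centred functions have covariance -p q,
    and the product of their squares has mean q^2 E[f^2] + p^2 E[g^2] - 3 p^2 q^2. By p^2 <= E[f^2]
    and q^2 <= E[g^2] both are controlled by second moments alone. *)
Lemma exp_deviation_sqr_mul n f g : bdd f -> bdd g ->
  (forall x, f x * g x = 0) ->
  Ex (fun w => deviation n f w ^+ 2 * deviation n g w ^+ 2) <=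
  3 * n%:R ^+ 2 * (mean (fun x => f x ^+ 2) * mean (fun x => g x ^+ 2)).
Proof.
move=> bf bg fg0.
have [bf0 bg0] := (bdd_comp (X 0%N) bf, bdd_comp (X 0%N) bg).
have bf2 : bdd (fun w => f (X 0%N w) ^+ 2) by exact: bddX.
have bg2 : bdd (fun w => g (X 0%N w) ^+ 2) by exact: bddX.
have pf := sqr_mean_le bf; have qg := sqr_mean_le bg.
have [p20 q20] := (sqr_ge0 (mean f), sqr_ge0 (mean g)).
under eq_Rintegral do rewrite !deviation_centered.
apply: (@exp_sum_sqr_mul _ _ _ P X indepX identX n (fun x => f x - mean f)
  (fun x => g x - mean g)); rewrite ?mean_centered//; try bdd.
- by rewrite mean_centered_sqr// gerDl oppr_le0.
- by rewrite mean_centered_sqr// gerDl oppr_le0.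
- rewrite (_ : (fun w => (f (X 0%N w) - _) * _) = (fun w =>
     (- mean g) * f (X 0%N w) + ((- mean f) * g (X 0%N w) + mean f * mean g))).
    rewrite !expD ?expZ ?exp_cst; [|bdd..].
    rewrite (_ : _ ^+ 2 = mean f ^+ 2 * mean g ^+ 2); last by ring.
    exact: ler_pM.
  apply/funext => w; have := fg0 (X 0%N w).
  by set a := f _; set b := g _ => ab; rewrite mulrBl !mulrBr ab; ring.
- set p := mean f in pf p20 *; set q := mean g in qg q20 *.
  rewrite (_ : (fun w => (f (X 0%N w) - _) ^+ 2 * _) = (fun w =>
     q ^+ 2 * f (X 0%N w) ^+ 2 + (p ^+ 2 * g (X 0%N w) ^+ 2 +
     ((- (2 * p * q ^+ 2)) * f (X 0%N w) + ((- (2 * p ^+ 2 * q)) * g (X 0%N w) +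
      p ^+ 2 * q ^+ 2))))).
    rewrite !expD ?expZ ?exp_cst; [|bdd..].
    rewrite -/p -/q; move: pf qg.
    set a := mean (fun x => f x ^+ 2); set b := mean (fun x => g x ^+ 2).
    move=> pa qb.
    have h1 : q ^+ 2 * a <= a * b by rewrite mulrC ler_wpM2l// (le_trans p20).
    have h2 : p ^+ 2 * b <= a * b by rewrite ler_wpM2r// (le_trans q20).
    have h3 : 0 <= a * b by rewrite mulr_ge0// ?(le_trans p20 pa) ?(le_trans q20 qb).
    have h4 : 0 <= p ^+ 2 * q ^+ 2 by rewrite mulr_ge0.
    have -> : - (2 * p * q ^+ 2) * p = - (2 * (p ^+ 2 * q ^+ 2)) by ring.
    have -> : - (2 * p ^+ 2 * q) * q = - (2 * (p ^+ 2 * q ^+ 2)) by ring.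
    lra.
  apply/funext => w; have := fg0 (X 0%N w).
  set x := f _; set y := g _ => xy.
  rewrite (_ : (x - p) ^+ 2 * (y - q) ^+ 2 = q ^+ 2 * x ^+ 2 + (p ^+ 2 * y ^+ 2 +
     (- (2 * p * q ^+ 2) * x + (- (2 * p ^+ 2 * q) * y + p ^+ 2 * q ^+ 2))) +
     (x * y) * (x * y - 2 * q * x - 2 * p * y + 4 * p * q)); last by ring.
  by rewrite xy mul0r addr0.
Qed.

(** Adjacent increments are deviations of [h] restricted to disjoint differences of the nested sets,
    so the previous lemma supplies the hypothesis of the maximal inequality with [c = 3 n^2]. The
    mass of an index is the second moment of [h] on the next difference; it telescopes to at most
    the full second moment, whatever [N] is. *)
Lemma nested_deviation_bdd n N (h : R -> R) (B : nat -> set R) (l : R) :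
  bdd h -> (forall j, measurable (B j)) ->
  (forall i j, (i <= j)%N -> B i `<=` B j) -> B 0%N = set0 -> 0 < l ->
  (P [set w | exists2 j, (j <= N)%N &
       (2 * l < `|deviation n (fun x => h x * \1_(B j) x)%R w|)%R] <=
   (8 * 11 ^+ 4 * (3 * n%:R ^+ 2 * mean (fun x => h x ^+ 2)%R ^+ 2) / l ^+ 4 +
    n%:R * mean (fun x => h x ^+ 2)%R / l ^+ 2)%:E)%E.
Proof.
move=> bh mB Bmono B00 l0.
have bB j : bdd (fun x => h x * \1_(B j) x) by apply: bddM => //; exact: bdd_indic.
pose mass j := mean (fun x => h x ^+ 2 * \1_(B j) x).
have bmass j : bdd (fun x => h x ^+ 2 * \1_(B j) x).
  by apply: bddM; [exact: bddX|exact: bdd_indic].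
have bmean j := bdd_comp (X 0%N) (bmass j).
have bh2 := bdd_comp (X 0%N) (bddX 2 bh).
have bB2 j := bdd_comp (X 0%N) (bddX 2 (bB j)).
have ind01 j x : 0 <= (\1_(B j) x : R) <= 1.
  by rewrite indicE; case: (_ \in _); rewrite ?ler01 ?lexx.
have indmono i j x : (i <= j)%N -> (\1_(B i) x : R) <= \1_(B j) x.
  move=> ij; rewrite !indicE; have [xi|] := boolP (x \in B i); last by [].
  by rewrite mem_set//; apply: (Bmono i) => //; rewrite inE in xi.
have massmono i j : (i <= j)%N -> mass i <= mass j.
  move=> ij; apply: exp_le; [exact: bmean|exact: bmean|].
  by move=> w; rewrite ler_wpM2l ?sqr_ge0 ?indmono.
have sumu i k : (i <= k)%N ->
    \sum_(i <= q < k) (mass q.+1 - mass q) = mass k - mass i.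
  by move=> ik; rewrite telescope_sumr.
have mass0 j : 0 <= mass j.
  apply: exp_ge0 => w; have /andP[h0 _] := ind01 j (X 0%N w).
  by rewrite mulr_ge0 ?sqr_ge0.
have massh j : mass j <= mean (fun x => h x ^+ 2).
  apply: exp_le; [exact: bmean|exact: bh2|].
  move=> w; have /andP[_ h1] := ind01 j (X 0%N w).
  by rewrite ler_piMr ?sqr_ge0.
apply: (le_trans (@maximal_inequality _ _ _ P
    (fun j => deviation n (fun x => h x * \1_(B j) x))
    (fun q => mass q.+1 - mass q) (3 * n%:R ^+ 2) _ _ _ _ N l l0 _)).
- by move=> j; exact: bdd_deviation.
- by move=> j; rewrite subr_ge0 massmono.
- by rewrite mulr_ge0// sqr_ge0.
- move=> i j k /andP[ij jk].
  under eq_Rintegral do rewrite !deviationB//.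
  apply: (le_trans (exp_deviation_sqr_mul n _ _ _)); [exact: bddB|exact: bddB| |].
    move=> x; have := indmono i j x ij; have := indmono j k x jk.
    rewrite !indicE; case: (x \in B i); case: (x \in B j); case: (x \in B k);
      rewrite ?mulr1 ?mulr0 ?subrr ?mulr0 ?mul0r ?subr0 ?mulr0// ler10//.
  rewrite sumu ?(leq_trans ij)//.
  rewrite ler_wpM2l ?mulr_ge0 ?sqr_ge0//.
  have sq i' j' : (i' <= j')%N ->
      mean (fun x => (h x * \1_(B j') x - h x * \1_(B i') x) ^+ 2) =
      mass j' - mass i'.
    move=> ij'; rewrite -expB; [|exact: bmean..].
    congr (Rintegral _ _ _); apply/funext => w.
    have := indmono i' j' (X 0%N w) ij'; rewrite !indicE.
    by case: (_ \in B i'); case: (_ \in B j'); rewrite ?ler10// => _;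
      rewrite ?mulr1 ?mulr0 ?subrr ?subr0 ?expr0n.
  rewrite !sq// expr2 ler_pM ?subr_ge0 ?massmono//.
    by rewrite lerB// massmono.
  by rewrite lerB// massmono.
- move=> w; rewrite /deviation B00.
  under eq_bigr do rewrite indic0 mulr0.
  under eq_Rintegral do rewrite indic0 mulr0.
  by rewrite exp_cst mulr0 big1 ?subrr.
rewrite lee_fin lerD// ler_wpM2r ?invr_ge0 ?exprn_ge0 ?(ltW l0)//.
  rewrite ler_wpM2l ?mulr_ge0 ?exprn_ge0// ler_wpM2l ?mulr_ge0 ?exprn_ge0//.
  have hN : mass N - mass 0%N <= mean (fun x => h x ^+ 2).
    by rewrite (le_trans _ (massh N))// gerBl.
  rewrite sumu// lerXn2r ?nnegrE ?subr_ge0 ?massmono//.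
  exact: le_trans (massh 0%N).
apply: (le_trans (exp_deviation_sqr n (bB N))).
rewrite ler_wpM2l//; apply: le_trans (massh N).
apply: exp_le; [exact: bB2|exact: bmean|].
move=> w; rewrite exprMn indicE; case: (_ \in _); by rewrite ?expr1n ?expr0n.
Qed.

Variable psi : R -> R.
Hypothesis mpsi : measurable_fun setT psi.
Hypothesis psi2 : P.-integrable setT (EFin \o (fun w => psi (X 0%N w) ^+ 2)).
Local Notation s2 := (mean (fun x => psi x ^+ 2)).

Let mpsi0 : measurable_fun setT (fun w => psi (X 0%N w)).
Proof. exact: measurableT_comp. Qed.

Lemma psi_integrable : P.-integrable setT (EFin \o (fun w => psi (X 0%N w))).
Proof.
have i1 : P.-integrable setT (EFin \o (fun w => 1 + psi (X 0%N w) ^+ 2)).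
  by apply: integrable_EFinD => //; exact: bdd_integrable.
apply: le_integrable i1 => //; first exact/measurable_EFinP.
move=> w _ /=; rewrite lee_fin.
set y := psi _; rewrite (@ger0_norm _ (1 + _)); last by rewrite addr_ge0// sqr_ge0.
have h : 0 <= (`|y| - 1) ^+ 2 by exact: sqr_ge0.
have hy : `|y| ^+ 2 = y ^+ 2 by rewrite real_normK// num_real.
by rewrite -hy; have := normr_ge0 y; nra.
Qed.

Lemma psi_mul_integrable k : bdd k ->
  P.-integrable setT (EFin \o (fun w => psi (X 0%N w) * k (X 0%N w))).
Proof.
move=> [mk [C kC]].
have i1 : P.-integrable setT (fun w => (C%:E * (psi (X 0%N w))%:E)%E).
  exact: (integrableZl measurableT C psi_integrable).
apply: le_integrable i1 => //.
  apply/measurable_EFinP; apply: measurable_funM => //.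
  exact: measurableT_comp.
move=> w _ /=; rewrite lee_fin !normrM mulrC ler_wpM2r//.
exact: le_trans (kC _) (ler_norm _).
Qed.

Lemma prob_psi_gt i (l : R) : 0 < l ->
  (P [set w | (l < `|psi (X i w)|)%R] <= (s2 / l ^+ 2)%:E)%E.
Proof.
move=> l0; pose A : set R := [set x | l < `|psi x|].
have mA : measurable A.
  rewrite (_ : A = setT `&` (fun x => `|psi x|) @^-1` [set` `]l, +oo[]).
    by apply: (measurableT_comp (@normr_measurable R setT) mpsi) => //.
  by apply/seteqP; split => x /=; rewrite in_itv/= andbT// => -[].
have bA : bdd (\1_A : R -> R) by exact: bdd_indic.
have mAX j : measurable (X j @^-1` A).
  by rewrite -[X in measurable X]setTI; exact: measurable_funP.
have -> : [set w | l < `|psi (X i w)|] = X i @^-1` A by [].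
rewrite -(fineK (fin_num_measure P _ (mAX i))) lee_fin -exp_indic//.
rewrite (_ : \1_(X i @^-1` A) = (fun w => \1_A (X i w)))//.
rewrite (identX i bA) ler_pdivlMr ?exprn_gt0// mulrC -expZ; last exact: bdd_comp.
apply: le_Rintegral => //.
  by apply: bdd_integrable; apply: bddZ; exact: bdd_comp.
move=> w _; rewrite indicE; case: (boolP (_ \in A)); rewrite ?mulr0 ?sqr_ge0//.
rewrite inE /A/= mulr1 => h; rewrite -[leRHS]real_normK ?num_real//.
by rewrite lerXn2r ?nnegrE// ltW.
Qed.

(* Truncating psi at level l costs n * P(|psi| > l) in probability and at most
   n * s2 / l <= l in bias. *)
Lemma nested_deviation n N (B : nat -> set R) (l : R) :
  (forall j, measurable (B j)) ->
  (forall i j, (i <= j)%N -> B i `<=` B j) -> B 0%N = set0 -> 0 < l ->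
  (P [set w | exists2 j, (j <= N)%N &
       (3 * l < `|deviation n (fun x => psi x * \1_(B j) x)%R w|)%R] <=
   ((24 * 11 ^+ 4 + 2) * (n%:R * s2 / l ^+ 2))%:E)%E.
Proof.
move=> mB Bmono B00 l0.
set r := n%:R * s2 / l ^+ 2.
have s20 : 0 <= s2 by apply: exp_ge0 => w; exact: sqr_ge0.
have r0 : 0 <= r by rewrite divr_ge0 ?mulr_ge0// ?exprn_ge0// ltW.
have l20 : 0 < l ^+ 2 by rewrite exprn_gt0.
set C := 24 * 11 ^+ 4 + 2.
have C1 : 1 <= C by rewrite /C -[X in X <= _]add0r lerD ?mulr_ge0 ?exprn_ge0// ler1n.
have mgt (f : T -> R) (a : R) : measurable_fun setT f -> measurable [set w | a < `|f w|].
  move=> mf; rewrite (_ : [set w | _] = setT `&` (fun w => `|f w|) @^-1` [set` `]a, +oo[]).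
    by apply: (measurableT_comp (@normr_measurable R setT) mf) => //.
  by apply/seteqP; split => w /=; rewrite in_itv/= andbT// => -[].
have mex (f : nat -> T -> R) (a : R) : (forall j, measurable_fun setT (f j)) ->
    measurable [set w | exists2 j, (j <= N)%N & a < `|f j w|].
  move=> mf; rewrite (_ : [set w | _] = \bigcup_(j in [set j | (j <= N)%N])
    [set w | a < `|f j w|]); last first.
    by apply/seteqP; split => [w [j jN hj]|w [j jN hj]]; exists j.
  by apply: bigcup_measurable => j _; exact: mgt.
have mDpsi j : measurable_fun setT (fun x => psi x * \1_(B j) x).
  by apply: measurable_funM => //; exact: measurable_indic.
have mtot := mex _ (3 * l) (fun j => measurable_deviation n (mDpsi j)).
(* For [r >= 1] the claim is trivial. Otherwise [r < 1] keeps the truncation bias [r * l] below [l]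
   and allows [r ^+ 2] to be replaced by [r]. *)
have [r1|r1] := lerP 1 r.
  apply: (@le_trans _ _ 1%E); first exact: probability_le1.
  by rewrite lee_fin; apply: le_trans r1 _; rewrite ler_peMl.
pose A : set R := [set x | `|psi x| <= l].
have mA : measurable A.
  rewrite (_ : A = setT `&` (fun x => `|psi x|) @^-1` [set` `]-oo, l]]).
    by apply: (measurableT_comp (@normr_measurable R setT) mpsi) => //.
  by apply/seteqP; split => x /=; rewrite in_itv// => -[].
pose h x := psi x * \1_A x.
have bh : bdd h.
  split; first by apply: measurable_funM => //; exact: measurable_indic.
  exists l => x; rewrite /h indicE; case: (boolP (x \in A)).
    by rewrite inE mulr1.
  by rewrite mulr0 normr0 ltW.
have bind (D : set R) : measurable D -> bdd (\1_D : R -> R) by exact: bdd_indic.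
have meanh : mean (fun x => h x ^+ 2) <= s2.
  apply: le_Rintegral => //.
    by apply: bdd_integrable; exact: (bdd_comp (X 0%N) (bddX 2 bh)).
  move=> w _; rewrite /h exprMn indicE.
  by case: (_ \in A); rewrite ?expr1n ?expr0n ?mulr1 ?mulr0 ?sqr_ge0.
have mDh j : measurable_fun setT (fun x => h x * \1_(B j) x).
  by apply: measurable_funM; [case: bh|exact: measurable_indic].
have bias j : `|mean (fun x => psi x * \1_(B j) x) -
                mean (fun x => h x * \1_(B j) x)| * n%:R <= l.
  rewrite -RintegralB//; [|exact: psi_mul_integrable (bind _ (mB j))|]; last first.
    apply: bdd_integrable; apply: (bdd_comp (X 0%N) (k := fun x => h x * \1_(B j) x)).
    by apply: bddM => //; exact: bind.
  have mD : measurable_fun setT (fun w => psi (X 0%N w) * \1_(B j) (X 0%N w) -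
      h (X 0%N w) * \1_(B j) (X 0%N w)).
    by apply: (measurableT_comp (measurable_funB (mDpsi j) (mDh j))).
  have dom w : `|psi (X 0%N w) * \1_(B j) (X 0%N w) -
      h (X 0%N w) * \1_(B j) (X 0%N w)| <= l^-1 * psi (X 0%N w) ^+ 2.
    rewrite /h -mulrBl normrM.
    apply: (@le_trans _ _ (`|psi (X 0%N w) - psi (X 0%N w) * \1_A (X 0%N w)|)).
      apply: ler_piMr => //; rewrite indicE.
      by case: (_ \in _); rewrite ?normr1 ?normr0.
    rewrite indicE; case: (boolP (_ \in A)).
      by rewrite mulr1 subrr normr0 mulr_ge0 ?sqr_ge0// invr_ge0 ltW.
    rewrite notin_setE /A/= => /negP; rewrite -ltNge mulr0 subr0 => h1.
    rewrite -[X in _ * X]real_normK ?num_real// expr2 mulrA ler_peMl//.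
    by rewrite ler_pdivlMl// mulr1 ltW.
  have i2 : P.-integrable setT (EFin \o (fun w => l^-1 * psi (X 0%N w) ^+ 2)).
    exact: integrable_EFinZ.
  have iD : P.-integrable setT (EFin \o (fun w => psi (X 0%N w) * \1_(B j) (X 0%N w) -
      h (X 0%N w) * \1_(B j) (X 0%N w))).
    apply: le_integrable i2 => //; first exact/measurable_EFinP.
    move=> w _ /=; rewrite lee_fin (le_trans (dom w))//; exact: ler_norm.
  apply: (@le_trans _ _ ((l^-1 * s2) * n%:R)).
    rewrite ler_wpM2r//; apply: (le_trans (le_normr_Rintegral measurableT iD)).
    rewrite -RintegralZl//; apply: le_Rintegral => //.
    by apply: le_integrable iD => //; [apply/measurable_EFinP; exact: measurableT_comp|
      move=> w _ /=; rewrite normr_id].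
  rewrite (_ : l^-1 * s2 * n%:R = r * l); last by rewrite /r; field; rewrite gt_eqF.
  by rewrite ler_piMl// ltW.
pose bad := \big[setU/set0]_(i < n) [set w | l < `|psi (X i w)|].
pose dev := [set w | exists2 j, (j <= N)%N &
       2 * l < `|deviation n (fun x => h x * \1_(B j) x) w|].
have mpsiX i : measurable_fun setT (fun w => psi (X i w)) by exact: measurableT_comp.
have mbad : measurable bad by apply: bigsetU_measurable => i _; exact: mgt.
have mdev : measurable dev by apply: mex => j; exact: measurable_deviation.
have sub : [set w | exists2 j, (j <= N)%N &
    3 * l < `|deviation n (fun x => psi x * \1_(B j) x) w|] `<=` bad `|` dev.
  move=> w [j jN hj]; have [wb|wb] := pselect (bad w); first by left.
  right; exists j => //.
  have good i : (i < n)%N -> `|psi (X i w)| <= l.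
    move=> ni; rewrite leNgt; apply/negP => h1; apply: wb.
    by rewrite /bad -(bigcup_mkord n (fun i => [set w | l < `|psi (X i w)|])); exists i.
  have e : \sum_(i < n) psi (X i w) * \1_(B j) (X i w) =
           \sum_(i < n) h (X i w) * \1_(B j) (X i w).
    apply: eq_bigr => i _; rewrite /h [\1_A _]indicE mem_set ?mulr1//.
    exact: good.
  have := bias j; move: hj; rewrite /deviation e.
  set y := \sum_(i < n) _; set p := Ex (fun w => psi (X 0%N w) * _).
  set q := Ex (fun w => h (X 0%N w) * _) => hj hpq.
  have : `|y - n%:R * p| <= `|y - n%:R * q| + `|p - q| * n%:R.
    rewrite (_ : y - n%:R * p = (y - n%:R * q) - (p - q) * n%:R); last by ring.
    by rewrite (le_trans (ler_normB _ _))// normrM (@ger0_norm _ n%:R).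
  by move=> h1; move: hj h1 hpq; set y1 := `|_ - n%:R * p|; set y2 := `|_|; lra.
apply: (le_trans (le_measure _ _ _ sub)); rewrite ?inE//.
  exact: measurableU.
apply: le_trans; first by apply: measureU2.
have Pbad : (P bad <= r%:E)%E.
  apply: (le_trans (Boole_inequality P (A := fun i => [set w | (l < `|psi (X i w)|)%R]) _)).
    by move=> i _; exact: mgt.
  apply: (@le_trans _ _ (\sum_(i < n) (s2 / l ^+ 2)%:E)%E).
    by apply: lee_sum => i _; exact: prob_psi_gt.
  rewrite sumEFin lee_fin sumr_const card_ord -[X in X <= _]mulr_natl /r.
  by rewrite mulrA.
(* Here [24 = 8 * 3] joins the chaining constant to that of the product moments; the summand 1 is
   the variance term, and the truncation event adds another 1 to give the final [+ 2]. *)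
have Pdev : (P dev <= ((24 * 11 ^+ 4 + 1) * r)%:E)%E.
  apply: (le_trans (nested_deviation_bdd n N bh mB Bmono B00 l0)).
  rewrite lee_fin [in leRHS]mulrDl mul1r.
  have [h0 hs] : 0 <= mean (fun x => h x ^+ 2) /\ mean (fun x => h x ^+ 2) <= s2.
    by split => //; apply: exp_ge0 => w; exact: sqr_ge0.
  rewrite lerD//; last by rewrite ler_wpM2r ?invr_ge0 ?(ltW l20)// ler_wpM2l.
  apply: (@le_trans _ _ (24 * 11 ^+ 4 * r ^+ 2)).
    rewrite (_ : _ / l ^+ 4 = 24 * 11 ^+ 4 *
      (n%:R * mean (fun x => h x ^+ 2) / l ^+ 2) ^+ 2); last first.
      by field; rewrite gt_eqF.
    rewrite ler_wpM2l ?mulr_ge0 ?exprn_ge0// lerXn2r ?nnegrE//.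
      by rewrite divr_ge0 ?mulr_ge0// ltW.
    by rewrite ler_wpM2r ?invr_ge0 ?(ltW l20)// ler_wpM2l.
  rewrite ler_wpM2l ?mulr_ge0 ?exprn_ge0// expr2 ler_piMl// ltW//.
apply: (le_trans (leeD Pbad Pdev)); rewrite -EFinD lee_fin /C.
by rewrite le_eqVlt; apply/orP; left; apply/eqP; ring.
Qed.

End Deviation.

(** * Uniform deviations over quasiconcave functions *)

Section Quasiconcave.
Variables (R : realType) (M : R) (f : R -> R).
Hypothesis fM : forall x, 0 <= f x <= M.
Hypothesis fq : forall u, 0 < u -> is_interval [set x | u <= f x].

(** At levels [u <= 0] the set is the whole line. Hence intervals are demanded at positive levels
    only, which is compatible with extending a shape by 0 outside [[a, b]]. *)
Lemma measurable_superlevel u : measurable [set x | u <= f x].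
Proof.
have [u0|u0] := ltrP 0 u; first by apply: is_interval_measurable; exact: fq.
rewrite (_ : [set x | _] = setT)//; apply/seteqP; split => // x _ /=.
by have /andP[+ _] := fM x; exact: le_trans.
Qed.

Lemma quasiconcave_measurable : measurable_fun setT f.
Proof.
apply: (measurability _ (RGenCInfty.measurableE R)) => //.
move=> _ [_ [u ->] <-]; rewrite setTI.
rewrite (_ : _ @^-1` _ = [set x | u <= f x]); first exact: measurable_superlevel.
by apply/seteqP; split => x /=; rewrite in_itv/= andbT.
Qed.

End Quasiconcave.

Section UniformDeviation.
Context d (T : measurableType d) (R : realType) (P : probability T R).
Variable X : nat -> {RV P >-> R}.
Local Notation bdd := (bounded_measurable (R := R)).
Local Notation Ex := (Rintegral P setT).
Local Notation mean k := (Ex (fun w => k (X 0%N w))).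
Hypothesis indepX : mutually_independent X.
Hypothesis identX : forall i k, bdd k ->
  Ex (fun w => k (X i w)) = Ex (fun w => k (X 0%N w)).
Variable psi : R -> R.
Hypothesis mpsi : measurable_fun setT psi.
Hypothesis psi2 : P.-integrable setT (EFin \o (fun w => psi (X 0%N w) ^+ 2)).
Local Notation s2 := (mean (fun x => psi x ^+ 2)).

Local Notation restr D := (fun x => psi x * \1_D x).

Let mrestr (D : set R) : measurable D -> measurable_fun setT (restr D).
Proof. by move=> mD; apply: measurable_funM => //; exact: measurable_indic. Qed.

(** A sequence of thresholds keeps the event measurable; the factor 3 is the one produced by
    truncation. *)
Definition deviates n (l : R) (q : nat -> R) (w : T) :=
  exists i, 3 * l < `|deviation X n (restr `]-oo, q i]) w|.

Let dev_i n l (q : nat -> R) i :=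
  [set w | 3 * l < `|deviation X n (restr `]-oo, q i]) w|].

Let mdev_i n l q i : measurable (dev_i n l q i).
Proof.
pose f w := `|deviation X n (restr `]-oo, q i]) w|.
rewrite (_ : dev_i n l q i = setT `&` f @^-1` [set` `]3 * l, +oo[]).
  apply: (measurableT_comp (@normr_measurable R setT)) => //.
  by apply: measurable_deviation; exact: mrestr.
by apply/seteqP; split => w /=; rewrite in_itv/= andbT// => -[].
Qed.

Lemma measurable_deviates n l q : measurable [set w | deviates n l q w].
Proof.
rewrite (_ : [set w | _] = \bigcup_i dev_i n l q i).
  by apply: bigcup_measurable => i _; exact: mdev_i.
by apply/seteqP; split => [w [i h]|w [i _ h]]; exists i.
Qed.

(** Sorting the thresholds turns the rays into a chain. The set [B j] collects the first [j] sorted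
    rays, so that [B 0] is empty, as the maximal inequality requires. *)
Lemma finite_deviation n N (q : nat -> R) (l : R) : 0 < l ->
  (P (\bigcup_(i in [set i | (i <= N)%N]) dev_i n l q i) <=
   ((24 * 11 ^+ 4 + 2) * (n%:R * s2 / l ^+ 2))%:E)%E.
Proof.
move=> l0; pose qs := [seq q i | i <- iota 0 N.+1]; pose t := sort <=%R qs.
pose B j := \bigcup_(i in [set i | (i < j)%N /\ (i < size t)%N])
  [set` `]-oo, t`_i]] : set R.
have mB j : measurable (B j) by apply: bigcup_measurable.
have Bmono i j : (i <= j)%N -> B i `<=` B j.
  by move=> ij x [k [ki kt] xk]; exists k => //; split => //; exact: leq_trans ij.
have B0 : B 0%N = set0 by apply/seteqP; split => // x [k []].
have t_sorted : sorted <=%R t by exact: sort_le_sorted.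
have BE i : (i <= N)%N -> exists2 j, (j <= size t)%N & B j = [set` `]-oo, q i]].
  move=> iN; have qt : q i \in t.
    by rewrite mem_sort; apply/mapP; exists i => //; rewrite mem_iota.
  have jt : (index (q i) t < size t)%N by rewrite index_mem.
  exists (index (q i) t).+1 => //.
  apply/seteqP; split => [x [k [kj kt]]|x xq]; last first.
    by exists (index (q i) t); rewrite ?nth_index//=; split.
  rewrite /= !in_itv/= => xk; apply: le_trans xk _.
  rewrite -[leRHS](nth_index 0 qt).
  by apply: (sorted_leq_nth le_trans lexx) => //; rewrite inE.
have := nested_deviation indepX identX mpsi psi2 n (size t) mB Bmono B0 l0.
apply: le_trans; apply: le_measure; rewrite ?inE.
- by apply: bigcup_measurable => i _; exact: mdev_i.
- rewrite (_ : [set w | _] = \bigcup_(j in [set j | (j <= size t)%N])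
    [set w | 3 * l < `|deviation X n (restr (B j)) w|]); last first.
    by apply/seteqP; split => [w [j jN h]|w [j jN h]]; exists j.
  apply: bigcup_measurable => j _.
  pose f w := `|deviation X n (restr (B j)) w|.
  rewrite (_ : [set w | _] = setT `&` f @^-1` [set` `]3 * l, +oo[]).
    apply: (measurableT_comp (@normr_measurable R setT)) => //.
    by apply: measurable_deviation; exact: mrestr.
  by apply/seteqP; split => w /=; rewrite in_itv/= andbT// => -[].
- move=> w [i /= iN wi]; have [j jt Bj] := BE _ iN.
  by exists j => //; rewrite Bj.
Qed.

Lemma countable_deviation n (q : nat -> R) (l : R) : 0 < l ->
  (P [set w | deviates n l q w] <=
   ((24 * 11 ^+ 4 + 2) * (n%:R * s2 / l ^+ 2))%:E)%E.
Proof.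
move=> l0; pose F N := \bigcup_(i in [set i | (i <= N)%N]) dev_i n l q i.
have mF N : measurable (F N) by apply: bigcup_measurable => i _; exact: mdev_i.
have FE : [set w | deviates n l q w] = \bigcup_N F N.
  apply/seteqP; split => [w [i h]|w [N _ [i _ h]]]; last by exists i.
  by exists i => //; exists i => /=.
have Fnd : nondecreasing_seq F.
  by move=> i j ij; apply/subsetPset => w [k /= ki h]; exists k => //=; exact: leq_trans ij.
rewrite FE; have cv := nondecreasing_cvg_mu (mu := P) mF (bigcup_measurable (fun i _ => mF i)) Fnd.
rewrite -(cvg_lim _ cv)//; apply: lime_le; first by apply/cvg_ex; eexists; exact: cv.
by apply: nearW => N; exact: finite_deviation.
Qed.

Local Notation dev n D w := (deviation X n (restr D) w).

Let ipsi := psi_integrable mpsi psi2.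

Let irestr (D : set R) : measurable D ->
  P.-integrable setT (EFin \o (fun w => psi (X 0%N w) * \1_D (X 0%N w))).
Proof.
move=> mD; apply: (psi_mul_integrable mpsi psi2); exact: bdd_indic.
Qed.

(** For a fixed outcome the finite sum converges term by term and the mean by domination with
    [|psi|]; this carries bounds from rational rays to all rays, open or closed. *)
Lemma deviation_cvg n (D_ : nat -> set R) D w :
  (forall k, measurable (D_ k)) -> measurable D ->
  (forall x, \1_(D_ k) x @[k --> \oo] --> (\1_D x : R)) ->
  dev n (D_ k) w @[k --> \oo] --> dev n D w.
Proof.
move=> mD_ mD D_D; rewrite /deviation; apply: cvgB.
  apply: cvg_big => [|i _]; first exact: add_continuous.
  by apply: cvgMr; exact: D_D.
apply: cvgMr.
pose f k w := (psi (X 0%N w) * \1_(D_ k) (X 0%N w))%:E.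
pose f0 w := (psi (X 0%N w) * \1_D (X 0%N w))%:E.
have mf k : measurable_fun setT (f k) by case/integrableP: (irestr (mD_ k)).
have mf0 : measurable_fun setT f0 by case/integrableP: (irestr mD).
have ff0 : {ae P, forall v, setT v -> f ^~ v @ \oo --> f0 v}.
  apply: aeW => v _; apply: cvg_EFin; first exact: nearW.
  by apply: cvgMr; exact: D_D.
have fpsi : {ae P, forall v k, setT v -> (`|f k v| <= `|(psi (X 0%N v))%:E|)%E}.
  apply: aeW => v k _; rewrite /f /= lee_fin normrM ler_piMr//.
  by rewrite indicE; case: (_ \in _); rewrite ?normr1 ?normr0.
have [_ _ cv] := dominated_convergence measurableT mf mf0 ff0
  (integrable_abse ipsi) fpsi.
apply: fine_cvg; rewrite fineK//; apply: integrable_fin_num => //; exact: irestr.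
Qed.

Variables (n : nat) (l : R) (w : T).
Hypothesis ratD : forall r : rat, `|dev n `]-oo, ratr r] w| <= l.

Let cvg_norm_le (D_ : nat -> set R) D :
  (forall k, measurable (D_ k)) -> measurable D ->
  (forall x, \1_(D_ k) x @[k --> \oo] --> (\1_D x : R)) ->
  (forall k, `|dev n (D_ k) w| <= l) -> `|dev n D w| <= l.
Proof.
move=> mD_ mD D_D bD; have := cvg_norm (deviation_cvg (n := n) (w := w) mD_ mD D_D) => /(_ _) cv.
rewrite -(cvg_lim _ cv)//; apply: limr_le; first by apply/cvg_ex; eexists; exact: cv.
exact: nearW.
Qed.

Let eventually_eq (D_ : nat -> set R) D x :
  (\forall k \near \oo, D_ k x <-> D x) ->
  \1_(D_ k) x @[k --> \oo] --> (\1_D x : R).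
Proof.
move=> h; apply: cvg_near_cst; near=> k; rewrite !indicE.
have e : D_ k x <-> D x by near: k.
by congr (_%:R); congr nat_of_bool; apply/idP/idP; rewrite !inE => ?; apply/e.
Unshelve. all: by end_near.
Qed.

Lemma ray_deviation t : `|dev n `]-oo, t] w| <= l.
Proof.
have /choice[q qt] : forall k : nat, exists q : rat, t < ratr q < t + k.+1%:R^-1.
  move=> k; have tk : t < t + k.+1%:R^-1 by rewrite ltrDl.
  by have [q] := rat_in_itvoo tk; rewrite in_itv/= => ?; exists q.
apply: (cvg_norm_le (D_ := fun k => [set` `]-oo, ratr (q k)]])) => // x.
apply: eventually_eq; have [xt|tx] := lerP x t.
  apply: nearW => k /=; rewrite !in_itv/= xt; split => // _.
  by have /andP[/ltW + _] := qt k; exact: le_trans.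
have xt0 : 0 < x - t by rewrite subr_gt0.
near=> k; rewrite /= !in_itv/=; split; last by rewrite leNgt tx.
move=> xq; exfalso; have /andP[_ qk] := qt k.
have : k.+1%:R^-1 < x - t by near: k; exact: near_infty_natSinv_lt (PosNum xt0).
by rewrite ltrBrDl => h; have := lt_trans (le_lt_trans xq qk) h; rewrite ltxx.
Unshelve. all: by end_near.
Qed.

(** A lower set is empty, the line, a closed ray or an open ray; each case other than the closed ray
    is a pointwise limit of closed rays. *)
Lemma lower_set_deviation (D : set R) : measurable D ->
  (forall x y, D y -> x <= y -> D x) -> `|dev n D w| <= l.
Proof.
move=> mD Dlow; have [->|D0] := eqVneq D set0.
  apply: (cvg_norm_le (D_ := fun k => [set` `]-oo, (- k%:R : R)]])) => //.
    move=> x; apply: eventually_eq; near=> k; split => //=; rewrite in_itv/= => h.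
    have : - x < k%:R by near: k; exact: nbhs_infty_gtr.
    by rewrite ltrNl ltNge h.
  by move=> k; exact: ray_deviation.
have [DT|/existsNP[u Du]] := pselect (forall x, D x).
  apply: (cvg_norm_le (D_ := fun k => [set` `]-oo, (k%:R : R)]])) => //.
    move=> x; apply: eventually_eq; near=> k; split => // _ /=; rewrite in_itv/=.
    by near: k; exact: nbhs_infty_ger.
  by move=> k; exact: ray_deviation.
have hs : has_sup D.
  split; first exact/set0P.
  exists u => x Dx; rewrite leNgt; apply/negP => /ltW ux; apply: Du; exact: Dlow ux.
have [Ds|Ds] := pselect (D (sup D)).
  rewrite (_ : D = [set` `]-oo, sup D]]); first exact: ray_deviation.
  apply/seteqP; split => x /=; rewrite in_itv/=; last exact: Dlow.
  by move=> Dx; apply: sup_upper_bound.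
apply: (cvg_norm_le (D_ := fun k => [set` `]-oo, sup D - k.+1%:R^-1]])) => //; last first.
  by move=> k; exact: ray_deviation.
move=> x; apply: eventually_eq; have [xs|sx] := ltrP x (sup D); last first.
  apply: nearW => k /=; rewrite in_itv/=; split.
    move=> xk; exfalso; have := le_trans sx xk.
    by rewrite leNgt ltrBlDr ltrDl invr_gt0 ltr0n.
  move=> Dx; exfalso; apply: Ds; exact: Dlow sx.
have xs0 : 0 < sup D - x by rewrite subr_gt0.
near=> k; rewrite /= in_itv/=; split => [_|_].
  have [y Dy xy] := sup_adherent xs0 hs.
  by apply: (Dlow _ _ Dy); rewrite ltW//; move: xy; rewrite subKr.
rewrite lerBrDl -lerBrDr ltW//.
by near: k; exact: near_infty_natSinv_lt (PosNum xs0).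
Unshelve. all: by end_near.
Qed.

(** An interval is its lower closure minus the lower set strictly to its left, whence the factor 2.
    No case distinction on the type of the endpoints is involved. *)
Lemma interval_deviation (I : set R) : is_interval I -> `|dev n I w| <= 2 * l.
Proof.
move=> itvI; pose B : set R := [set x | exists2 y, I y & x <= y].
pose A := B `\` I.
have Blow x y : B y -> x <= y -> B x.
  by move=> [z Iz yz] xy; exists z => //; exact: le_trans yz.
have Alow x y : A y -> x <= y -> A x.
  move=> [By nIy] xy; split; first exact: Blow xy.
  move=> Ix; apply: nIy; have [z Iz yz] := By.
  by apply: (itvI x z) => //; rewrite xy.
have mlow (D : set R) : (forall x y, D y -> x <= y -> D x) -> measurable D.
  move=> Dl; apply: is_interval_measurable => x y Dx Dy z /andP[_ zy].
  exact: Dl zy.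
have IB : I `<=` B by move=> x Ix; exists x.
have IE x : \1_I x = \1_B x - \1_A x :> R.
  rewrite !indicE; have [Ix|nIx] := pselect (I x).
    by rewrite mem_set// mem_set ?memNset ?subr0//; [move=> []|exact: IB].
  rewrite memNset//; have [Bx|nBx] := pselect (B x).
    by rewrite !mem_set ?subrr.
  by rewrite !memNset ?subrr// => -[].
have mB := mlow _ Blow; have mA := mlow _ Alow.
have -> : dev n I w = dev n B w - dev n A w.
  rewrite /deviation; under eq_bigr do rewrite IE mulrBr.
  under eq_Rintegral do rewrite IE mulrBr.
  by rewrite sumrB RintegralB//; [ring|exact: irestr|exact: irestr].
rewrite (le_trans (ler_normB _ _))// mulr2n mulrDl mul1r lerD//.
  exact: lower_set_deviation.
exact: lower_set_deviation.
Qed.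

(** The staircase of mesh [M / N] has [N] interval levels, each of deviation at most [2 * l], which
    add up to [2 * M * l] for every [N]. The remainder is at most [M / N] times a quantity [S] fixed
    by the outcome, and [N] is chosen last. *)
Lemma quasiconcave_deviation (M : R) (f : R -> R) : 0 < M ->
  (forall x, 0 <= f x <= M) ->
  (forall u, 0 < u -> is_interval [set x | u <= f x]) ->
  `|deviation X n (fun x => psi x * f x) w| <= 2 * M * l.
Proof.
move=> M0 fM fq.
have mlev u : measurable [set x | u <= f x].
  exact: (measurable_superlevel fM fq).
have mf := quasiconcave_measurable fM fq.
have bf : bdd f.
  by split => //; exists M => x; have /andP[f0 f1] := fM x; rewrite ger0_norm.
have l0 : 0 <= l by apply: le_trans (ratD 0).
pose S : R := \sum_(i < n) `|psi (X i w)| + n%:R * mean (fun x => `|psi x|).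
have S0 : 0 <= S.
  rewrite addr_ge0 ?sumr_ge0// mulr_ge0//; apply: exp_ge0 => v; exact: normr_ge0.
apply/ler_addgt0Pr => e e0.
pose N := (Num.truncn (M * S / e)).+1.
have N0 : 0 < N%:R :> R by rewrite ltr0n.
have hN : M / N%:R * S <= e.
  have h : M * S / e <= N%:R by exact/ltW/truncnS_gt.
  by rewrite mulrAC ler_pdivrMr// [e * _]mulrC -ler_pdivrMr.
pose A (i : nat) := [set x | i.+1%:R * (M / N%:R) <= f x].
pose fN x := M / N%:R * \sum_(i < N) (\1_(A i) x : R).
have ffN x : 0 <= f x - fN x <= M / N%:R.
  rewrite (_ : fN x = M / N%:R *
      \sum_(i < N) (i.+1%:R * (M / N%:R) <= f x)%R%:R).
    exact: staircase.
  congr (_ * _); apply: eq_bigr => i _.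
  rewrite indicE /A; case: (boolP (_ <= f x)) => h; first by rewrite mem_set.
  by rewrite memNset//; exact/negP.
have bA i : bdd (\1_(A i) : R -> R) by apply: bdd_indic; exact: mlev.
have bfN : bdd fN by apply: bddM => //; apply: bdd_sum => i.
have iA i : P.-integrable setT (EFin \o (fun v => psi (X 0%N v) * \1_(A i) (X 0%N v))).
  by apply: irestr; exact: mlev.
have devN : deviation X n (fun x => psi x * fN x) w =
    M / N%:R * \sum_(i < N) dev n (A i) w.
  rewrite /deviation sumrB mulrBr; congr (_ - _).
    rewrite exchange_big/= mulr_sumr; apply: eq_bigr => i _.
    by rewrite /fN mulrCA mulr_sumr.
  rewrite -mulr_sumr mulrCA; congr (_ * _).
  rewrite /fN; under eq_Rintegral do rewrite mulrCA mulr_sumr.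
  rewrite RintegralZl//; last first.
    pose h (i : 'I_N) v : R := psi (X 0%N v) * \1_(A i) (X 0%N v).
    rewrite (_ : EFin \o _ = (fun v => \sum_(i < N) (h i v)%:E)%E); last first.
      by apply/funext => v /=; rewrite sumEFin.
    by apply: integrable_sum => // i _; exact: iA.
  by congr (_ * _); rewrite Rintegral_sum// => i; exact: iA.
have h1 : `|deviation X n (fun x => psi x * fN x) w| <= 2 * M * l.
  have MN0 : 0 <= M / N%:R by rewrite divr_ge0// ltW.
  rewrite devN normrM (ger0_norm MN0).
  apply: (@le_trans _ _ (M / N%:R * \sum_(i < N) (2 * l))).
    rewrite ler_wpM2l//; apply: (le_trans (ler_norm_sum _ _ _)).
    apply: ler_sum => i _; apply: interval_deviation; apply: fq.
    by rewrite mulr_gt0 ?divr_gt0// ltr0n.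
  rewrite sumr_const card_ord -[X in _ * X]mulr_natl le_eqVlt; apply/orP; left.
  by apply/eqP; field; rewrite gt_eqF.
have h2 : `|deviation X n (fun x => psi x * f x) w -
    deviation X n (fun x => psi x * fN x) w| <= M / N%:R * S.
  have -> : deviation X n (fun x => psi x * f x) w -
      deviation X n (fun x => psi x * fN x) w =
      deviation X n (fun x => psi x * (f x - fN x)) w.
    rewrite /deviation; under [X in _ = X - _]eq_bigr do rewrite mulrBr.
    under [X in _ = _ - _ * X]eq_Rintegral do rewrite mulrBr.
    rewrite sumrB RintegralB//; first by ring.
      exact: (psi_mul_integrable mpsi psi2 bf).
    exact: (psi_mul_integrable mpsi psi2 bfN).
  have fle x : `|psi x * (f x - fN x)| <= M / N%:R * `|psi x|.
    have /andP[g0 g1] := ffN x.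
    by rewrite normrM mulrC (ger0_norm g0) ler_wpM2r.
  rewrite (le_trans (ler_normB _ _))// /S mulrDr lerD//.
    rewrite (le_trans (ler_norm_sum _ _ _))// mulr_sumr.
    by apply: ler_sum => i _; exact: fle.
  rewrite normrM (@ger0_norm _ n%:R)// mulrCA ler_wpM2l//.
  have bffN : bdd (fun x => f x - fN x) by exact: bddB.
  have ii := psi_mul_integrable mpsi psi2 bffN.
  apply: (le_trans (le_normr_Rintegral measurableT ii)).
  have iabs : P.-integrable setT (EFin \o (fun v => `|psi (X 0%N v)|)).
    by have /integrable_abse := ipsi.
  rewrite -RintegralZl//; apply: le_Rintegral => //.
    by have /integrable_abse := ii.
  exact: integrable_EFinZ.
have := ler_normD (deviation X n (fun x => psi x * f x) w -
    deviation X n (fun x => psi x * fN x) w) (deviation X n (fun x => psi x * fN x) w).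
by rewrite subrK => h3; lra.
Qed.

End UniformDeviation.

(** * Minimal majorants and outer convergence *)

Section Majorants.
Context d (Omega : measurableType d) (R : realType) (P : probability Omega R).

Lemma measurable_if_mem (A : set Omega) (x y : \bar R) : measurable A ->
  measurable_fun setT (fun w => if w \in A then x else y).
Proof.
move=> mA; apply: (@measurable_fun_ifT _ _ _ _ (cst x) (cst y) (mem A)) => //.
apply: (measurable_fun_bool true); rewrite setTI [X in measurable X](_ : _ = A)//.
by apply/seteqP; split => w /=; [exact: set_mem|exact: mem_set].
Qed.

Lemma limn_esup_le_near (u : nat -> \bar R) x :
  (\forall n \near \oo, (u n <= x)%E) -> (limn_esup u <= x)%E.
Proof.
move=> [N _ hN]; rewrite limn_esup_lim; apply: lime_le; first exact: is_cvg_esups.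
exists N => // n /= Nn; apply: ge_ereal_sup => _ [k /= nk <-].
by apply: hN => /=; exact: leq_trans nk.
Qed.

Lemma outer_prob_le (A B : set Omega) : measurable A -> B `<=` A ->
  (outer_prob P B <= P A)%E.
Proof. by move=> mA BA; apply: ereal_inf_lbound; exists A. Qed.

(** Intersecting countably many covers that nearly attain the outer probability gives one that
    attains it. *)
Lemma measurable_hull (B : set Omega) : exists A, [/\ measurable A, B `<=` A &
  forall A', measurable A' -> B `<=` A' -> (P A <= P A')%E].
Proof.
have inf_fin : outer_prob P B \is a fin_num.
  rewrite ge0_fin_numE.
    by apply: le_lt_trans (outer_prob_le measurableT (@subsetT _ B)) _;
      rewrite /= probability_setT ltry.
  by apply: le_ereal_inf_tmp => _ [A _ <-].
have /choice[A_ hA] : forall k : nat, exists A, [/\ measurable A, B `<=` A &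
    (P A <= outer_prob P B + (k.+1%:R^-1)%:E)%E].
  move=> k; have k0 : 0 < (k.+1%:R^-1 : R) by [].
  have [_ [A [mA BA] <-] hA] := lb_ereal_inf_adherent k0 inf_fin.
  by exists A; split => //; exact: ltW.
exists (\bigcap_k A_ k); split.
- by apply: bigcap_measurable => // k _; have [] := hA k.
- by move=> w Bw k _; have [_ + _] := hA k; exact.
move=> A' mA' BA'; apply: (@le_trans _ _ (outer_prob P B)); last exact: outer_prob_le.
have mcap : measurable (\bigcap_k A_ k).
  by apply: bigcap_measurable => // k _; have [] := hA k.
apply/lee_addgt0Pr => e e0.
pose k := Num.truncn e^-1.
have ke : k.+1%:R^-1 <= e.
  rewrite -[leRHS]invrK lef_pV2 ?posrE ?invr_gt0//.
  exact/ltW/truncnS_gt.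
have [mA _ hk] := hA k.
apply: (@le_trans _ _ (P (A_ k))).
  by apply: le_measure; rewrite ?inE//; exact: bigcap_inf.
by apply: (le_trans hk); rewrite leeD2l// lee_fin.
Qed.

(* U is the supremum of the rationals q such that w lies in a measurable hull
   of the superlevel set {T > q}. *)
Lemma minimal_majorant_exists (T : Omega -> \bar R) :
  exists U, minimal_majorant P T U.
Proof.
pose qr k : R := ratr (odflt 0 (choice.unpickle k : option rat)).
have /choice[A hA] := fun k => measurable_hull [set w | ((qr k)%:E < T w)%E].
have mA k : measurable (A k) by have [] := hA k.
pose u k w : \bar R := if w \in A k then (qr k)%:E else -oo%E.
have mu k : measurable_fun setT (u k).
  exact: measurable_if_mem.
pose U w := esups (u ^~ w) 0.
have dense (x y : \bar R) : (x < y)%E -> exists k, (x < (qr k)%:E)%E /\ ((qr k)%:E < y)%E.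
  move=> xy; have [q [xq qy]] : exists q : rat, (x < (ratr q : R)%:E)%E /\ ((ratr q : R)%:E < y)%E.
    case: x xy => [x| |]; case: y => [y| |] //.
    - rewrite lte_fin => xy; have [q] := rat_in_itvoo xy.
      by rewrite in_itv/= => /andP[xq qy]; exists q; rewrite !lte_fin.
    - move=> _; have xy : x < x + 1 by rewrite ltrDl.
      have [q] := rat_in_itvoo xy.
      by rewrite in_itv/= => /andP[xq _]; exists q; rewrite lte_fin ltry.
    - move=> _; have xy : y - 1 < y by rewrite gtrBl.
      have [q] := rat_in_itvoo xy.
      by rewrite in_itv/= => /andP[_ qy]; exists q; rewrite ltNyr lte_fin.
    - by move=> _; exists 0; rewrite ltNyr ltry.
  by exists (choice.pickle q); rewrite /qr choice.pickleK.
exists U; split.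
- exact: measurable_fun_esups.
- move=> w; rewrite leNgt; apply/negP => UT.
  have [k [Uk kT]] := dense _ _ UT.
  have : ((qr k)%:E <= U w)%E.
    apply: ereal_sup_ubound; exists k => //; rewrite /u mem_set//.
    by have [_ + _] := hA k; exact.
  by rewrite leNgt Uk.
move=> V mV TV.
have mVk k : measurable [set w | ((qr k)%:E < V w)%E].
  rewrite -[X in measurable X]setTI; apply: emeasurable_fun_o_infty => //.
have ak : \forall w \ae P, forall k, A k w -> ((qr k)%:E < V w)%E.
  apply: ae_foralln => k.
  have [N [mN PN TVN]] := TV.
  have [_ sub min] := hA k.
  (* Cut by the superlevel set of [V], enlarged by the null set [N] outside which [T <= V], the hull
     still covers the superlevel set of [T]; minimality makes the removed part null. *)
  pose A' := A k `&` ([set w | ((qr k)%:E < V w)%E] `|` N).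
  have mA' : measurable A' by apply: measurableI => //; exact: measurableU.
  have subA' : [set w | ((qr k)%:E < T w)%E] `<=` A'.
    move=> w Tw; split; first exact: sub.
    have [Nw|nN] := pselect (N w); first by right.
    left => /=; apply: (lt_le_trans Tw); apply: contrapT => nTV.
    by apply: nN; apply: TVN => /=.
  have le := min _ mA' subA'.
  exists ((A k `\` A') `|` N); split.
  - by apply: measurableU => //; exact: measurableD.
  - apply/eqP; rewrite eq_le measure_ge0 andbT.
    apply: (le_trans (measureU2 _ _ _)) => //; first exact: measurableD.
    rewrite [X in (_ + X)%E](PN : _ = 0%E) adde0 measureD//; last first.
      by rewrite /= (le_lt_trans (probability_le1 _ _))// ltry.
    rewrite (_ : A k `&` A' = A'); last by apply/setIidPr => w [].
    by rewrite sube_le0.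
  - move=> w /= /existsNP; rewrite /= => -[Aw nV].
    have [Nw|nN] := pselect (N w); first by right.
    by left; split => // -[_ [|]].
apply: filterS ak => w h; apply: ge_ereal_sup => _ [k _ <-]; rewrite /u.
by case: ifPn => [|_]; rewrite ?leNye// inE => /h /ltW.
Qed.

Variables (v_ : nat -> Omega -> \bar R) (v : \bar R).
Variables (bad : nat -> R -> set Omega) (C K eta : R).
Hypothesis C0 : 0 < C.
Hypothesis K0 : 0 <= K.
Hypothesis eta0 : 0 < eta.
Hypothesis mbad : forall n l, measurable (bad n l).
Hypothesis near_v : forall n l w, (0 < n)%N -> 0 < l <= eta -> ~ bad n l w ->
  (`|v_ n w - v| <= (C * l)%:E)%E.
Hypothesis Pbad : forall n l, (0 < n)%N -> 0 < l ->
  (P (bad n l) <= (K / (n%:R * l ^+ 2))%:E)%E.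
Hypothesis aebad : forall l, 0 < l ->
  \forall w \ae P, \forall n \near \oo, ~ bad n l w.

(** The function [V n k], infinite on the bad event at level [l k] and equal to [C * l k] elsewhere,
    is a measurable majorant, so it dominates the minimal one almost surely, for all of the
    countably many [n > 0] and [k] at once. *)
Lemma outer_as_cvg_of_bad :
  outer_as_cvg P (fun n w => `|v_ n w - v|%E) (fun _ => 0%E).
Proof.
have /choice[U hU] := fun n => minimal_majorant_exists
  (fun w => `| `|v_ n w - v| - 0 |%E).
exists U; split => //.
pose l k := eta / k.+1%:R.
have l0 k : 0 < l k by rewrite divr_gt0.
have leta k : l k <= eta by rewrite ler_pdivrMr// ler_peMr ?ler1n// ltW.
pose V n k w : \bar R := if w \in bad n (l k) then +oo%E else (C * l k)%:E.
have mV n k : measurable_fun setT (V n k).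
  exact: measurable_if_mem.
have UV : \forall w \ae P, forall n k, (0 < n)%N -> (U n w <= V n k w)%E.
  apply: ae_foralln => n; apply: ae_foralln => k.
  have [n0|n0] := posnP n; first by apply: aeW.
  have [_ _ min] := hU n.
  apply: filterS (min (V n k) (mV n k) _) => //.
  apply: aeW => w; rewrite /V; case: ifPn => [_|]; first by rewrite leey.
  rewrite notin_setE => nb; rewrite sube0 abse_id.
  by apply: near_v => //; rewrite l0 leta.
have nb : \forall w \ae P, forall k, \forall n \near \oo, ~ bad n (l k) w.
  by apply: ae_foralln => k; exact: aebad.
apply: filterS2 UV nb => w UVw nbw.
have U0 n : (0 <= U n w)%E by have [_ h _] := hU n; exact: le_trans (h w).
have key (e : R) : 0 < e -> \forall n \near \oo, (U n w <= e%:E)%E.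
  move=> e0; pose k := Num.truncn (C * eta / e).
  have ke : C * l k <= e.
    have h : C * eta / e <= k.+1%:R by exact/ltW/truncnS_gt.
    by rewrite /l mulrA ler_pdivrMr// [e * _]mulrC -ler_pdivrMr.
  near=> n.
  have n0 : (0 < n)%N by near: n; exact: nbhs_infty_gt.
  have nbn : ~ bad n (l k) w by near: n; exact: nbw.
  have := UVw n k n0; rewrite /V memNset// => h; apply: (le_trans h).
  by rewrite lee_fin.
apply: limn_esup_le_cvg => //; apply/lee_addgt0Pr => e e0; rewrite add0e.
by apply: limn_esup_le_near; exact: key.
Unshelve. all: by end_near.
Qed.

Lemma outer_bounded_of_bad :
  outer_bounded_in_prob P
    (fun n w => ((Num.sqrt n%:R)%:E * (v_ n w - v))%E).
Proof.
move=> eps eps0.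
(* At level [t / sqrt n] the bad event has probability at most [K / t ^+ 2 <= eps]; the added 1
   keeps [t] positive when [K = 0]. *)
pose t : R := Num.sqrt (K / eps) + 1.
have t0 : 0 < t by rewrite ltr_wpDl.
have Kt : K / t ^+ 2 <= eps.
  rewrite ler_pdivrMr ?exprn_gt0// mulrC -ler_pdivrMr//.
  have Ke : 0 <= K / eps by rewrite divr_ge0// ltW.
  by rewrite -[leLHS]sqr_sqrtr// lerXn2r ?nnegrE ?sqrtr_ge0 ?(ltW t0)// lerDl.
(* Off the bad event the scaled error is only known to be at most [C * t]; the extra 1 excludes
   equality, since the event is stated with a weak inequality. *)
exists (C * t + 1); first by rewrite addr_gt0// mulr_gt0.
apply: limn_esup_le_near.
pose N := (Num.truncn ((t / eta) ^+ 2)).+1.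
have main n : (N <= n)%N -> (outer_prob P
    [set w | (C * t + 1)%:E <= `|(Num.sqrt n%:R)%:E * (v_ n w - v)|]%E <= eps%:E)%E.
  move=> Nn; have n0 : (0 < n)%N by exact: leq_trans Nn.
  have n0R : 0 < n%:R :> R by rewrite ltr0n.
  have sn0 : 0 < Num.sqrt (n%:R : R) by rewrite sqrtr_gt0.
  have sn2 : Num.sqrt (n%:R : R) ^+ 2 = n%:R by rewrite sqr_sqrtr// ltW.
  pose l := t / Num.sqrt n%:R.
  have l0 : 0 < l by rewrite divr_gt0.
  have leta : l <= eta.
    rewrite ler_pdivrMr// mulrC -ler_pdivrMr//.
    rewrite -ler_sqr ?nnegrE ?(ltW sn0) ?divr_ge0 ?(ltW t0) ?(ltW eta0)//.
    rewrite sn2; apply: (@le_trans _ _ N%:R); last by rewrite ler_nat.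
    exact/ltW/truncnS_gt.
  apply: (le_trans (outer_prob_le (mbad n l) _)); last first.
    apply: (le_trans (Pbad n0 l0)); rewrite lee_fin.
    by rewrite /l expr_div_n sn2 mulrCA divff ?mulr1// gt_eqF.
  move=> w /= hw; apply: contrapT => nb.
  have /(_ n l w n0) := near_v; rewrite l0 leta => /(_ isT nb) h.
  move: hw; rewrite abseM gee0_abs ?lee_fin ?(ltW sn0)// leNgt => /negP; apply.
  apply: (@le_lt_trans _ _ ((Num.sqrt n%:R)%:E * (C * l)%:E)%E).
    by rewrite lee_pmul2l// lte_fin.
  rewrite -EFinM lte_fin (_ : _ * (C * l) = C * t) ?ltrDl//.
  by rewrite /l; field; rewrite gt_eqF.
by exists N => // n /= Nn; exact: main.
Qed.

End Majorants.

(** * Expectations through a density *)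

Section Density.
Context d (T : measurableType d) (R : realType) (P : probability T R).
Variables (a b : R) (g : R -> R) (X : {RV P >-> R}).
Hypothesis gd : prob_density a b g.
Hypothesis dX : has_density a b g X.
Local Notation leb := (@lebesgue_measure R).
Local Notation mX := (distribution P X).
Let G := (g \_ `[a, b]).

Let mG : measurable_fun setT G.
Proof. by apply/(measurable_restrictT _ _).1 => //; case: gd. Qed.

Let mE (h : R -> R) : measurable_fun setT h ->
  measurable_fun setT (fun x => (h x)%:E).
Proof. by move=> mh; exact/measurable_EFinP. Qed.

Let mGE := mE mG.

Let G0 x : 0 <= G x.
Proof.
rewrite /G patchE; case: ifPn => //; rewrite inE/= in_itv/= => xab.
by case: gd => _ /(_ _ xab)/ltW.
Qed.

Let dXG A : measurable A -> mX A = (\int[leb]_(x in A) (G x)%:E)%E.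
Proof.
move=> mA; rewrite dX// integral_mkcondr; apply: eq_integral => x _.
by rewrite /G !patchE; case: ifPn.
Qed.

Import HBNNSimple.

Let integral_nnsfun_density (f : {nnsfun R >-> R}) :
  (\int[mX]_x (f x)%:E = \int[leb]_x ((f x)%:E * (G x)%:E))%E.
Proof.
under [LHS]eq_integral do rewrite fimfunE -fsumEFin//.
rewrite [LHS]ge0_integral_fsum//; last 2 first.
  - by move=> r; exact/measurable_EFinP/measurableT_comp.
  - by move=> n x _; rewrite EFinM nnfun_muleindic_ge0.
under [RHS]eq_integral.
  move=> x xD; rewrite fimfunE -fsumEFin// muleC ge0_mule_fsumr; last first.
    by move=> r; rewrite EFinM nnfun_muleindic_ge0.
  over.
rewrite [RHS]ge0_integral_fsum//; last 2 first.
  - move=> r; apply: emeasurable_funM; first exact: mGE.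
    apply: (mE (h := fun x => r * \1_(f @^-1` [set r]) x)).
    by apply: measurable_funM => //; exact: measurable_indic.
  - move=> r x _; apply: mule_ge0; first by rewrite lee_fin G0.
    exact: (nnfun_muleindic_ge0 f r x).
apply: eq_fsbigr => r _.
rewrite integralZl_indic_nnsfun// integral_indic// setIT [LHS]/=.
have mr : measurable (f @^-1` [set r]) by [].
have [r0|r0] := leP 0 r; last first.
  have -> : f @^-1` [set r] = set0.
    by rewrite -subset0 => x /= fr; move: r0; rewrite -fr ltNge fun_ge0.
  rewrite measure0 mule0 integral0_eq// => x _.
  by rewrite indic0 mulr0 mule0.
rewrite dXG// [in LHS]integral_mkcond -ge0_integralZl//; last 2 first.
- by apply/(measurable_restrictT _ _).1 => //; apply/measurable_EFinP/measurable_funTS.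
- by move=> x _; rewrite patchE; case: ifPn => _; rewrite ?lee_fin.
apply: eq_integral => x _; rewrite patchE indicE; case: ifPn => _.
  by rewrite mulr1 muleC.
by rewrite mulr0 !mule0.
Qed.

Let ge0_integral_density (f : R -> \bar R) :
  measurable_fun setT f -> (forall x, 0 <= f x)%E ->
  (\int[mX]_x f x = \int[leb]_x (f x * (G x)%:E))%E.
Proof.
move=> mf f0.
pose f_ := nnsfun_approx measurableT mf.
transitivity (limn (fun n => \int[mX]_x (f_ n x)%:E))%E.
  rewrite -monotone_convergence//=.
  - apply: eq_integral => ? /[!inE] xD; apply/esym/cvg_lim => //=.
    exact: cvg_nnsfun_approx.
  - by move=> n; exact/measurable_EFinP/measurable_funTS.
  - by move=> n ? _; rewrite lee_fin.
  - by move=> ? _ ? ? mn; rewrite lee_fin; exact/lefP/nd_nnsfun_approx.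
transitivity (limn (fun n => \int[leb]_x ((f_ n x)%:E * (G x)%:E)))%E.
  by apply: congr_lim; apply/funext => n /=; exact: integral_nnsfun_density.
rewrite -monotone_convergence//=.
- apply: eq_integral => x _; apply/cvg_lim => //=.
  by apply: cvgeZr => //; exact: cvg_nnsfun_approx.
- move=> n; apply: emeasurable_funM; last exact: mGE.
  exact: (mE (h := f_ n)).
- by move=> n ? _; rewrite mule_ge0 ?lee_fin.
- move=> x _ ? ? mn; rewrite lee_wpmul2r ?lee_fin ?G0//.
  by have /lefP/(_ x) := nd_nnsfun_approx measurableT mf mn.
Qed.

Lemma ge0_integral_RV (f : R -> \bar R) :
  measurable_fun setT f -> (forall x, 0 <= f x)%E ->
  (\int[P]_w f (X w) = \int[leb]_(x in `[a, b]) (f x * (g x)%:E))%E.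
Proof.
move=> mf f0; rewrite [RHS]integral_mkcond.
rewrite -[LHS](ge0_integral_distribution X mf f0) ge0_integral_density//.
apply: eq_integral => x _; rewrite /G !patchE; case: ifPn => // _.
by rewrite mule0.
Qed.

(** Positive and negative parts are transferred separately, so the two integrals agree by convention
    even when both parts are infinite. *)
Lemma integral_RV (f : R -> \bar R) : measurable_fun setT f ->
  (\int[P]_w f (X w) = \int[leb]_(x in `[a, b]) (f x * (g x)%:E))%E.
Proof.
move=> mf; rewrite [LHS]integralE [RHS]integralE; congr (_ - _)%E.
- transitivity (\int[P]_w (fun x => maxe (f x) 0%E) (X w))%E.
    by apply: eq_integral => w _; rewrite funeposE.
  rewrite (ge0_integral_RV (f := fun x => maxe (f x) 0%E)); last 2 first.
  + exact: measurable_maxe.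
  + by move=> x; rewrite le_max lexx orbT.
  apply: eq_integral => x; rewrite inE/= in_itv/= => xab.
  have gx : 0 <= g x by case: gd => _ /(_ _ xab)/ltW.
  by rewrite funeposE maxe_pMl// mul0e.
- transitivity (\int[P]_w (fun x => maxe (- f x) 0) (X w))%E.
    by apply: eq_integral => w _; rewrite funenegE.
  rewrite (ge0_integral_RV (f := fun x => maxe (- f x) 0)%E); last 2 first.
  + by apply: measurable_maxe => //; exact: measurableT_comp.
  + by move=> x; rewrite le_max lexx orbT.
  apply: eq_integral => x; rewrite inE/= in_itv/= => xab.
  have gx : 0 <= g x by case: gd => _ /(_ _ xab)/ltW.
  by rewrite funenegE maxe_pMl// mul0e mulNe.
Qed.

Lemma expect_RV (f : R -> R) : measurable_fun setT f ->
  Rintegral P setT (fun w => f (X w)) = expect a b g f.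
Proof.
move=> mf; rewrite /expect /Rintegral; congr fine.
by rewrite (integral_RV (f := EFin \o f))//; exact/measurable_EFinP.
Qed.

Lemma distribution_point x : mX [set x] = 0%E.
Proof.
by rewrite dXG// integral_set1.
Qed.

Lemma RV_in_oo : P [set w | ~ (a < X w < b)] = 0%E.
Proof.
rewrite (_ : [set w | _] = X @^-1` (~` `]a, b[)); last first.
  by apply/seteqP; split => w /=; rewrite in_itv.
apply/eqP; rewrite eq_le measure_ge0 andbT.
have := dX (A := ~` `]a, b[%classic) (measurableC (measurable_itv _)).
rewrite /distribution/= /pushforward => ->.
apply: (@le_trans _ _ (mX [set a] + mX [set b])%E); last first.
  by rewrite !distribution_point adde0.
apply: (le_trans _ (measureU2 mX (measurable_set1 a) (measurable_set1 b))).
apply: (@le_trans _ _ (\int[leb]_(x in [set a; b] `&` `[a, b]) (g x)%:E)%E); last first.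
  rewrite le_eqVlt; apply/orP; left; apply/eqP; symmetry.
  exact: dX (measurableU _ _ (measurable_set1 a) (measurable_set1 b)).
apply: ge0_subset_integral => //.
- by apply: measurableI => //; exact/measurableC.
- by apply: measurableI => //; exact: measurableU.
- apply/measurable_EFinP; case: gd => mg _ _.
  by apply: measurable_funS mg => // x [].
- by move=> x [_]; rewrite /= in_itv/= lee_fin => xab; case: gd => _ /(_ _ xab)/ltW.
move=> x [/= nx xab]; split => //; move: nx xab; rewrite !in_itv/=.
move=> /negP; rewrite negb_and -!leNgt => /orP h /andP[ax xb].
by case: h => h; [left|right] => /=; apply/eqP; rewrite eq_le ?ax ?xb ?h.
Qed.

End Density.

(** * Ties have probability zero *)

Section NoTies.
Context d (T : measurableType d) (R : realType) (P : probability T R).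
Variables (a b : R) (g : R -> R) (X : nat -> {RV P >-> R}).
Hypothesis iX : iid_with_density a b g X.

(** By uniqueness of product measures the joint law is the product of the marginals, and the
    sections of the diagonal are single points, null for a law with a density. *)
Lemma no_ties i j : i != j -> P [set w | X i w = X j w] = 0%E.
Proof.
move=> ij; have [indX dX] := iX.
pose Y w := (X i w, X j w).
have mY : measurable_fun setT Y by apply/measurable_fun_pairP; split.
pose D : set (R * R) := [set z | z.1 = z.2].
have mD : measurable D.
  rewrite (_ : D = setT `&` (fun z : R * R => z.1 - z.2) @^-1` [set 0]).
    by apply: measurable_funB => //; exact: measurable_set1.
  by apply/seteqP; split => z /=; [move=> ->; rewrite subrr|move=> [_ /subr0_eq]].
pose m' : probability (R * R)%type R :=
  distribution P (mfun_Sub (mem_set mY) : {RV P >-> (R * R)%type}).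
rewrite -[LHS]/(m' D).
rewrite -(product_measure_unique (m1 := distribution P (X i)) (m2 := distribution P (X j)))//.
  rewrite /product_measure1 integral0_eq// => x _ /=.
  rewrite (_ : xsection D x = [set x]); last first.
    by apply/seteqP; split => y; rewrite /xsection/= inE /D/= => ->.
  exact: distribution_point (dX j) x.
move=> A B mA mB; rewrite /m' /pushforward /=.
pose J : {fset nat} := [fset i; j]%fset.
pose F k := if k == i then A else B.
have mF k : measurable (F k) by rewrite /F; case: ifP.
have := indX J F mF; rewrite big_fsetU1/=; last by rewrite inE.
rewrite big_seq_fset1 /F eqxx eq_sym (negbTE ij) => <-.
congr (P _); apply/seteqP; split => w /=.
  by move=> [Aw Bw] k; rewrite /= !inE => /orP[] /eqP ->; rewrite ?eqxx// eq_sym (negbTE ij).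
move=> h; split; first by have := h i; rewrite /= !inE !eqxx; exact.
by have := h j; rewrite /= !inE !eqxx orbT eq_sym (negbTE ij); exact.
Qed.

End NoTies.

(** * Almost sure control of the deviations *)

(** Telescoping: [1 / x^2 <= 2 / x - 2 / (x + 1)] for [x >= 1]. *)
Lemma sum_inv_sqr_le (R : realFieldType) n :
  \sum_(k < n) (k.+1%:R ^+ 2)^-1 <= 2 - 2 / n.+1%:R :> R.
Proof.
elim: n => [|n IHn]; first by rewrite big_ord0 divr1 subrr.
rewrite big_ord_recr/=; apply: (le_trans (lerD IHn (lexx _))).
rewrite -subr_ge0.
have n1 : 0 < n.+1%:R :> R by rewrite ltr0n.
have -> : n.+2%:R = n.+1%:R + 1 :> R by rewrite -natr1.
set x : R := n.+1%:R in n1 *.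
have x1 : 1 <= x by rewrite /x ler1n.
clearbody x; clear IHn.
have -> : 2 - 2 / (x + 1) - (2 - 2 / x + (x ^+ 2)^-1) = (x - 1) / (x ^+ 2 * (x + 1)).
  have x0' : x + 1 != 0 by rewrite gt_eqF// addr_gt0.
  by field; rewrite x0' lt0r_neq0.
by rewrite divr_ge0 ?subr_ge0// mulr_ge0 ?sqr_ge0// addr_ge0// ltW.
Qed.

Lemma ae_eventually_not d (T : measurableType d) (R : realType)
    (P : probability T R) (F : nat -> set T) (C : R) :
  (forall k, measurable (F k)) -> 0 <= C ->
  (forall k, (P (F k) <= (C / k.+1%:R ^+ 2)%:E)%E) ->
  \forall w \ae P, \forall k \near \oo, ~ F k w.
Proof.
move=> mF C0 PF.
exists (lim_sup_set F); split.
- by apply: bigcap_measurable => // k _; exact: bigcup_measurable.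
- apply: lim_sup_set_cvg0 => //.
  apply: (@le_lt_trans _ _ (C * 2)%:E); last exact: ltry.
  apply: lime_le; first exact: is_cvg_nneseries.
  apply: nearW => n; rewrite big_mkord.
  apply: (@le_trans _ _ (\sum_(k < n) (C / k.+1%:R ^+ 2)%:E)%E).
    by apply: lee_sum => k _; exact: PF.
  rewrite sumEFin lee_fin -mulr_sumr ler_wpM2l//.
  apply: (le_trans (sum_inv_sqr_le R n)).
  by rewrite lerBlDr lerDl divr_ge0.
- move=> w h n _; apply: contrapT => hn; apply: h; exists n => // k /= nk Fk.
  by apply: hn; exists k.
Qed.

Lemma between_squares n : exists k, (k ^ 2 <= n < k.+1 ^ 2)%N.
Proof.
elim: n => [|n [k /andP[kn nk]]]; first by exists 0%N.
have [h|h] := ltnP n.+1 (k.+1 ^ 2).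
  by exists k; rewrite h andbT; lia.
exists k.+1; rewrite h /=; apply: (leq_ltn_trans nk).
by rewrite ltn_sqr.
Qed.

Section EventualDeviation.
Context d (T : measurableType d) (R : realType) (P : probability T R).
Variable X : nat -> {RV P >-> R}.
Local Notation bdd := (bounded_measurable (R := R)).
Local Notation Ex := (Rintegral P setT).
Local Notation mean k := (Ex (fun w => k (X 0%N w))).
Hypothesis indepX : mutually_independent X.
Hypothesis identX : forall i k, bdd k ->
  Ex (fun w => k (X i w)) = Ex (fun w => k (X 0%N w)).
Variable psi : R -> R.
Hypothesis mpsi : measurable_fun setT psi.
Hypothesis psi2 : P.-integrable setT (EFin \o (fun w => psi (X 0%N w) ^+ 2)).
Local Notation s2 := (mean (fun x => psi x ^+ 2)).
Hypothesis psi2i : forall i, (\int[P]_w (psi (X i w) ^+ 2)%:E = s2%:E)%E.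

Let block N r w := \sum_(i < r) psi (X (N + i)%N w) ^+ 2.

Let mpsi2 i : measurable_fun setT (fun w => psi (X i w) ^+ 2).
Proof. by apply: measurable_funX; exact: measurableT_comp. Qed.

Let mblock N r : measurable_fun setT (block N r).
Proof. by apply: measurable_sum => i. Qed.

Let block_ge0 N r w : 0 <= block N r w.
Proof. by apply: sumr_ge0 => i _; exact: sqr_ge0. Qed.

Let prob_block (N r : nat) (t : R) : 0 < t ->
  (P [set w | (t <= block N r w)%R] <= (r%:R * s2 / t)%:E)%E.
Proof.
move=> t0.
have := le_integral_abse P measurableT (g := EFin \o block N r) (a := t).
move=> /(_ _ t0); rewrite setTI.
have -> : [set x | (`|(EFin \o block N r) x| >= t%:E)%E] = [set w | t <= block N r w].
  by apply/seteqP; split => w /=; rewrite lee_fin ger0_norm.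
have -> : (\int[P]_x `|(EFin \o block N r) x| = (r%:R * s2)%:E)%E.
  transitivity (\int[P]_x (\sum_(i < r) (psi (X (N + i)%N x) ^+ 2)%:E))%E.
    by apply: eq_integral => w _ /=; rewrite ger0_norm// sumEFin.
  rewrite ge0_integral_sum//; last 2 first.
  - by move=> i; exact/measurable_EFinP.
  - by move=> i w _; rewrite lee_fin sqr_ge0.
  rewrite (eq_bigr (fun _ => s2%:E)) => [|i _]; last exact: psi2i.
  by rewrite sumEFin sumr_const card_ord mulr_natl.
move=> h.
have mB : measurable [set w | t <= block N r w].
  rewrite (_ : [set w | _] = setT `&` block N r @^-1` [set` `[t, +oo[]).
    by apply: mblock.
  by apply/seteqP; split => w /=; rewrite in_itv/= andbT// => -[].
have fB := fineK (fin_num_measure P _ mB).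
have mE : measurable_fun setT (EFin \o block N r) by exact/measurable_EFinP.
have : (t%:E * (fine (P [set w | t <= block N r w]))%:E <= (r%:R * s2)%:E)%E.
  by rewrite fB; exact: h mE.
rewrite -[X in _ -> (X <= _)%E]fB -EFinM !lee_fin => {}h.
by rewrite ler_pdivlMr// mulrC.
Qed.

Let sum_abs_le_block N r w :
  (\sum_(i < r) `|psi (X (N + i)%N w)|) ^+ 2 <= r%:R * block N r w.
Proof.
case: r => [|r]; first by rewrite big_ord0 expr0n mul0r.
set S := \sum_(i < r.+1) _.
have : 0 <= \sum_(i < r.+1) (r.+1%:R * `|psi (X (N + i)%N w)| - S) ^+ 2.
  by apply: sumr_ge0 => i _; exact: sqr_ge0.
have -> : \sum_(i < r.+1) (r.+1%:R * `|psi (X (N + i)%N w)| - S) ^+ 2 =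
    r.+1%:R * (r.+1%:R * block N r.+1 w - S ^+ 2).
  under eq_bigr => i _.
    rewrite (_ : _ ^+ 2 = r.+1%:R ^+ 2 * psi (X (N + i)%N w) ^+ 2
       - (2 * r.+1%:R * S) * `|psi (X (N + i)%N w)| + S ^+ 2); last first.
      by rewrite -[psi _ ^+ 2]real_normK ?num_real//; ring.
    over.
  rewrite big_split/= sumrB -!mulr_sumr -/S sumr_const card_ord -/(block N r.+1 w).
  by rewrite -mulr_natl; ring.
by rewrite pmulr_rge0 ?ltr0n// subr_ge0.
Qed.

Let restr D := (fun x => psi x * \1_D x : R).

Let deviation_shift N r D w : measurable D ->
  `|deviation X (N + r) (restr D) w| <= `|deviation X N (restr D) w| +
    \sum_(i < r) `|psi (X (N + i)%N w)| + r%:R * mean (fun x => `|psi x|).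
Proof.
move=> mD; have ipsi := psi_integrable mpsi psi2.
have bD : bdd (\1_D : R -> R) by exact: bdd_indic.
have iD := psi_mul_integrable mpsi psi2 bD.
have ler1 x : `|restr D x| <= `|psi x|.
  rewrite /restr normrM indicE; case: (_ \in D); rewrite ?normr1 ?mulr1//.
  by rewrite normr0 mulr0.
rewrite (_ : deviation X (N + r) (restr D) w = deviation X N (restr D) w +
   \sum_(i < r) restr D (X (N + i)%N w) - r%:R * mean (restr D)); last first.
  by rewrite /deviation big_split_ord/= natrD; ring.
apply: (le_trans (ler_normB _ _)); apply: lerD.
  apply: (le_trans (ler_normD _ _)); apply: lerD => //.
  by apply: (le_trans (ler_norm_sum _ _ _)); exact: ler_sum.
rewrite normrM ger0_norm ?ler0n// ler_wpM2l ?ler0n//.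
apply: (le_trans (le_normr_Rintegral measurableT iD)).
apply: le_Rintegral => //; last by move=> x _; exact: ler1.
- exact: integrable_norm iD.
- exact: integrable_norm ipsi.
Qed.

(** For [n] between consecutive squares the deviation splits into its value at the lower square, the
    absolute weights added since, and the drift of the mean; each is kept below [N k * l], and
    [3 * (N k * l) <= 3 * (n * l)]. *)
Lemma eventually_not_deviates (q : nat -> R) (l : R) : 0 < l ->
  \forall w \ae P, \forall n \near \oo, ~ deviates X psi n (n%:R * l) q w.
Proof.
move=> l0; pose p := mean (fun x => `|psi x|).
(* The length [r k = 2 k + 3] is the gap from [(k + 1)^2] to [(k + 2)^2]. *)
pose N k := (k.+1 ^ 2)%N; pose r k := k.*2.+3.
(* The level [l / 3] absorbs the factor 3 in [deviates]. The block threshold is what Cauchy-Schwarz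
   needs in order to keep the sum of [|psi|] over the block below [N k * l]. *)
pose F k := [set w | deviates X psi (N k) ((N k)%:R * (l / 3)) q w] `|`
  [set w | (N k)%:R ^+ 2 * l ^+ 2 / (r k)%:R <= block (N k) (r k) w].
have s20 : 0 <= s2 by apply: exp_ge0 => w; exact: sqr_ge0.
(* The 9 is the square of 3 in [r k <= 3 (k + 1)]: Markov bounds the block event by
   [(r k / N k)^2 * s2 / l^2]. *)
pose C : R := (24 * 11 ^+ 4 + 2) * (s2 * (3 / l) ^+ 2) + 9 * s2 / l ^+ 2.
have C0 : 0 <= C.
  have c0 : 0 <= 24 * 11 ^+ 4 + 2 :> R by rewrite addr_ge0// mulr_ge0// exprn_ge0.
  apply: addr_ge0; first by rewrite mulr_ge0// mulr_ge0// sqr_ge0.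
  by rewrite divr_ge0 ?sqr_ge0// mulr_ge0.
have N0 k : 0 < (N k)%:R :> R by rewrite ltr0n expn_gt0.
have r0 k : 0 < (r k)%:R :> R by rewrite ltr0n.
have mF k : measurable (F k).
  apply: measurableU; first exact: measurable_deviates.
  rewrite (_ : [set w | _] = setT `&` block (N k) (r k) @^-1`
    [set` `[((N k)%:R ^+ 2 * l ^+ 2 / (r k)%:R), +oo[]).
    by apply: mblock.
  by apply/seteqP; split => w /=; rewrite in_itv/= andbT// => -[].
have PF k : (P (F k) <= (C / k.+1%:R ^+ 2)%:E)%E.
  apply: (le_trans (measureU2 _ _ _)).
  - exact: measurable_deviates.
  - rewrite (_ : [set w | _] = setT `&` block (N k) (r k) @^-1`
      [set` `[((N k)%:R ^+ 2 * l ^+ 2 / (r k)%:R), +oo[]).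
      by apply: mblock.
    by apply/seteqP; split => w /=; rewrite in_itv/= andbT// => -[].
  have l30 : 0 < (N k)%:R * (l / 3) by rewrite mulr_gt0// divr_gt0.
  have h1 := countable_deviation indepX identX mpsi psi2 (N k) q l30.
  have t0 : 0 < (N k)%:R ^+ 2 * l ^+ 2 / (r k)%:R.
    by rewrite divr_gt0// mulr_gt0// exprn_gt0.
  have h2 := prob_block (N k) (r k) t0.
  apply: (le_trans (leeD h1 h2)); rewrite -EFinD lee_fin /C [leRHS]mulrDl.
  have k0 : 0 < k.+1%:R :> R by rewrite ltr0n.
  have Nk : (N k)%:R = k.+1%:R ^+ 2 :> R by rewrite natrX.
  apply: lerD.
    rewrite Nk le_eqVlt; apply/orP; left; apply/eqP.
    by field; rewrite !gt_eqF.
  have -> : (r k)%:R * s2 / ((N k)%:R ^+ 2 * l ^+ 2 / (r k)%:R) =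
     ((r k)%:R / k.+1%:R) ^+ 2 * s2 / l ^+ 2 / k.+1%:R ^+ 2.
    by rewrite Nk; field; rewrite !gt_eqF.
  rewrite ler_wpM2r ?invr_ge0 ?sqr_ge0// ler_wpM2r ?invr_ge0 ?sqr_ge0//.
  rewrite ler_wpM2r//.
  have -> : 9 = 3 ^+ 2 :> R by rewrite -natrX.
  rewrite lerXn2r ?nnegrE ?divr_ge0 ?ler0n// ler_pdivrMr//.
  by rewrite -natrM ler_nat /r; lia.
apply: filterS (ae_eventually_not mF C0 PF) => w [K _ hK].
(* Beyond this index [3 * p <= (k + 1) * l], so the drift [r k * p] is at most
   [(k + 1)^2 * l = N k * l]. *)
pose K' := Num.truncn (3 * p / l).
have K'P : 3 * p / l < K'.+1%:R by exact: truncnS_gt.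
exists ((maxn K.+1 K'.+1).+1 ^ 2)%N => // n /= Kn.
have [k0 /andP[kn nk]] := between_squares n.
have : (maxn K.+1 K'.+1 < k0.+1)%N.
  by rewrite -ltn_sqr; apply: leq_ltn_trans nk; apply: leq_trans Kn; rewrite leq_sqr.
case: k0 kn nk => [|k] kn nk; first by rewrite ltnS leqn0; lia.
rewrite ltnS geq_max !ltnS => /andP[Kk K'k].
have /not_orP[nd nb] := hK k Kk.
rewrite /deviates => -[i]; apply/negP; rewrite -leNgt.
pose e := (n - N k)%N.
have ne : n = (N k + e)%N by rewrite /e subnKC.
have er : (e <= r k)%N by rewrite /e /r leq_subLR; move: nk; rewrite /N; lia.
have mI : measurable (`]-oo, q i] : set R) by exact: measurable_itv.
have Nn : (N k)%:R <= n%:R :> R by rewrite ler_nat.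
rewrite ne; apply: (le_trans (deviation_shift _ _ _ mI)); rewrite -ne.
apply: (@le_trans _ _ (3 * ((N k)%:R * l))); last first.
  by rewrite ler_wpM2l// ler_wpM2r// ltW.
have -> : 3 * ((N k)%:R * l) = (N k)%:R * l + (N k)%:R * l + (N k)%:R * l by ring.
apply: lerD; first apply: lerD.
- rewrite leNgt; apply/negP => h; apply: nd; exists i.
  by rewrite (_ : 3 * _ = (N k)%:R * l)//; field.
- apply: (@le_trans _ _ (\sum_(i < r k) `|psi (X (N k + i)%N w)|)).
    rewrite -(subnKC er) big_split_ord/= lerDl.
    by apply: sumr_ge0.
  rewrite -ler_sqr ?nnegrE; last 2 first.
  + by apply: sumr_ge0.
  + by rewrite mulr_ge0 ?ltW.
  apply: (le_trans (sum_abs_le_block _ _ _)).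
  move/negP: nb; rewrite -ltNge => /ltW nb.
  apply: (le_trans (ler_wpM2l (ltW (r0 k)) nb)).
  by rewrite le_eqVlt; apply/orP; left; apply/eqP; field; rewrite gt_eqF.
- have p0 : 0 <= p by apply: exp_ge0.
  apply: (@le_trans _ _ ((r k)%:R * p)).
    by rewrite ler_wpM2r// ler_nat.
  have : 3 * p <= k.+1%:R * l.
    rewrite -ler_pdivrMr//; apply: (le_trans (ltW K'P)).
    by rewrite ler_nat.
  move=> h; apply: (@le_trans _ _ (k.+1%:R * (3 * p))).
    rewrite mulrA ler_wpM2r// -natrM ler_nat /r; lia.
  apply: (le_trans (ler_wpM2l (ler0n _ _) h)).
  by rewrite mulrA /N natrX expr2.
Qed.

End EventualDeviation.

(** * Shape classes as quasiconcave functions *)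

(** The value 0 outside turns the superlevel sets at positive levels into intervals of the whole
    line, without affecting integrals over [[a, b]] or samples inside it. *)
Definition extend0 (R : realType) (a b : R) (f : R -> R) (x : R) : R :=
  if a <= x <= b then f x else 0.

Lemma extend0E (R : realType) (a b : R) f x : a <= x <= b ->
  extend0 a b f x = f x.
Proof. by rewrite /extend0 => ->. Qed.

Lemma measurable_extend0 (R : realType) (a b : R) f :
  measurable_fun `[a, b] f -> measurable_fun setT (extend0 a b f).
Proof.
move=> mf; rewrite (_ : extend0 a b f = f \_ `[a, b]); last first.
  apply/funext => x; rewrite patchE /extend0.
  have -> : (x \in `[a, b]%classic) = (a <= x <= b) by rewrite mem_setE in_itv.
  by case: ifP.
by apply/(measurable_restrictT _ _).1.
Qed.

Section Shapes.
Variables (R : realType) (a b c M : R).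
Hypothesis M0 : 0 < M.

Lemma extend0_bounds f : (forall x, a <= x <= b -> 0 <= f x <= M) ->
  forall x, 0 <= extend0 a b f x <= M.
Proof.
by move=> fM x; rewrite /extend0; case: ifP => [/fM//|_]; rewrite lexx ltW.
Qed.

Lemma extend0_superlevel f u : 0 < u ->
  (forall x y z, a <= x -> x <= y -> y <= z -> z <= b ->
    u <= f x -> u <= f z -> u <= f y) ->
  is_interval [set x | u <= extend0 a b f x].
Proof.
move=> u0 fq x z /= ux uz y /andP[xy yz]; move: ux uz; rewrite /extend0.
case: ifP => [/andP[ax xb] ux|_]; last by rewrite leNgt u0.
case: ifP => [/andP[az zb] uz|_]; last by rewrite leNgt u0.
by rewrite (le_trans ax xy) (le_trans yz zb)/=; exact: fq ux uz.
Qed.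

(* A convex f in [0, M] is M minus a quasiconcave function in [0, M]. *)
Lemma shape_quasiconcave s f : shape_class s a b c M f ->
  exists (A : R) (h : R -> R), [/\ `|A| <= 1,
    forall x, 0 <= extend0 a b h x <= M,
    forall u, 0 < u -> is_interval [set x | u <= extend0 a b h x]
  & forall x, extend0 a b f x =
      (1 - A) / 2 * extend0 a b (fun _ => M) x + A * extend0 a b h x].
Proof.
move=> [fM]; case: s => /= fs.
(* [A] is 1 here and -1 in the convex case; the coefficient [(1 - A) / 2] switches the constant [M]
   on in the latter only. *)
- exists 1, f; split; first by rewrite normr1.
  + exact: extend0_bounds.
  + move=> u u0; apply: extend0_superlevel => // x y z ax xy yz zb ux uz.
    by apply: (le_trans uz); apply: fs => //; exact: le_trans xy.
  + by move=> x; rewrite subrr mul0r mul0r add0r mul1r.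
- exists (-1), (fun x => M - f x); split; first by rewrite normrN1.
  + apply: extend0_bounds => x /fM /andP[f0 f1].
    by rewrite subr_ge0 f1 lerBlDr lerDl.
  + move=> u u0; apply: extend0_superlevel => // x y z ax xy yz zb ux uz.
    rewrite lerBrDr addrC -lerBrDr; apply: (convex_superlevel fs ax xy yz zb).
      by rewrite lerBrDr addrC -lerBrDr.
    by rewrite lerBrDr addrC -lerBrDr.
  + move=> x; rewrite /extend0; case: ifP => _; last by rewrite !mulr0 addr0.
    by field.
- have [up dn] := fs.
  exists 1, f; split; first by rewrite normr1.
  + exact: extend0_bounds.
  + move=> u u0; apply: extend0_superlevel => // x y z ax xy yz zb ux uz.
    have [yc|cy] := leP y c.
      by apply: (le_trans ux); apply: up => //; exact: le_trans yz zb.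
    apply: (le_trans uz); apply: dn => //; last exact: ltW.
    exact: le_trans xy.
  + by move=> x; rewrite subrr mul0r mul0r add0r mul1r.
Qed.

Lemma extend0_const_superlevel u : 0 < u ->
  is_interval [set x | u <= extend0 a b (fun _ => M) x].
Proof. by move=> u0; apply: extend0_superlevel. Qed.

Lemma bdd_const0 : bounded_measurable (extend0 a b (fun _ => M)).
Proof.
have h : forall x, 0 <= extend0 a b (fun _ => M) x <= M.
  by apply: extend0_bounds => x _; rewrite lexx ltW.
split; first exact: (quasiconcave_measurable h extend0_const_superlevel).
by exists M => x; have /andP[h0 h1] := h x; rewrite ger0_norm.
Qed.

(** Measurability is not part of the definition of the classes; it comes from the interval
    superlevel sets. *)
Lemma bdd_shape s f : shape_class s a b c M f ->
  bounded_measurable (extend0 a b f).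
Proof.
move=> /[dup] -[fM _] /shape_quasiconcave[A [h [_ hM hq fE]]].
split; last first.
  exists M => x; have /andP[f0 f1] := extend0_bounds fM x.
  by rewrite ger0_norm.
rewrite (_ : extend0 a b f = (fun x => (1 - A) / 2 * extend0 a b (fun _ => M) x
   + A * extend0 a b h x)); last by apply/funext.
have [mM _] := bdd_const0.
apply: measurable_funD; apply: measurable_funM => //.
exact: (quasiconcave_measurable hM hq).
Qed.

Lemma shape_class_mixture s (I : finType) (w : I -> R) (f : I -> R -> R) :
  (forall i, shape_class s a b c M (f i)) -> (forall i, 0 <= w i) ->
  \sum_i w i = 1 -> shape_class s a b c M (fun x => \sum_i w i * f i x).
Proof.
move=> fs w0 w1; split.
  move=> x xab; rewrite sumr_ge0/=; last first.
    by move=> i _; rewrite mulr_ge0//; have [/(_ x xab)/andP[]] := fs i.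
  rewrite -[leRHS]mul1r -w1 mulr_suml ler_sum// => i _.
  by rewrite ler_wpM2l//; have [/(_ x xab)/andP[]] := fs i.
case: s fs => fs /=.
- move=> x y ax xy yb; apply: ler_sum => i _; rewrite ler_wpM2l//.
  by have [_] := fs i; exact.
- apply/convex_functionP => x y t xab yab t01.
  rewrite !mulr_sumr -big_split/=; apply: ler_sum => i _.
  have [_ /convex_functionP/(_ x y t xab yab t01) h] := fs i.
  by rewrite [t * (w i * _)]mulrCA [(1 - t) * (w i * _)]mulrCA -mulrDr ler_wpM2l.
- split=> x y *; apply: ler_sum => i _; rewrite ler_wpM2l//.
    by have [_ [+ _]] := fs i; exact.
  by have [_ [_]] := fs i; exact.
Qed.

End Shapes.

Lemma sqr_le_powR (R : realType) (y e : R) : 0 < e ->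
  y ^+ 2 <= 1 + `|y| `^ (2 + e).
Proof.
move=> e0; rewrite -[y ^+ 2]real_normK ?num_real//.
have [y1|y1] := leP `|y| 1.
  by rewrite (@le_trans _ _ 1) ?exprn_ile1 ?lerDl ?powR_ge0.
rewrite -powR_mulrn// (@le_trans _ _ (`|y| `^ (2 + e))) ?lerDr//.
by apply: ler_powR; [exact: ltW|rewrite lerDl ltW].
Qed.

(** * Moments of likelihood ratios through the weights [phi / g] *)

Section Weights.
Context d (T : measurableType d) (R : realType) (P : probability T R).
Variables (a b c M : R) (g : R -> R) (X : nat -> {RV P >-> R}).
Hypothesis M0 : 0 < M.
Hypothesis gd : prob_density a b g.
Hypothesis iX : iid_with_density a b g X.
Hypothesis ginf : 0 < inf [set g x | x in `[a, b]].
Local Notation bdd := (bounded_measurable (R := R)).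
Local Notation Ex := (Rintegral P setT).
Local Notation mean k := (Ex (fun w => k (X 0%N w))).
Local Notation leb := (@lebesgue_measure R).

Lemma iid_indep : mutually_independent X. Proof. by case: iX. Qed.

Lemma iid_ident i k : bdd k ->
  Ex (fun w => k (X i w)) = Ex (fun w => k (X 0%N w)).
Proof.
by case: iX => _ dX [mk _]; rewrite (expect_RV gd (dX i))// (expect_RV gd (dX 0%N)).
Qed.

Variables (phi : R -> R) (e : R).
Hypothesis mphi : measurable_fun `[a, b] phi.
Hypothesis e0 : 0 < e.
Hypothesis phi2e : (\int[leb]_(x in `[a, b]) (`|phi x| `^ (2 + e))%:E < +oo)%E.
Let psi := extend0 a b (fun x => phi x / g x).

Lemma measurable_weight : measurable_fun setT psi.
Proof.
apply: measurable_extend0.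
have [mg g0 _] := gd.
(* On [[a, b]] the inverse of the positive [g] is a power, and real powers are measurable. *)
apply: (eq_measurable_fun (fun x => phi x * g x `^ (-1))).
  move=> x; rewrite inE/= in_itv/= => /g0 gx.
  by rewrite powR_inv1// ltW.
apply: measurable_funM => //.
exact: (measurableT_comp (measurable_powR (-1)) mg).
Qed.

Let psi2 := (\int[P]_w (psi (X 0%N w) ^+ 2)%:E)%E.

Let mpsi2 : measurable_fun setT (fun x => (psi x ^+ 2)%:E).
Proof.
by apply/measurable_EFinP; apply: measurable_funX; exact: measurable_weight.
Qed.

(** On [[a, b]] one has [psi^2 * g = phi^2 / g], at most [(1 + |phi| ^ (2 + e)) / inf g], which is
    integrable on a bounded interval. *)
Let psi2_lty : (psi2 < +oo)%E.
Proof.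
have [mg g0 _] := gd; have [_ dX] := iX.
rewrite /psi2 (ge0_integral_RV gd (dX 0%N) (f := fun x => (psi x ^+ 2)%:E))//; last first.
  by move=> x; rewrite lee_fin sqr_ge0.
set y := inf [set g x | x in `[a, b]].
have y0 : 0 < y by exact: ginf.
have ley x : a <= x <= b -> y <= g x.
  move=> xab; apply: ge_inf; last by exists x => //=; rewrite in_itv.
  by exists 0 => _ [z /= + <-]; rewrite in_itv/= => /g0/ltW.
have mpow : measurable_fun `[a, b] (fun x => (`|phi x| `^ (2 + e))%:E).
  apply/measurable_EFinP; apply: (measurableT_comp (measurable_powR _)).
  exact: measurableT_comp.
apply: (@le_lt_trans _ _
   (\int[leb]_(x in `[a, b]) (y^-1%:E * (1 + (`|phi x| `^ (2 + e))%:E)))%E).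
  apply: ge0_le_integral => //.
  - by move=> x; rewrite /= in_itv/= => /g0/ltW gx; rewrite mule_ge0 ?lee_fin ?sqr_ge0.
  - by apply: emeasurable_funM; [exact: measurable_funTS|exact/measurable_EFinP].
  - apply: emeasurable_funM => //; exact: emeasurable_funD.
  - move=> x; rewrite /= in_itv/= => xab; have gx := g0 x xab.
    rewrite /psi extend0E// -EFinM -EFinD -EFinM lee_fin.
    have -> : (phi x / g x) ^+ 2 * g x = (g x)^-1 * phi x ^+ 2.
      by field; rewrite gt_eqF.
    apply: ler_pM; rewrite ?invr_ge0 ?sqr_ge0//; first exact: ltW.
      by rewrite lef_pV2 ?posrE//; exact: ley.
    exact: sqr_le_powR.
rewrite ge0_integralZl//; last 3 first.
- exact: emeasurable_funD.
- by move=> x _; rewrite -EFinD lee_fin addr_ge0// powR_ge0.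
- by rewrite lee_fin invr_ge0 ltW.
rewrite lte_mul_pinfty//; first by rewrite lee_fin invr_ge0 ltW.
rewrite ge0_integralD//.
apply: lte_add_pinfty; last exact: phi2e.
by rewrite integral_cst// mul1e/= lebesgue_measure_itv/=; case: ifP; rewrite ?ltry.
Qed.

Let psi2i i : (\int[P]_w (psi (X i w) ^+ 2)%:E = psi2)%E.
Proof.
have [_ dX] := iX.
rewrite /psi2 (ge0_integral_RV gd (dX 0%N) (f := fun x => (psi x ^+ 2)%:E))//; last first.
  by move=> x; rewrite lee_fin sqr_ge0.
rewrite (ge0_integral_RV gd (dX i) (f := fun x => (psi x ^+ 2)%:E))//.
by move=> x; rewrite lee_fin sqr_ge0.
Qed.

Lemma weight_sqr_integrable :
  P.-integrable setT (EFin \o (fun w => psi (X 0%N w) ^+ 2)).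
Proof.
apply/integrableP; split.
  exact: (measurableT_comp mpsi2 (measurable_funP (X 0%N))).
rewrite (eq_integral (fun w => (psi (X 0%N w) ^+ 2)%:E)); first exact: psi2_lty.
by move=> w _ /=; rewrite ger0_norm// sqr_ge0.
Qed.

Lemma weight_sqr_ident i : (\int[P]_w (psi (X i w) ^+ 2)%:E =
  (mean (fun x => psi x ^+ 2))%:E)%E.
Proof.
rewrite psi2i /Rintegral fineK// ge0_fin_numE; first exact: psi2_lty.
by apply: integral_ge0 => w _; rewrite lee_fin sqr_ge0.
Qed.

Lemma moment_mean f : measurable_fun setT (extend0 a b f) ->
  expect a b g (fun x => phi x * (f x / g x)) =
  mean (fun x => psi x * extend0 a b f x).
Proof.
move=> mf; have [_ dX] := iX.
rewrite (expect_RV gd (dX 0%N) (f := fun x => psi x * extend0 a b f x)); last first.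
  by apply: measurable_funM => //; exact: measurable_weight.
rewrite /expect /Rintegral; congr fine; apply: eq_integral => x.
rewrite inE/= in_itv/= => xab; rewrite /psi !extend0E//; congr EFin; ring.
Qed.

(** The constant and the quasiconcave part of the decomposition cost [2 * M * l] each, with
    coefficients of absolute value at most 1. *)
Lemma shape_deviation s f n (l : R) w :
  (forall r : rat,
    `|deviation X n (fun x => psi x * \1_`]-oo, ratr r] x) w| <= l) ->
  shape_class s a b c M f ->
  `|deviation X n (fun x => psi x * extend0 a b f x) w| <= 4 * M * l.
Proof.
move=> ratD fs.
have mpsi := measurable_weight; have ipsi := weight_sqr_integrable.
have [A [h [A1 hM hq fE]]] := shape_quasiconcave M0 fs.
have bM : bdd (extend0 a b (fun _ => M)) := bdd_const0 a b M0.
have bh : bdd (extend0 a b h).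
  split; first exact: (quasiconcave_measurable hM hq).
  by exists M => x; have /andP[h0 h1] := hM x; rewrite ger0_norm.
have dM : `|deviation X n (fun x => psi x * extend0 a b (fun _ => M) x) w| <= 2 * M * l.
  apply: (quasiconcave_deviation mpsi ipsi ratD M0).
    by apply: extend0_bounds => // x _; rewrite lexx ltW.
  exact: extend0_const_superlevel.
have dh := quasiconcave_deviation mpsi ipsi ratD M0 hM hq.
have iM := psi_mul_integrable mpsi ipsi bM.
have ih := psi_mul_integrable mpsi ipsi bh.
have -> : deviation X n (fun x => psi x * extend0 a b f x) w =
   (1 - A) / 2 * deviation X n (fun x => psi x * extend0 a b (fun _ => M) x) w +
   A * deviation X n (fun x => psi x * extend0 a b h x) w.
  rewrite /deviation.
  have -> : mean (fun x => psi x * extend0 a b f x) =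
     (1 - A) / 2 * mean (fun x => psi x * extend0 a b (fun _ => M) x) +
     A * mean (fun x => psi x * extend0 a b h x).
    rewrite -!RintegralZl// -RintegralD//.
    - by apply: eq_Rintegral => v _; rewrite fE; ring.
    - exact: integrable_EFinZ.
    - exact: integrable_EFinZ.
  under eq_bigr do rewrite fE mulrDr mulrCA [psi _ * (A * _)]mulrCA.
  by rewrite big_split/= -!mulr_sumr; ring.
apply: (le_trans (ler_normD _ _)).
have -> : 4 * M * l = 2 * M * l + 2 * M * l by ring.
have l0 : 0 <= l by apply: le_trans (ratD 0).
have Ml : 0 <= 2 * M * l by rewrite mulr_ge0// mulr_ge0// ltW.
rewrite !normrM lerD//; last by apply: (le_trans _ dh); rewrite ler_piMl.
apply: (le_trans _ dM); rewrite ler_piMl//.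
move: A1; rewrite ler_norml => /andP[A1 A2].
have -> : `|1 - A| * `|2^-1| = (1 - A) / 2.
  by rewrite !ger0_norm ?subr_ge0.
by rewrite ler_pdivrMr// mul1r; lra.
Qed.

End Weights.

(** * The sample average approximation *)

Lemma interior_row (R : realType) n (A : set 'rV[R]_n) (x : 'rV[R]_n) :
  A^° x -> exists2 e : R, 0 < e &
    forall y : 'rV[R]_n, (forall i, `|x 0 i - y 0 i| < e) -> A y.
Proof.
rewrite /interior => /nbhs_ballP[e /= e0 eA]; exists e => // y xy.
by apply: eA; split => // i j; rewrite (ord1 i) /ball/=; exact: xy.
Qed.

Section Assembly.
Context (R : realType) (d : measure_display) (Omega : measurableType d).
Variables (P : probability Omega R) (a b c M : R) (s : shape_type) (m l : nat).
Variables (phi : nat -> R -> R) (mu : nat -> R) (g : R -> R).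
Variables (X : nat -> {RV P >-> R}) (e : R).
Hypothesis acb : a < c < b.
Hypothesis M0 : 0 < M.
Hypothesis mphi : forall j, (j <= l)%N -> measurable_fun `[a, b] (phi j).
Hypothesis gd : prob_density a b g.
Hypothesis iX : iid_with_density a b g X.
Hypothesis ginf : 0 < inf [set g x | x in `[a, b]].
Hypothesis e0 : 0 < e.
Hypothesis phi2e : forall j, (j <= l)%N ->
  (\int[@lebesgue_measure R]_(x in `[a, b]) (`|phi j x| `^ (2 + e))%:E < +oo)%E.
Local Notation calL := (likelihood_ratios (shape_class s a b c M) g).
Local Notation N := (moment a b g phi).
Local Notation Nn n w :=
  (fun j L => sample_mean (fun i : 'I_n => phi j (X i w) * L (X i w))).
Local Notation mean k := (Rintegral P setT (fun w => k (X 0%N w))).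
Let psi j := extend0 a b (fun x => phi j x / g x).
Local Notation s2 j := (mean (fun x => psi j x ^+ 2)).

Let mpsi j (jl : (j <= l)%N) : measurable_fun setT (psi j) :=
  measurable_weight gd (mphi jl).
Let psi2 j (jl : (j <= l)%N) :=
  weight_sqr_integrable gd iX ginf (mphi jl) e0 (phi2e jl).
Let psi2i j (jl : (j <= l)%N) :=
  weight_sqr_ident gd iX ginf (mphi jl) e0 (phi2e jl).
Let indepX := iid_indep iX.
Let identX := iid_ident gd iX.

Lemma likelihood_ratios_mixture : closed_under_mixtures calL.
Proof.
move=> I w L LS w0 w1.
have /choice[f fP] : forall i, exists f, shape_class s a b c M f /\
    L i = (fun x => f x / g x) by move=> i; have [f fS LE] := LS i; exists f.
exists (fun x => \sum_i w i * f i x).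
  by apply: shape_class_mixture => // i; have [] := fP i.
apply/funext => x; rewrite mulr_suml; apply: eq_bigr => i _.
by have [_ ->] := fP i; rewrite mulrA.
Qed.

Let moment_ratio j f : (j <= l)%N -> shape_class s a b c M f ->
  N j (fun x => f x / g x) = mean (fun x => psi j x * extend0 a b f x).
Proof.
move=> jl fS; have [mf _] := bdd_shape M0 fS.
by rewrite /moment (moment_mean gd iX (mphi jl) mf).
Qed.

Let sample_ratio j f n w : (forall i, a < X i w < b) ->
  Nn n w j (fun x => f x / g x) =
  n%:R^-1 * \sum_(i < n) psi j (X i w) * extend0 a b f (X i w).
Proof.
move=> Xab; rewrite /sample_mean; congr (_ * _); apply: eq_bigr => i _.
have /andP[/ltW aX /ltW Xb] := Xab i.
by rewrite /psi !extend0E ?aX//; ring.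
Qed.

Lemma moment_affine j : (j <= l)%N -> affine_on calL (N j).
Proof.
move=> jl I w L LS w0 w1.
have /choice[f fP] : forall i, exists f, shape_class s a b c M f /\
    L i = (fun x => f x / g x) by move=> i; have [f fS LE] := LS i; exists f.
have fS i : shape_class s a b c M (f i) by have [] := fP i.
have LE i : L i = (fun x => f i x / g x) by have [] := fP i.
have -> : (fun x => \sum_i w i * L i x) = (fun x => (\sum_i w i * f i x) / g x).
  by apply/funext => x; rewrite mulr_suml; apply: eq_bigr => i _; rewrite LE mulrA.
rewrite moment_ratio//; last exact: shape_class_mixture.
have ii i : P.-integrable setT (EFin \o (fun v =>
    psi j (X 0%N v) * extend0 a b (f i) (X 0%N v))).
  have bf := bdd_shape M0 (fS i).
  exact: (psi_mul_integrable (mpsi jl) (psi2 jl) bf).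
transitivity (Rintegral P setT (fun v => \sum_i w i *
    (psi j (X 0%N v) * extend0 a b (f i) (X 0%N v)))).
  apply: eq_Rintegral => v _; rewrite [in LHS]/extend0; case: ifP => h.
    rewrite mulr_sumr; apply: eq_bigr => i _; rewrite mulrCA.
    by rewrite extend0E.
  by rewrite mulr0 big1// => i _; rewrite /extend0 h !mulr0.
rewrite Rintegral_sum; last by move=> i; exact: integrable_EFinZ.
by apply: eq_bigr => i _; rewrite RintegralZl// LE moment_ratio.
Qed.

Lemma sample_affine n w j : affine_on calL (Nn n w j).
Proof.
move=> I v L _ _ _; rewrite /sample_mean.
under eq_bigr do rewrite mulr_sumr.
rewrite exchange_big/= mulr_sumr; apply: eq_bigr => i _.
rewrite mulrCA; congr (_ * _); rewrite mulr_sumr.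
by apply: eq_bigr => k _; rewrite mulrCA.
Qed.

Lemma moment_bounded : exists B : R, forall j L, (j <= l)%N -> calL L ->
  `|N j L| <= B.
Proof.
exists (\sum_(j < l.+1) M * mean (fun x => `|psi j x|)) => j L jl [f fS ->].
rewrite moment_ratio//.
have bf := bdd_shape M0 fS.
have ii := psi_mul_integrable (mpsi jl) (psi2 jl) bf.
have ip : P.-integrable setT (EFin \o (fun v => `|psi j (X 0%N v)|)).
  exact: integrable_norm (psi_integrable (mpsi jl) (psi2 jl)).
apply: (@le_trans _ _ (M * mean (fun x => `|psi j x|))).
  apply: (le_trans (le_normr_Rintegral measurableT ii)).
  rewrite -RintegralZl//; apply: le_Rintegral => //.
  - exact: integrable_norm ii.
  - exact: integrable_EFinZ.
  move=> v _; have [fM _] := fS.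
  have /andP[f0 f1] := extend0_bounds M0 fM (X 0%N v).
  by rewrite normrM mulrC (ger0_norm f0) ler_wpM2r.
have jl' : (j < l.+1)%N by [].
rewrite (bigD1 (Ordinal jl'))//= lerDl sumr_ge0// => i _.
by rewrite mulr_ge0 ?(ltW M0)//; apply: exp_ge0.
Qed.

(** Runs through all rationals; codes that do not decode fall back on 0. *)
Let q k : R := ratr (odflt 0 (choice.unpickle k : option rat)).

Definition out_of_range := \bigcup_i [set w | ~ (a < X i w < b)].

(** The null event of a sample outside the open interval is included, so that off [bad] the
    estimates hold for every outcome and not just almost surely. *)
Definition bad n (t : R) := out_of_range `|`
  \big[setU/set0]_(j < l.+1) [set w | deviates X (psi j) n (n%:R * t) q w].

Let mout i : measurable [set w | ~ (a < X i w < b)].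
Proof.
rewrite (_ : [set w | _] = X i @^-1` (~` `]a, b[)); last first.
  by apply/seteqP; split => w /=; rewrite in_itv.
by rewrite -[X in measurable X]setTI; apply: measurable_funP => //; exact: measurableC.
Qed.

Let mout_of_range : measurable out_of_range.
Proof. by apply: bigcup_measurable => i _. Qed.

Let out_of_range0 : P out_of_range = 0%E.
Proof.
apply: measure_negligible => //; apply: negligible_bigcup => i.
apply/negligibleP => //; have [_ dX] := iX.
exact: RV_in_oo gd (dX i).
Qed.

Lemma measurable_bad n t : measurable (bad n t).
Proof.
apply: measurableU => //; apply: bigsetU_measurable => j _.
by apply: measurable_deviates; apply: mpsi; rewrite -ltnS.
Qed.

(** The constant is [12 = 4 * 3]: 4 from [shape_deviation], 3 from the threshold in [deviates]. *)
Lemma moment_deviation n t w j L : (0 < n)%N -> 0 < t -> ~ bad n t w ->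
  (j <= l)%N -> calL L -> `|Nn n w j L - N j L| <= 12 * M * t.
Proof.
move=> n0 t0 /not_orP[nout ndev] jl [f fS ->].
have Xab i : a < X i w < b.
  by apply: contrapT => h; apply: nout; exists i.
have n0' : 0 < n%:R :> R by rewrite ltr0n.
rewrite sample_ratio// moment_ratio//.
have -> : n%:R^-1 * \sum_(i < n) psi j (X i w) * extend0 a b f (X i w) -
    mean (fun x => psi j x * extend0 a b f x) =
    n%:R^-1 * deviation X n (fun x => psi j x * extend0 a b f x) w.
  by rewrite /deviation; field; rewrite gt_eqF.
rewrite normrM (@ger0_norm _ n%:R^-1) ?invr_ge0 ?ler0n// ler_pdivrMl//.
have ratD (r : rat) :
    `|deviation X n (fun x => psi j x * \1_`]-oo, ratr r] x) w| <= 3 * (n%:R * t).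
  rewrite leNgt; apply/negP => h; apply: ndev.
  apply: (@bigsetU_sup _ j l.+1
    (fun j => [set w | deviates X (psi j) n (n%:R * t) q w])) => //=.
  by exists (choice.pickle r); rewrite /q choice.pickleK.
have := shape_deviation M0 gd iX ginf (mphi jl) e0 (phi2e jl) ratD fS.
by move=> h; apply: (le_trans h); rewrite le_eqVlt; apply/orP; left; apply/eqP; ring.
Qed.

Lemma prob_bad : exists2 K : R, 0 <= K & forall n t, (0 < n)%N -> 0 < t ->
  (P (bad n t) <= (K / (n%:R * t ^+ 2))%:E)%E.
Proof.
exists (\sum_(j < l.+1) (24 * 11 ^+ 4 + 2) * s2 j).
  apply: sumr_ge0 => j _; apply: mulr_ge0.
    by rewrite addr_ge0// mulr_ge0// exprn_ge0.
  by apply: exp_ge0 => w; exact: sqr_ge0.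
move=> n t n0 t0; have n0' : 0 < n%:R :> R by rewrite ltr0n.
have mdev (j : 'I_l.+1) : measurable [set w | deviates X (psi j) n (n%:R * t) q w].
  by apply: measurable_deviates; apply: mpsi; rewrite -ltnS.
apply: (le_trans (measureU2 _ _ _)) => //; first exact: bigsetU_measurable.
rewrite [X in (X + _)%E](out_of_range0 : _ = 0%E) add0e.
apply: (@le_trans _ _ (\sum_(j < l.+1)
    ((24 * 11 ^+ 4 + 2) * s2 j / (n%:R * t ^+ 2))%:E)%E); last first.
  by rewrite sumEFin mulr_suml.
apply: (le_trans (Boole_inequality P
  (A := fun j => [set w | deviates X (psi j) n (n%:R * t) q w]) _)) => //.
  by move=> j jl; exact: (mdev (Ordinal jl)).
apply: lee_sum => j _.
have jl : (j <= l)%N by rewrite -ltnS.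
have nt0 : 0 < n%:R * t by rewrite mulr_gt0.
apply: (le_trans (countable_deviation indepX identX (mpsi jl) (psi2 jl) n q nt0)).
rewrite lee_fin le_eqVlt; apply/orP; left; apply/eqP.
by field; rewrite !gt_eqF.
Qed.

Lemma eventually_not_bad t : 0 < t ->
  \forall w \ae P, \forall n \near \oo, ~ bad n t w.
Proof.
move=> t0.
have h1 : \forall w \ae P, ~ out_of_range w.
  exists out_of_range; split => // w /= /contrapT; exact.
have h2 : \forall w \ae P, forall j : 'I_l.+1,
    \forall n \near \oo, ~ deviates X (psi j) n (n%:R * t) q w.
  apply: filter_forall => j; have jl : (j <= l)%N by rewrite -ltnS.
  have := eventually_not_deviates indepX identX (mpsi jl) (psi2 jl) (psi2i jl) q t0.
  exact.
apply: filterS2 h1 h2 => w nout /filter_forall ndev.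
apply: filterS ndev => n ndev [//|].
rewrite -(bigcup_mkord _ (fun j => [set w | deviates X (psi j) n (n%:R * t) q w])).
by move=> -[j /= jl]; exact: (ndev (Ordinal jl)).
Qed.

Lemma reduction_ae : \forall w \ae P, forall n, (0 < n)%N ->
  finitely_reducible calL (fun i : 'I_n => X i w)
    (discrete_shape a b c M g (fun i : 'I_n => X i w) s).
Proof.
have h1 : \forall w \ae P, ~ out_of_range w.
  exists out_of_range; split => // w /= /contrapT; exact.
have h2 : \forall w \ae P, forall i j : nat, i != j -> X i w <> X j w.
  apply: ae_foralln => i; apply: ae_foralln => j.
  have [->|ij] := eqVneq i j; first exact: aeW.
  exists [set w | X i w = X j w]; split.
  - rewrite (_ : [set w | _] = setT `&` (fun w => X i w - X j w) @^-1` [set 0]).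
      by apply: measurable_funB => //; exact: measurable_set1.
    by apply/seteqP; split => w /=; [move=> ->; rewrite subrr|move=> [_ /subr0_eq]].
  - by apply: no_ties ij; exact: iX.
  - by move=> w /= h; apply: contrapT => h'; apply: h => _; exact: h'.
apply: filterS2 h1 h2 => w nout noties [//|n] _.
have [_ g0 _] := gd.
apply: (shape_reducible acb M0 g0).
  move=> i j Xij; apply/val_inj/eqP; apply: contrapT => /negP ij.
  exact: noties ij Xij.
by move=> i; apply: contrapT => h; apply: nout; exists i.
Qed.

End Assembly.

Theorem corollary1 (R : realType) (d : measure_display)
    (Omega : measurableType d) (P : probability Omega R)
    (a b c M : R) (s : shape_type) (m l : nat)
    (phi : nat -> R -> R) (mu : nat -> R) (g : R -> R)
    (X : nat -> {RV P >-> R})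
    (calL := likelihood_ratios (shape_class s a b c M) g)
    (sample := fun (n : nat) (w : Omega) (i : 'I_n) => X i w)
    (vP := val_P a b g phi mu m l calL)
    (vPn := fun (n : nat) (w : Omega) =>
              val_Pn phi mu m l calL (sample n w)) :
  a < c < b -> 0 < M -> (m <= l)%N ->
  (forall j, (j <= l)%N -> measurable_fun `[a, b] (phi j)) ->
  (exists2 j, (1 <= j <= l)%N & forall x, a <= x <= b -> phi j x = 1) ->
  prob_density a b g ->
  iid_with_density a b g X ->
  0 < inf [set g x | x in `[a, b]] ->
  (exists2 delta : R, 0 < delta & forall j, (j <= l)%N ->
    (\int[@lebesgue_measure R]_(x in `[a, b])
       (`|phi j x| `^ (2 + delta))%:E < +oo)%E) ->
  (exists2 L0, calL L0 &
    (forall j, (1 <= j <= m)%N -> moment a b g phi j L0 < mu j) /\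
    (forall j, (m < j <= l)%N -> moment a b g phi j L0 = mu j)) ->
  interior [set eq_moments a b g phi m l L | L in calL]
    (\row_(i < l - m) mu (m + i).+1) ->
  [/\ \forall w \ae P, forall n, (0 < n)%N ->
        finitely_reducible calL (sample n w)
          (discrete_shape a b c M g (sample n w) s) /\
        vPn n w = val_Pn' phi mu m l (sample n w)
                    (discrete_shape a b c M g (sample n w) s),
      outer_as_cvg P (fun n w => `|vPn n w - vP|%E) (fun _ => 0%E)
    & outer_bounded_in_prob P
        (fun n w => ((Num.sqrt n%:R)%:E * (vPn n w - vP))%E)].
Proof.
move=> acb M0 ml mphi _ gd iX ginf [e e0 phi2e] [L0 L0S [L0lt L0eq]] intmu.
have [B NB] := moment_bounded c s M0 mphi gd iX ginf e0 phi2e.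
have [r r0 rV] := interior_row intmu.
(* Vertices of a cross-polytope around the target; the radius is halved because the ball inside the
   moment set is open. *)
have /choice[V VP] : forall kb : 'I_(l - m) * bool, exists L, calL L /\
    forall i : 'I_(l - m), moment a b g phi (m + i).+1 L =
      mu (m + i).+1 + (-1) ^+ kb.2 * (i == kb.1)%:R * (r / 2).
  move=> [k bk] /=.
  pose u : 'rV[R]_(l - m) :=
    \row_(i < l - m) (mu (m + i).+1 + (-1) ^+ bk * (i == k)%:R * (r / 2)).
  have [|L LS Lu] := rV u.
    move=> i; rewrite !mxE opprD addNKr normrN !normrM normr_sign mul1r.
    rewrite ger0_norm ?ler0n// (@ger0_norm _ 2^-1)// (ger0_norm (ltW r0)).
    by case: (i == k); rewrite ?mul0r// mul1r; lra.
  exists L; split => // i.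
  by have := congr1 (fun v : 'rV_(l - m) => v 0 i) Lu; rewrite !mxE.
have Naff j (jl : (j <= l)%N) :=
  moment_affine (c := c) (s := s) M0 mphi gd iX ginf e0 phi2e jl.
have r20 : 0 < r / 2 by rewrite divr_gt0.
have [C [t [C0 t0 stable]]] := optimal_value_stable (V := fun k bk => V (k, bk)) ml
  (@likelihood_ratios_mixture _ a b c M s g)
  Naff NB L0S L0lt L0eq r20
  (fun k bk => (VP (k, bk)).1) (fun i k bk => (VP (k, bk)).2 i).
have M12 : 0 < 12 * M by rewrite mulr_gt0.
have C12 : 0 < C * (12 * M) by rewrite mulr_gt0.
(* For levels up to this bound the moment error [12 * M * x] stays within the radius [t] where the
   value is Lipschitz. *)
have eta0 : 0 < t / (12 * M) by rewrite divr_gt0.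
have mbad := measurable_bad X mphi gd.
have near n x w : (0 < n)%N -> 0 < x <= t / (12 * M) ->
    ~ bad a b l phi g X n x w -> (`|vPn n w - vP| <= (C * (12 * M) * x)%:E)%E.
  move=> n0 /andP[x0 xt] nb; rewrite -mulrA; apply: stable.
  - by move=> j _; exact: sample_affine.
  - by rewrite mulr_gt0//= mulrC -ler_pdivlMr.
  - move=> j L jl LS.
    exact: (moment_deviation M0 mphi gd iX ginf e0 phi2e n0 x0 nb jl LS).
have [K K0 PK] := prob_bad mphi gd iX ginf e0 phi2e.
have ae := eventually_not_bad mphi gd iX ginf e0 phi2e.
split.
- apply: filterS (reduction_ae s acb M0 gd iX) => w red n n0.
  by split; [exact: red|apply: val_Pn_reduction; exact: red].
- exact: outer_as_cvg_of_bad eta0 mbad near ae.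
- exact: outer_bounded_of_bad C12 K0 eta0 mbad near PK.
Qed.
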